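(* Let $\rho\in L^1(\mathbb{R}^n)$ satisfy $\int_{\mathbb{R}^n}\rho=1$, and let $0<s<1$. If $\rho$ satisfies the moment condition $$\int_{\mathbb{R}^n}|y|^s|\rho(y)|\,dy<\infty,$$ then $\rho$ characterizes all the spaces $B^s_{p,q}$ (in the sense defined in the context), that is, for every $1\le p\le\infty$ and every $1\le q<\infty$, $$\|f\|_{B^{s}_{p,q}}^q\sim \|f\|_{L^p}^q+\int_0^1\frac 1{\varepsilon^{sq+1}}\|f-f\ast\rho_\varepsilon\|_{L^p}^q\, d\varepsilon .$$
   Context: For a function $g$ on $\mathbb{R}^n$ and $\varepsilon>0$, $g_\varepsilon(x)=\varepsilon^{-n}g(x/\varepsilon)$. Besov norm. Fix Schwartz functions $\zeta,\varphi\in\mathcal{S}(\mathbb{R}^n)$ with $\operatorname{supp}\widehat\zeta\subset B(0,2)$, $\widehat\zeta\equiv1$ in a neighborhood of $\overline{B}(0,1)$, and $\varphi:=\zeta_{1/2}-\zeta$, so that $\widehat\varphi=\widehat\zeta(\cdot/2)-\widehat\zeta$ and $\operatorname{supp}\widehat\varphi\subset B(0,4)\setminus\overline{B}(0,1)$. The (inhomogeneous) Littlewood-Paley decomposition of a temperate distribution $f$ is $f=\sum_{j\ge0}f_j$ with $f_0=f\ast\zeta$ and $f_j=f\ast\varphi_{2^{1-j}}$ for $j\ge1$. For $f\in L^p$ and $1\le q<\infty$, set $|f|_{B^s_{p,q}}^q=\sum_{j\ge0}2^{sjq}\|f_j\|_{L^p}^q$ and $\|f\|_{B^s_{p,q}}^q=\|f\|_{L^p}^q+|f|_{B^s_{p,q}}^q$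 (possibly $+\infty$). Characterization property. For $\rho\in L^1(\mathbb{R}^n)$ with $\int\rho=1$ and $s>0$, we say that $\rho$ characterizes all the spaces $B^s_{p,q}$ if for every $1\le p\le\infty$ and every $1\le q<\infty$, $$\|f\|_{B^{s}_{p,q}}^q\sim \|f\|_{L^p}^q+\int_0^1\frac 1{\varepsilon^{sq+1}}\|f-f\ast\rho_\varepsilon\|_{L^p}^q\, d\varepsilon,$$ i.e. there is a constant $C\in[1,\infty)$ (which may depend on $\rho,s,p,q,n$ but not on $f$) such that for every $f\in L^p(\mathbb{R}^n)$ each side, as an element of $[0,\infty]$, is at most $C$ times the other. *)

(* Defs.v *)
From HB Require Import structures.
From mathcomp Require Import all_boot all_order all_algebra.
From mathcomp Require Import all_classical all_reals all_analysis.
From mathcomp Require Import complex.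

Set Implicit Arguments.
Unset Strict Implicit.
Unset Printing Implicit Defensive.

Import Order.TTheory GRing.Theory Num.Theory.
Import numFieldNormedType.Exports.

Local Open Scope classical_set_scope.
Local Open Scope ring_scope.

Definition rV_display : measure_display.
Proof. exact: default_measure_display. Qed.

(* 'rV[R]_n carries the sigma-algebra generated by the coordinates, as the
   library does for n.-tuple R; on R^n this is the Borel sigma-algebra. *)
Section measurable_rV.
Context {R : realType} (n : nat).

Definition rV_coord (i : 'I_n) (x : 'rV[R]_n) : R := x 0 i.

Let rV_set0 : g_sigma_preimage rV_coord set0.
Proof. exact: sigma_algebra0. Qed.

Let rV_setC A : g_sigma_preimage rV_coord A -> g_sigma_preimage rV_coord (~` A).
Proof. exact: sigma_algebraC. Qed.

Let rV_bigcup (F : _^nat) : (forall i, g_sigma_preimage rV_coord (F i)) ->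
  g_sigma_preimage rV_coord (\bigcup_i (F i)).
Proof. exact: sigma_algebra_bigcup. Qed.

HB.instance Definition _ := @isMeasurable.Build rV_display
  'rV[R]_n (g_sigma_preimage rV_coord) rV_set0 rV_setC rV_bigcup.

Lemma measurable_rV_coord (i : 'I_n) :
  measurable_fun [set: 'rV[R]_n] (fun x : 'rV[R]_n => x 0 i).
Proof.
move=> _ Y mY; rewrite setTI; apply: sub_sigma_algebra => /=.
rewrite -bigcup_seq/=; exists i => /=; first by rewrite mem_index_enum.
by exists Y => //; rewrite setTI.
Qed.

Lemma measurable_fun_rV d (T : measurableType d) (f : T -> 'rV[R]_n) :
  (forall i, measurable_fun [set: T] (fun t => f t 0 i)) ->
  measurable_fun [set: T] f.
Proof.
move=> mf; apply: (@measurability _ _ _ _ _ _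
  (\big[setU/set0]_(i < n) preimage_set_system setT (rV_coord i) measurable)) => //.
move=> _ [A + <-]; rewrite -bigcup_seq => -[i _ [B mB <-]].
by rewrite setTI; exact: mf.
Qed.

End measurable_rV.

Section lebesgue_rV.
Context {R : realType}.

Definition rV_cons n (z : 'rV[R]_n * R) : 'rV[R]_n.+1 :=
  \row_i (if unlift ord0 i is Some j then z.1 0 j else z.2).

Lemma measurable_rV_cons n :
  measurable_fun [set: 'rV[R]_n * R] (@rV_cons n).
Proof.
apply: measurable_fun_rV => i; under eq_fun do rewrite mxE.
case: (unlift ord0 i) => [j|]; last exact: measurable_snd.
exact: (measurableT_comp (measurable_rV_coord j) measurable_fst).
Qed.

Definition rV_uncons n (x : 'rV[R]_n.+1) : 'rV[R]_n * R :=
  (\row_j x 0 (lift ord0 j), x 0 ord0).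

Lemma rV_consK n : cancel (@rV_cons n) (@rV_uncons n).
Proof.
move=> [x t]; congr pair; last by rewrite mxE unlift_none.
by apply/rowP => j; rewrite !mxE liftK.
Qed.

Lemma measurable_rV_uncons n : measurable_fun [set: 'rV[R]_n.+1] (@rV_uncons n).
Proof.
have m1 : measurable_fun [set: 'rV[R]_n.+1]
    (fun x => \row_(j < n) x 0 (lift ord0 j)).
  apply: measurable_fun_rV => j; under eq_fun do rewrite mxE.
  exact: measurable_rV_coord.
exact: measurable_fun_pair m1 (measurable_rV_coord ord0).
Qed.

Section rV_product.
Variables (n : nat) (m : {sigma_finite_measure set 'rV[R]_n -> \bar R}).

Definition rV_product : set 'rV[R]_n.+1 -> \bar R :=
  pushforward (product_measure1 m (@lebesgue_measure R)) (@rV_cons n).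

Let rV_product0 : rV_product set0 = 0%E.
Proof. by rewrite /rV_product /pushforward preimage_set0 measure0. Qed.

Let rV_product_ge0 A : (0 <= rV_product A)%E.
Proof.
exact: (measure_ge0 (m \x @lebesgue_measure R)%E).
Qed.

Let measurable_rV_cons_preimage (A : set 'rV[R]_n.+1) :
  measurable A -> measurable (@rV_cons n @^-1` A).
Proof. by move=> mA; rewrite -[X in measurable X]setTI; exact: measurable_rV_cons. Qed.

Let rV_product_sigma_additive : semi_sigma_additive rV_product.
Proof.
move=> F mF tF mUF; rewrite /rV_product /pushforward preimage_bigcup.
apply: measure_semi_sigma_additive.
- by move=> k; exact: measurable_rV_cons_preimage.
- apply/trivIsetP => /= i j _ _ ij; rewrite -preimage_setI.
  by move/trivIsetP : tF => /(_ _ _ _ _ ij) ->//; rewrite preimage_set0.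
- by rewrite -preimage_bigcup; exact: measurable_rV_cons_preimage.
Qed.

HB.instance Definition _ := isMeasure.Build _ _ _ rV_product
  rV_product0 rV_product_ge0 rV_product_sigma_additive.

Let rV_product_sigma_finite : sigma_finite setT rV_product.
Proof.
have /sigma_finiteP[F [FT ndF Foo]] := sigma_finiteT m.
have /sigma_finiteP[G [GT ndG Goo]] := sigma_finiteT (@lebesgue_measure R).
exists (fun k => @rV_uncons n @^-1` (F k `*` G k)).
  rewrite -preimage_bigcup (_ : \bigcup_k _ = setT) ?preimage_setT//.
  apply/seteqP; split => // -[x t] _.
  have [a _ Fax] : (\bigcup_k F k) x by rewrite -FT.
  have [b _ Gbt] : (\bigcup_k G k) t by rewrite -GT.
  exists (maxn a b) => //; split.
  - by move: x Fax; exact/subsetPset/ndF/leq_maxl.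
  - by move: t Gbt; exact/subsetPset/ndG/leq_maxr.
move=> k; have [mF Fk] := Foo k; have [mG Gk] := Goo k; split.
  rewrite -[X in measurable X]setTI.
  exact: (measurable_rV_uncons measurableT (measurableX mF mG)).
rewrite /rV_product /pushforward -comp_preimage.
rewrite (_ : _ \o _ = id); last by apply/funext => z; exact: rV_consK.
by rewrite preimage_id product_measure1E// lte_mul_pinfty// ge0_fin_numE.
Qed.

HB.instance Definition _ := Measure_isSigmaFinite.Build _ _ _ rV_product
  rV_product_sigma_finite.

End rV_product.

(* Lebesgue measure on R^n as an iterated product (on Borel sets). *)
Fixpoint lebesgue_rV (n : nat) : {sigma_finite_measure set 'rV[R]_n -> \bar R} :=
  if n is m.+1 then rV_product (lebesgue_rV m) else \d_(0 : 'rV[R]_0).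

Lemma lebesgue_rV_box n (A : 'I_n -> set R) : (forall i, measurable (A i)) ->
  lebesgue_rV n [set x : 'rV[R]_n | forall i, A i (x 0 i)]
  = (\prod_(i < n) @lebesgue_measure R (A i))%E.
Proof.
elim: n => [|n IH] in A * => mA.
  rewrite big_ord0 /= diracE (_ : _ \in _ = true)//.
  by apply/mem_set => -[].
have mB : measurable [set x : 'rV[R]_n | forall i, A (lift ord0 i) (x 0 i)].
  rewrite (_ : mkset _ =
    \bigcap_(i in [set: 'I_n]) [set x : 'rV[R]_n | A (lift ord0 i) (x 0 i)]).
    apply: fin_bigcap_measurable => // i _.
    rewrite -[X in measurable X]setTI.
    exact: (measurable_rV_coord i measurableT (mA (lift ord0 i))).
  by apply/seteqP; split => [x /= h i _|x /= h i]; exact: h.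
rewrite big_ord_recl muleC.
rewrite -(IH (fun i => A (lift ord0 i))) => [|i]; last exact: mA.
rewrite /= /rV_product /pushforward.
rewrite -[RHS](product_measure1E (lebesgue_rV n)
  (@lebesgue_measure R) mB (mA ord0)).
congr product_measure1; apply/seteqP; split => -[x t] /=.
  move=> h; split => [i|]; first by have := h (lift ord0 i); rewrite mxE liftK.
  by have := h ord0; rewrite mxE unlift_none.
move=> [h1 h2] i; rewrite mxE.
by case: unliftP => [j ->|->].
Qed.

End lebesgue_rV.

Section function_spaces.
Context {R : realType} {n : nat}.
Implicit Types (x y xi : 'rV[R]_n) (f g : 'rV[R]_n -> R[i]) (p : \bar R).

Local Notation mu := (@lebesgue_rV R n).

(* The library norm on 'rV[R]_n is the sup norm; the dot product and the
   Euclidean norm have to be written out. *)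
Definition dotp x y : R := \sum_(i < n) x 0 i * y 0 i.

Definition enorm x : R := Num.sqrt (dotp x x).

Definition cmeasurable f :=
  measurable_fun [set: 'rV[R]_n] (fun x => complex.Re (f x)) /\
  measurable_fun [set: 'rV[R]_n] (fun x => complex.Im (f x)).

Definition cintegral f : R[i] :=
  Complex (\int[mu]_x complex.Re (f x)) (\int[mu]_x complex.Im (f x)).

Definition Lp_norm p f : \bar R := 'N[mu]_p[(fun x => (Normc.normc (f x))%:E)]%E.

Definition in_Lp p f := cmeasurable f /\ (Lp_norm p f < +oo)%E.

(* For f in L^p and g in L^1 the integral converges for almost every x. *)
Definition convolution f g : 'rV[R]_n -> R[i] :=
  fun x => cintegral (fun y => f (x - y) * g y).

Definition dilate (eps : R) g : 'rV[R]_n -> R[i] :=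
  fun x => (eps ^- n)%:C%C * g (eps^-1 *: x).

(* Convention: \hat g(xi) = \int e^{- i x . xi} g(x) dx. *)
Definition fourier g : 'rV[R]_n -> R[i] :=
  fun xi => cintegral (fun x =>
    Complex (cos (dotp x xi)) (- sin (dotp x xi)) * g x).

(* Partial derivatives of arbitrary order; requiring all of them to be
   differentiable everywhere is smoothness. *)
Definition partials (l : seq 'I_n) (h : 'rV[R]_n -> R) : 'rV[R]_n -> R :=
  foldr (fun i (k : 'rV[R]_n -> R) x => 'D_(delta_mx 0 i) k x) h l.

Definition real_schwartz (h : 'rV[R]_n -> R) :=
  forall l : seq 'I_n,
    (forall x, differentiable (partials l h) x) /\
    forall k : nat, exists M : R,
      forall x, enorm x ^+ k * `|partials l h x| <= M.

Definition schwartz g :=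
  real_schwartz (fun x => complex.Re (g x)) /\
  real_schwartz (fun x => complex.Im (g x)).

Definition LP_generator (zeta : 'rV[R]_n -> R[i]) :=
  [/\ schwartz zeta,
      closure [set xi | fourier zeta xi != 0] `<=` [set xi | enorm xi < 2]
    & exists U : set 'rV[R]_n,
        [/\ open U, [set xi | enorm xi <= 1] `<=` U
          & forall xi, U xi -> fourier zeta xi = 1]].

Definition LP_phi (zeta : 'rV[R]_n -> R[i]) := dilate 2^-1 zeta \- zeta.

(* For j = k + 1 the scale 2^(1 - j) is 2^-k. *)
Definition LP_piece (zeta f : 'rV[R]_n -> R[i]) (j : nat) : 'rV[R]_n -> R[i] :=
  if j is k.+1 then convolution f (dilate (2 ^- k) (LP_phi zeta))
  else convolution f zeta.

(* q-th powers of the Besov seminorm |f|_{B^s_{p,q}} and norm, in [0, +oo]. *)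
Definition besov_seminorm_pow (zeta : 'rV[R]_n -> R[i]) (s : R) p (q : R) f
    : \bar R :=
  (\sum_(0 <= j <oo)
     ((2 `^ (s * j%:R * q))%:E * (Lp_norm p (LP_piece zeta f j)) `^ q))%E.

Definition besov_norm_pow (zeta : 'rV[R]_n -> R[i]) (s : R) p (q : R) f
    : \bar R :=
  ((Lp_norm p f) `^ q + besov_seminorm_pow zeta s p q f)%E.

Definition mollifier_pow (rho : 'rV[R]_n -> R[i]) (s : R) p (q : R) f
    : \bar R :=
  ((Lp_norm p f) `^ q +
   \int[lebesgue_measure]_(eps in `]0%R, 1%R[)
     (((eps `^ (s * q + 1))^-1)%:E *
      (Lp_norm p (f \- convolution f (dilate eps rho))%R) `^ q))%E.

Definition characterizes_besov (zeta rho : 'rV[R]_n -> R[i]) (s : R) :=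
  forall p (q : R), (1 <= p)%E -> 1 <= q ->
    exists C : R, 1 <= C /\
      forall f, in_Lp p f ->
        (besov_norm_pow zeta s p q f <= C%:E * mollifier_pow rho s p q f)%E /\
        (mollifier_pow rho s p q f <= C%:E * besov_norm_pow zeta s p q f)%E.

End function_spaces.

(* Main.v *)
(* Write Z_j for the dilate of zeta at scale 2^-j, so that f_j = f * psi_j with
   psi_j = Z_j - Z_{j-1}. Since the Fourier transform of Z_{j+1} is 1 on the
   support of that of psi_j, psi_j * Z_{j+1} = psi_j, and the j-th piece of
   u = f - f * rho_eps is u_j = f_j * (Z_{j+1} - Z_{j+1} * rho_eps). As zeta is
   Lipschitz in L^1, the L^1 norm of the last factor is at most
   C m(2^(j+1) eps) with m(t) = int min(1, t|y|) |rho(y)| dy. Together with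
   ||u||_p <= sum_j ||u_j||_p and the summation of eps over dyadic intervals,
   this bounds the mollification integral by Schur's test for the kernel
   t^-s m(t), t = 2^(j+1-k); its row and column sums are controlled by the moment
   of rho because sum_i (2^i c)^-s min(1, 2^i c r) <= C r^s uniformly in c.

   Conversely psi_j = psi_j * chi_j with chi_j = Z_{j+1} - Z_{j-2} of integral 0, hence
   f_j = u * psi_j + f_j * (chi_j * rho_eps), and the L^1 norm of chi_j * rho_eps
   is at most 1/2 once 2^j eps is large, by continuity of translations in
   L^1. Thus ||f_j||_p <= C ||u||_p for all eps comparable to 2^-j, and the
   finitely many remaining j are bounded by Young's inequality. *)

Require Import Defs.
From mathcomp Require Import all_boot all_order all_algebra.
From mathcomp Require Import all_classical all_reals all_analysis.
From mathcomp Require Import complex measurable_realfun ess_sup_inf.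
From mathcomp Require Import ring lra.

Set Implicit Arguments.
Unset Strict Implicit.
Unset Printing Implicit Defensive.

Import Order.TTheory GRing.Theory Num.Theory.
Import numFieldNormedType.Exports.

Local Open Scope classical_set_scope.
Local Open Scope ring_scope.

Import Normc.

Section lebesgue_change_of_variables.
Context {R : realType}.
Local Open Scope ereal_scope.

Local Notation leb := (@lebesgue_measure R).
Local Notation mu n := (@lebesgue_rV R n).

Lemma measurable_affine1 (c b : R) :
  measurable_fun [set: R] (fun x : R => (c * x + b)%R).
Proof. by apply: measurable_funD => //; exact: measurable_funM. Qed.

Lemma lebesgue_affine (c b : R) (A : set R) : c != 0%R -> measurable A ->
  (leb ((fun x : R => c * x + b)%R @^-1` A) = (`|c|^-1)%:E * leb A)%E.
Proof.
move=> c0 mA.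
have nc0 : (0 < `|c|)%R by rewrite normr_gt0.
pose phi : R -> measurableTypeR R := (fun x : R => c * x + b)%R.
have mphi : measurable_fun setT phi by exact: measurable_affine1.
pose k : {nonneg R} := NngNum (ltW nc0).
pose M := @measure_function_pushforward__canonical__measure_function_Measure
  _ _ (measurableTypeR R) (measurableTypeR R) R leb phi mphi.
suff -> : leb A = mscale k M A.
  by rewrite /mscale/= muleA -EFinM mulVf ?gt_eqF// mul1e.
refine (@lebesgue_measure_unique R (mscale k M) _ A mA).
move=> _ [[x y] _ <-].
change (leb `]x, y]%classic = `|c|%:E * leb (phi @^-1` `]x, y]%classic)).
have [c_gt0|c_lt0|/eqP] := ltgtP 0%R c; last by rewrite eq_sym (negbTE c0).
- rewrite (_ : phi @^-1` _ = `](x - b) / c, (y - b) / c]%classic)%R; last first.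
    apply/seteqP; split => z /=; rewrite !in_itv/= /phi.
      by rewrite ltr_pdivrMr// ler_pdivlMr// ltrBlDr lerBrDr (mulrC z).
    by rewrite ltr_pdivrMr// ler_pdivlMr// ltrBlDr lerBrDr (mulrC z).
  rewrite !lebesgue_measure_itv/= !lte_fin ltr_pM2r ?invr_gt0// ltrD2r.
  case: ifPn => xy; last by rewrite mule0.
  rewrite -!EFinB -EFinM; congr EFin; rewrite gtr0_norm//.
  by rewrite -mulrBl mulrC mulfVK// opprB addrA subrK.
- rewrite (_ : phi @^-1` _ = `[(y - b) / c, (x - b) / c[%classic)%R; last first.
    apply/seteqP; split => z /=; rewrite !in_itv/= /phi.
      by rewrite ltr_ndivlMr// ler_ndivrMr// ltrBlDr lerBrDr (mulrC z) andbC.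
    by rewrite ltr_ndivlMr// ler_ndivrMr// ltrBlDr lerBrDr (mulrC z) andbC.
  rewrite !lebesgue_measure_itv/= !lte_fin ltr_nM2r ?invr_lt0// ltrD2r.
  case: ifPn => xy; last by rewrite mule0.
  rewrite -!EFinB -EFinM; congr EFin; rewrite ltr0_norm//.
  by rewrite -mulrBl mulrC mulrN mulfVK// !opprB addrA; ring.
Qed.

Lemma ge0_integral_affine1 (c b : R) (g : R -> \bar R) : c != 0%R ->
  measurable_fun setT g -> (forall x, 0 <= g x) ->
  \int[leb]_x g (c * x + b)%R = (`|c|^-1)%:E * \int[leb]_x g x.
Proof.
move=> c0 mg g0.
have nc0 : (0 < `|c|)%R by rewrite normr_gt0.
pose phi : R -> measurableTypeR R := (fun x : R => c * x + b)%R.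
have mphi : measurable_fun setT phi by exact: measurable_affine1.
have ki : (0 <= `|c|^-1)%R by rewrite invr_ge0 ltW.
pose k : {nonneg R} := NngNum ki.
rewrite -(ge0_integral_mscale leb measurableT k)//.
have /= <- := @ge0_integral_pushforward _ _ (measurableTypeR R) (measurableTypeR R) R phi mphi leb setT g
  measurableT mg (in1W g0).
apply: eq_measure_integral => A mA _.
exact: (lebesgue_affine b c0 mA).
Qed.

Lemma ge0_integral_rVS n (g : 'rV[R]_n.+1 -> \bar R) :
  measurable_fun setT g -> (forall x, 0 <= g x) ->
  \int[mu n.+1]_x g x = \int[mu n]_x \int[leb]_t g (rV_cons (x, t)).
Proof.
move=> mg g0.
have /= -> := @ge0_integral_pushforward _ _ ('rV[R]_n * measurableTypeR R)%type _ R _ (@measurable_rV_cons R n)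
  (product_measure1 (mu n) leb) setT g measurableT mg (in1W g0).
rewrite fubini_tonelli1//.
exact: measurableT_comp mg (@measurable_rV_cons R n).
Qed.

Lemma measurable_affine n (c : R) (b : 'rV[R]_n) :
  measurable_fun setT (fun x : 'rV[R]_n => c *: x + b)%R.
Proof.
apply: measurable_fun_rV => i.
under eq_fun do rewrite !mxE.
apply: measurable_funD => //; apply: measurable_funM => //.
exact: measurable_rV_coord.
Qed.

Lemma ge0_integral_affine n (c : R) (b : 'rV[R]_n) (g : 'rV[R]_n -> \bar R) :
  c != 0%R -> measurable_fun setT g -> (forall x, 0 <= g x) ->
  \int[mu n]_x g (c *: x + b)%R = (`|c| ^- n)%:E * \int[mu n]_x g x.
Proof.
move=> c0; elim: n b g => [|n IH] b g mg g0.
  rewrite expr0 invr1 mul1e; apply: eq_integral => x _; congr g.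
  by apply/rowP => -[].
rewrite ge0_integral_rVS//; last first.
  exact: measurableT_comp mg (@measurable_affine _ _ _).
pose b' : 'rV[R]_n := (\row_j b 0%R (lift ord0 j))%R.
transitivity (\int[mu n]_x
    (fun x => (`|c|^-1)%:E * \int[leb]_t g (rV_cons (x, t))) (c *: x + b')%R).
  apply: eq_integral => x _ /=.
  rewrite -(ge0_integral_affine1 (b 0 ord0)%R (g := fun t => g (rV_cons (_, t))))//.
    apply: eq_integral => t _; congr g; apply/rowP => i; rewrite !mxE.
    by case: unliftP => [j ->|->]//=; rewrite !mxE.
  apply: measurableT_comp mg _; apply: measurableT_comp (@measurable_rV_cons R n) _.
  exact: pair1_measurable.
have mI : measurable_fun setT (fun x : 'rV[R]_n => \int[leb]_t g (rV_cons (x, t))).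
  apply: (@measurable_fun_fubini_tonelli_F _ _ _ _ _ leb (g \o @rV_cons R n)) => [|z]; last exact: g0.
  exact: measurableT_comp mg (@measurable_rV_cons R n).
have I0 x : 0 <= \int[leb]_t g (rV_cons (x, t)) by exact: integral_ge0.
have ci : (0 <= `|c|^-1)%R by rewrite invr_ge0.
rewrite (IH b' (fun x => (`|c|^-1)%:E * \int[leb]_t g (rV_cons (x, t)))); last 2 first.
- exact: measurable_funeM.
- by move=> x; rewrite mule_ge0// lee_fin.
rewrite ge0_integralZl_EFin// muleA -EFinM -invfM -exprSr.
by rewrite [in RHS]ge0_integral_rVS.
Qed.

End lebesgue_change_of_variables.

Section normc_theory.
Context {R : realType}.
Implicit Types z w : R[i].

Lemma normc_norm z : `|z| = (normc z)%:C%C.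
Proof. by []. Qed.

Lemma normc_ge0 z : 0 <= normc z.
Proof. by case: z => a b; exact: sqrtr_ge0. Qed.

Lemma normcD z w : normc (z + w) <= normc z + normc w.
Proof. by have := ler_normD z w; rewrite !normc_norm -rmorphD lecR. Qed.

Lemma normcN z : normc (- z) = normc z.
Proof. by case: z => a b /=; rewrite !sqrrN. Qed.

Lemma normcB z w : normc (z - w) <= normc z + normc w.
Proof. by rewrite (le_trans (normcD _ _))// normcN. Qed.

Lemma normcR (a : R) : normc a%:C%C = `|a|.
Proof. by rewrite /= expr0n addr0 sqrtr_sqr. Qed.

Lemma normc_Re z : `|complex.Re z| <= normc z.
Proof.
case: z => a b /=; rewrite -sqrtr_sqr ler_sqrt ?lerDl ?sqr_ge0//.
by rewrite addr_ge0 ?sqr_ge0.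
Qed.

Lemma normc_Im z : `|complex.Im z| <= normc z.
Proof.
case: z => a b /=; rewrite -sqrtr_sqr ler_sqrt ?lerDr ?sqr_ge0//.
by rewrite addr_ge0 ?sqr_ge0.
Qed.

Lemma normc_le z : normc z <= `|complex.Re z| + `|complex.Im z|.
Proof.
have -> : z = (complex.Re z)%:C%C + 'i%C * (complex.Im z)%:C%C by exact: complexE.
rewrite (le_trans (normcD _ _))// normcM !normcR.
have -> : normc ('i%C : R[i]) = 1 by rewrite /= expr0n expr1n add0r sqrtr1.
by rewrite mul1r; case: z => a b /=; rewrite !(mul0r,mulr0,subr0,addr0,mul1r,add0r).
Qed.

End normc_theory.

Section complex_measurable.
Context d (T : measurableType d) (R : realType).
Implicit Types f g : T -> R[i].

Definition cmeas f :=
  measurable_fun setT (fun x => complex.Re (f x)) /\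
  measurable_fun setT (fun x => complex.Im (f x)).

Lemma cmeas_cst (c : R[i]) : cmeas (fun=> c).
Proof. by split; exact: measurable_cst. Qed.

Lemma cmeasD f g : cmeas f -> cmeas g -> cmeas (fun x => f x + g x).
Proof.
move=> [mf1 mf2] [mg1 mg2]; split.
- rewrite (_ : (fun _ => _) = (fun x => complex.Re (f x) + complex.Re (g x))).
    exact: measurable_funD.
  by apply/funext => x; case: (f x) (g x) => ? ? [].
- rewrite (_ : (fun _ => _) = (fun x => complex.Im (f x) + complex.Im (g x))).
    exact: measurable_funD.
  by apply/funext => x; case: (f x) (g x) => ? ? [].
Qed.

Lemma cmeasN f : cmeas f -> cmeas (fun x => - f x).
Proof.
move=> [mf1 mf2]; split.
- rewrite (_ : (fun _ => _) = (fun x => - complex.Re (f x))).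
    exact: measurable_funN.
  by apply/funext => x; case: (f x).
- rewrite (_ : (fun _ => _) = (fun x => - complex.Im (f x))).
    exact: measurable_funN.
  by apply/funext => x; case: (f x).
Qed.

Lemma cmeasB f g : cmeas f -> cmeas g -> cmeas (fun x => f x - g x).
Proof. by move=> mf mg; apply: cmeasD => //; exact: cmeasN. Qed.

Lemma cmeasM f g : cmeas f -> cmeas g -> cmeas (fun x => f x * g x).
Proof.
move=> [mf1 mf2] [mg1 mg2]; split.
- rewrite (_ : (fun _ => _) = (fun x => complex.Re (f x) * complex.Re (g x)
      - complex.Im (f x) * complex.Im (g x))).
    by apply: measurable_funB; exact: measurable_funM.
  by apply/funext => x; case: (f x) (g x) => ? ? [].
- rewrite (_ : (fun _ => _) = (fun x => complex.Re (f x) * complex.Im (g x)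
      + complex.Im (f x) * complex.Re (g x))).
    by apply: measurable_funD; exact: measurable_funM.
  by apply/funext => x; case: (f x) (g x) => ? ? [].
Qed.

Lemma cmeas_conj f : cmeas f -> cmeas (fun x => (f x)^*%C).
Proof.
move=> [mf1 mf2]; split.
- rewrite (_ : (fun _ => _) = (fun x => complex.Re (f x)))//.
  by apply/funext => x; case: (f x).
- rewrite (_ : (fun _ => _) = (fun x => - complex.Im (f x))).
    exact: measurable_funN.
  by apply/funext => x; case: (f x).
Qed.

Lemma cmeas_normc f : cmeas f -> measurable_fun setT (fun x => normc (f x)).
Proof.
move=> [mf1 mf2].
rewrite (_ : (fun _ => _) = (fun x => (complex.Re (f x) ^+ 2 + complex.Im (f x) ^+ 2) `^ 2^-1)).
  apply: (@measurableT_comp _ _ _ _ _ _ (@powR R ^~ (2^-1))).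
    exact: measurable_powR.
  by apply: measurable_funD; exact: measurable_funX.
apply/funext => x; rewrite powR12_sqrt ?addr_ge0 ?sqr_ge0//.
by case: (f x).
Qed.

Lemma cmeas_enormc f : cmeas f -> measurable_fun setT (fun x => (normc (f x))%:E).
Proof. by move=> mf; apply/measurable_EFinP; exact: cmeas_normc. Qed.

End complex_measurable.

Lemma cmeas_comp d d' (T : measurableType d) (T' : measurableType d') (R : realType)
    (f : T' -> R[i]) (h : T -> T') :
  cmeas f -> measurable_fun setT h -> cmeas (fun x => f (h x)).
Proof.
move=> [mf1 mf2] mh; split.
- exact: (measurableT_comp mf1 mh).
- exact: (measurableT_comp mf2 mh).
Qed.

Section complex_integral.
Context d (T : measurableType d) (R : realType) (m : {measure set T -> \bar R}).
Implicit Types f g : T -> R[i].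

Definition cint f : R[i] :=
  Complex (\int[m]_x complex.Re (f x)) (\int[m]_x complex.Im (f x)).

Definition cintegrable f := cmeas f /\ (\int[m]_x (normc (f x))%:E < +oo)%E.

Lemma cintegrable_Re f : cintegrable f ->
  m.-integrable setT (EFin \o (fun x => complex.Re (f x))).
Proof.
move=> [mf fi]; apply/integrableP; split; first by apply/measurable_EFinP; case: mf.
apply: le_lt_trans fi; apply: ge0_le_integral => //.
- by do 2 apply: measurableT_comp => //; case: mf.
- exact: cmeas_enormc.
- by move=> x _; rewrite lee_fin normc_Re.
Qed.

Lemma cintegrable_Im f : cintegrable f ->
  m.-integrable setT (EFin \o (fun x => complex.Im (f x))).
Proof.
move=> [mf fi]; apply/integrableP; split; first by apply/measurable_EFinP; case: mf.
apply: le_lt_trans fi; apply: ge0_le_integral => //.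
- by do 2 apply: measurableT_comp => //; case: mf.
- exact: cmeas_enormc.
- by move=> x _; rewrite lee_fin normc_Im.
Qed.

Lemma le_cintegrable f g : cmeas f -> cintegrable g ->
  (forall x, normc (f x) <= normc (g x)) -> cintegrable f.
Proof.
move=> mf [mg gi] fg; split=> //; apply: le_lt_trans gi.
apply: ge0_le_integral => //.
- by move=> x _; rewrite lee_fin normc_ge0.
- exact: cmeas_enormc.
- exact: cmeas_enormc.
- by move=> x _; rewrite lee_fin.
Qed.

Lemma cintegrableD f g : cintegrable f -> cintegrable g ->
  cintegrable (fun x => f x + g x).
Proof.
move=> [mf fi] [mg gi]; split; first exact: cmeasD.
apply: (@le_lt_trans _ _ (\int[m]_x ((normc (f x))%:E + (normc (g x))%:E))%E).
  apply: ge0_le_integral => //.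
  - by move=> x _; rewrite lee_fin normc_ge0.
  - by apply: cmeas_enormc; exact: cmeasD.
  - by apply: emeasurable_funD; exact: cmeas_enormc.
  - by move=> x _; rewrite lee_fin normcD.
rewrite ge0_integralD//; first by rewrite lte_add_pinfty.
- by move=> x _; rewrite lee_fin normc_ge0.
- exact: cmeas_enormc.
- by move=> x _; rewrite lee_fin normc_ge0.
- exact: cmeas_enormc.
Qed.

Lemma cintegrableN f : cintegrable f -> cintegrable (fun x => - f x).
Proof.
move=> [mf fi]; split; first exact: cmeasN.
by under eq_integral do rewrite normcN.
Qed.

Lemma cintegrableB f g : cintegrable f -> cintegrable g ->
  cintegrable (fun x => f x - g x).
Proof. by move=> fi gi; apply: cintegrableD => //; exact: cintegrableN. Qed.

Lemma cintegrableZl (c : R[i]) f : cintegrable f -> cintegrable (fun x => c * f x).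
Proof.
move=> [mf fi]; split; first by apply: cmeasM => //; exact: cmeas_cst.
under eq_integral do rewrite normcM EFinM.
rewrite ge0_integralZl_EFin ?normc_ge0//.
- by rewrite lte_mul_pinfty ?lee_fin ?normc_ge0// ltry.
- by move=> x _; rewrite lee_fin normc_ge0.
- exact: cmeas_enormc.
Qed.

Lemma cintD f g : cintegrable f -> cintegrable g ->
  cint (fun x => f x + g x) = cint f + cint g.
Proof.
move=> fi gi; rewrite /cint.
rewrite (_ : (fun _ => complex.Re _) = (fun x => complex.Re (f x) + complex.Re (g x))); last first.
  by apply/funext => x; case: (f x) (g x) => ? ? [].
rewrite (_ : (fun _ => complex.Im _) = (fun x => complex.Im (f x) + complex.Im (g x))); last first.
  by apply/funext => x; case: (f x) (g x) => ? ? [].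
rewrite !RintegralD//; first exact: cintegrable_Im.
- exact: cintegrable_Im.
- exact: cintegrable_Re.
- exact: cintegrable_Re.
Qed.

Lemma cintZl (c : R[i]) f : cintegrable f ->
  cint (fun x => c * f x) = c * cint f.
Proof.
move=> fi; rewrite /cint; case: c => a b.
have i1 := cintegrable_Re fi; have i2 := cintegrable_Im fi.
have zl (k : R) h : m.-integrable setT (EFin \o h) ->
    m.-integrable setT (EFin \o (fun x => k * h x)).
  by move=> hi; exact: (integrableZl measurableT k hi).
rewrite (_ : (fun _ => complex.Re _) = (fun x => a * complex.Re (f x) - b * complex.Im (f x))); last first.
  by apply/funext => x; case: (f x) => ? ?.
rewrite (_ : (fun _ => complex.Im _) = (fun x => a * complex.Im (f x) + b * complex.Re (f x))); last first.
  by apply/funext => x; case: (f x) => ? ?.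
rewrite RintegralB ?RintegralD ?RintegralZl//; exact: zl.
Qed.

Lemma cintN f : cintegrable f -> cint (fun x => - f x) = - cint f.
Proof.
move=> fi; rewrite -[RHS]mulN1r -cintZl//; congr cint.
by apply/funext => x; rewrite mulN1r.
Qed.

Lemma cintB f g : cintegrable f -> cintegrable g ->
  cint (fun x => f x - g x) = cint f - cint g.
Proof. by move=> fi gi; rewrite cintD ?cintN//; exact: cintegrableN. Qed.

(* A rotation makes the integral real, which reduces the triangle inequality
   to the real case. *)
Lemma normc_cint_le f : cmeas f ->
  ((normc (cint f))%:E <= \int[m]_x (normc (f x))%:E)%E.
Proof.
move=> mf.
have [fi|] := ltP (\int[m]_x (normc (f x))%:E)%E +oo%E; last first.
  by rewrite leye_eq => /eqP ->; rewrite leey.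
have If : cintegrable f by [].
have [z0|z0] := eqVneq (cint f) 0.
  rewrite z0 normc0; apply: integral_ge0 => x _; rewrite lee_fin normc_ge0//.
set z := cint f in z0 *.
have nz0 : normc z != 0 by apply: contra z0 => /eqP/eq0_normc ->.
pose c := z^*%C * ((normc z)^-1)%:C%C.
have cz : c * z = (normc z)%:C%C.
  rewrite /c; move: nz0; case: (z) => a b /= nz0.
  have h : Num.sqrt (a ^+ 2 + b ^+ 2) ^+ 2 = a ^+ 2 + b ^+ 2.
    by rewrite sqr_sqrtr// addr_ge0 ?sqr_ge0.
  set N := Num.sqrt _ in h nz0 *.
  apply/eqP; rewrite eq_complex /=; apply/andP; split; apply/eqP; last by ring.
  rewrite !(mulr0, addr0, subr0, mulNr, opprK).
  apply: (mulIf nz0); rewrite -expr2 h; field => //.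
have nc : normc c = 1.
  rewrite /c normcM normcR ger0_norm ?invr_ge0 ?normc_ge0//.
  have -> : normc z^*%C = normc z by case: (z) => a b /=; rewrite sqrrN.
  by rewrite mulfV.
have -> : normc z = \int[m]_x (complex.Re (c * f x)).
  have /(congr1 (@complex.Re R)) := cintZl c If.
  by rewrite -/z cz /= => <-.
have Icf := cintegrableZl c If.
apply: (@le_trans _ _ `|\int[m]_x (complex.Re (c * f x))|%:E); first by rewrite lee_fin ler_norm.
rewrite EFin_normr_Rintegral//; last exact: cintegrable_Re.
apply: (le_trans (le_abse_integral _ _ _)) => //.
  by apply/measurable_EFinP; case: Icf => -[].
apply: ge0_le_integral => //.
- by do 2 apply: measurableT_comp => //; case: Icf => -[].
- exact: cmeas_enormc.
- by move=> x _; rewrite lee_fin (le_trans (normc_Re _))// normcM nc mul1r.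
Qed.

Lemma ae_eq_cint f g : cmeas f -> cmeas g -> {ae m, forall x, f x = g x} ->
  cint f = cint g.
Proof.
move=> [mf1 mf2] [mg1 mg2] fg; rewrite /cint /Rintegral; congr Complex.
- congr fine; apply: ae_eq_integral => //; [exact/measurable_EFinP..|].
  by apply: filterS fg => x /= ->.
- congr fine; apply: ae_eq_integral => //; [exact/measurable_EFinP..|].
  by apply: filterS fg => x /= ->.
Qed.

Lemma cintegrable_fin f : cintegrable f ->
  (\int[m]_x (normc (f x))%:E)%E \is a fin_num.
Proof.
move=> [_ fi]; rewrite ge0_fin_numE//.
by apply: integral_ge0 => x _; rewrite lee_fin normc_ge0.
Qed.

End complex_integral.

Section complex_fubini.
Context d1 d2 (T1 : measurableType d1) (T2 : measurableType d2) (R : realType).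
Variables (m1 : {sigma_finite_measure set T1 -> \bar R}).
Variables (m2 : {sigma_finite_measure set T2 -> \bar R}).

Lemma measurable_Rintegral_snd (F : T1 * T2 -> R) :
  measurable_fun setT F ->
  measurable_fun setT (fun x => \int[m2]_y F (x, y)).
Proof.
move=> mF; rewrite /Rintegral.
apply: (@measurableT_comp _ _ _ _ _ _ fine); first exact: fine_measurable.
under eq_fun do rewrite integralE.
apply: emeasurable_funB.
- have mpos : measurable_fun setT ((EFin \o F)^\+)%E.
    by apply: measurable_funepos; exact/measurable_EFinP.
  have := @measurable_fun_fubini_tonelli_F _ _ _ _ _ m2 _ mpos (funepos_ge0 _).
  congr measurable_fun; apply/funext => x; apply: eq_integral => y _.
  by rewrite !funeposE.
- have mneg : measurable_fun setT ((EFin \o F)^\-)%E.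
    by apply: measurable_funeneg; exact/measurable_EFinP.
  have := @measurable_fun_fubini_tonelli_F _ _ _ _ _ m2 _ mneg (funeneg_ge0 _).
  congr measurable_fun; apply/funext => x; apply: eq_integral => y _.
  by rewrite !funenegE.
Qed.

Lemma cmeas_cint_snd (F : T1 * T2 -> R[i]) : cmeas F ->
  cmeas (fun x => cint m2 (fun y => F (x, y))).
Proof.
move=> [mF1 mF2]; split => /=.
- exact: (measurable_Rintegral_snd mF1).
- exact: (measurable_Rintegral_snd mF2).
Qed.

Lemma Rintegral_fubini (F : T1 * T2 -> R) :
  (m1 \x m2)%E.-integrable setT (EFin \o F) ->
  \int[m1]_x \int[m2]_y F (x, y) = \int[m2]_y \int[m1]_x F (x, y).
Proof.
move=> iF; rewrite /Rintegral; congr fine.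
transitivity (\int[m1]_x \int[m2]_y (F (x, y))%:E)%E.
  apply: ae_eq_integral => //.
  - apply/measurable_EFinP; apply: measurable_Rintegral_snd.
    by apply/measurable_EFinP; exact: measurable_int iF.
  - exact: (measurable_fubini_F iF).
  - apply: filterS (integrable_ae measurableT (integrable_fubini_F iF)) => x.
    by move=> /(_ I) h _; rewrite fineK.
rewrite (Fubini iF).
apply: ae_eq_integral => //.
- exact: (measurable_fubini_G iF).
- apply/measurable_EFinP.
  apply: (@measurableT_comp _ _ _ _ _ _ fine); first exact: fine_measurable.
  exact: (measurable_fubini_G iF).
- apply: filterS (ae_integrable2 iF) => x xi _.
  by rewrite fineK//; exact: integrable_fin_num xi.
Qed.

Lemma cint_fubini (F : T1 * T2 -> R[i]) : cmeas F ->
  (\int[m1]_x \int[m2]_y (normc (F (x, y)))%:E < +oo)%E ->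
  cint m1 (fun x => cint m2 (fun y => F (x, y))) =
  cint m2 (fun y => cint m1 (fun x => F (x, y))).
Proof.
move=> mF Foo.
have iF : cintegrable (m1 \x m2)%E F.
  split => //; rewrite fubini_tonelli1//; first exact: cmeas_enormc.
  by move=> z; rewrite lee_fin normc_ge0.
congr Complex.
- exact: (Rintegral_fubini (cintegrable_Re iF)).
- exact: (Rintegral_fubini (cintegrable_Im iF)).
Qed.

End complex_fubini.

Section nonneg_limits.
Context {R : realType}.
Local Open Scope ereal_scope.

Lemma ge0_cvge0P (u : (\bar R)^nat) : (forall k, 0 <= u k) ->
  (u @ \oo --> 0) <->
  (forall e : R, (0 < e)%R -> \forall k \near \oo, u k <= e%:E).
Proof.
move=> u0; split.
- move=> /fine_cvgP[ufin u_0] e e0.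
  have /cvgrPdist_le/(_ e e0) h := u_0.
  near=> k.
  have fk : u k \is a fin_num by near: k.
  rewrite -(fineK fk) lee_fin.
  have : (`|0 - fine (u k)| <= e)%R by near: k.
  by rewrite sub0r normrN ger0_norm// fine_ge0.
- move=> h; apply/fine_cvgP; split.
    near=> k; rewrite ge0_fin_numE//.
    by apply: (@le_lt_trans _ _ 1%:E); [near: k; exact: h|exact: ltry].
  apply/cvgrPdist_le => e e0; near=> k.
  rewrite sub0r normrN ger0_norm ?fine_ge0//.
  have uk : u k <= e%:E by near: k; exact: h.
  by rewrite -lee_fin fineK// ge0_fin_numE// (le_lt_trans uk)// ltry.
Unshelve. all: by end_near. Qed.

Lemma ge0_squeeze_cvg0 (u v : (\bar R)^nat) : (forall k, 0 <= u k) ->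
  (forall k, u k <= v k) -> v @ \oo --> 0 -> u @ \oo --> 0.
Proof.
move=> u0 uv v0; apply/ge0_cvge0P => // e e0.
have v0' k : 0 <= v k by rewrite (le_trans (u0 k)).
have /(ge0_cvge0P v0')/(_ e e0) := v0.
by apply: filterS => k; exact: le_trans.
Qed.

Lemma ge0_dominated_cvg0 d (T : measurableType d) (m : {measure set T -> \bar R})
    (F : (T -> \bar R)^nat) (D : T -> \bar R) :
  (forall k, measurable_fun setT (F k)) -> (forall k x, 0 <= F k x) ->
  {ae m, forall x, F ^~ x @ \oo --> 0} ->
  measurable_fun setT D -> \int[m]_x D x < +oo ->
  (forall k x, F k x <= D x) ->
  \int[m]_x F k x @[k --> \oo] --> 0.
Proof.
move=> mF F0 cF mD iD FD.
have D0 x : 0 <= D x by rewrite (le_trans (F0 0%N x)).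
have iD' : m.-integrable setT D.
  by apply/integrableP; split=> //; under eq_integral do rewrite gee0_abs//.
have := @dominated_convergence _ T R m setT measurableT F (cst 0) D mF
  (measurable_cst _) _ iD' _.
rewrite integral0.
case=> //.
- by apply: filterS cF => x /= h _.
- by apply: nearW => x k _; rewrite gee0_abs.
Qed.

End nonneg_limits.

Section L1_translation_real.
Context {R : realType}.
Local Notation leb := (@lebesgue_measure R).
Local Open Scope ereal_scope.

Lemma ge0_integral_translate1 (t : R) (g : R -> \bar R) :
  measurable_fun setT g -> (forall x, 0 <= g x) ->
  \int[leb]_x g (x - t)%R = \int[leb]_x g x.
Proof.
move=> mg g0; have := ge0_integral_affine1 (- t)%R (oner_neq0 R) mg g0.
rewrite normr1 invr1 mul1e => <-.
by apply: eq_integral => x _; rewrite mul1r.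
Qed.

Lemma measurable_translate1 (t : R) (g : R -> R) :
  measurable_fun setT g -> measurable_fun setT (fun x : R => g (x - t)%R).
Proof.
move=> mg; apply: (measurableT_comp mg).
exact: (measurable_funB (@measurable_id _ _ _) (@measurable_cst _ _ _ _ _ t)).
Qed.

Let osc (g : R -> R) (t : R) := \int[leb]_x `|g (x - t) - g x|%:E.

Let osc_ge0 g t : 0 <= osc g t.
Proof. by apply: integral_ge0 => x _; rewrite lee_fin. Qed.

Let osc_approx (g psi : R -> R) t : measurable_fun setT g -> measurable_fun setT psi ->
  osc g t <= \int[leb]_x `|g x - psi x|%:E + osc psi t + \int[leb]_x `|g x - psi x|%:E.
Proof.
move=> mg mp; rewrite /osc.
have md : measurable_fun setT (fun x => `|g x - psi x|%:E).
  by apply/measurable_EFinP; apply: measurableT_comp => //; exact: measurable_funB.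
rewrite -{1}(ge0_integral_translate1 t md); last by move=> x; rewrite lee_fin.
have md' : measurable_fun setT (fun x : R => `|g (x - t) - psi (x - t)|%:E).
  apply/measurable_EFinP; apply: measurableT_comp => //; apply: measurable_funB;
  exact: measurable_translate1.
have mo : measurable_fun setT (fun x : R => `|psi (x - t) - psi x|%:E).
  apply/measurable_EFinP; apply: measurableT_comp => //; apply: measurable_funB => //.
  exact: measurable_translate1.
rewrite -ge0_integralD//.
rewrite -ge0_integralD//; last 2 first.
- by move=> x _; rewrite -EFinD lee_fin addr_ge0.
- exact: emeasurable_funD.
apply: ge0_le_integral => //.
- apply/measurable_EFinP; apply: measurableT_comp => //; apply: measurable_funB => //.
  exact: measurable_translate1.
- by apply: emeasurable_funD => //; exact: emeasurable_funD.
- move=> x _; rewrite -!EFinD lee_fin.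
  have -> : (g (x - t) - g x = (g (x - t) - psi (x - t)) + (psi (x - t) - psi x) - (g x - psi x))%R by ring.
  by rewrite (le_trans (ler_normB _ _))// lerD2r ler_normD.
Qed.

Let osc_cutoff (phi : R -> R) (N : R) (t : R^nat) : (0 < N)%R -> continuous phi ->
  t @ \oo --> (0 : R)%R ->
  osc (fun x => phi x * \1_(`[- N, N]%classic) x)%R (t k) @[k --> \oo] --> 0.
Proof.
move=> N0 cphi t0; set E := `[_, _]%classic.
have mphi : measurable_fun setT phi by exact: continuous_measurable_fun.
have mE : measurable E by exact: measurable_itv.
have m1 : measurable_fun setT (\1_E : R -> R) by exact: measurable_indic.
pose psi := (fun x : R => phi x * \1_E x)%R.
change (osc psi (t k) @[k --> \oo] --> 0).
have mpsi : measurable_fun setT psi by exact: measurable_funM.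
have [T [T0 tT]] : exists T : R, (0 < T)%R /\ forall k, (`|t k| <= T)%R.
  have /cvg_seq_bounded : cvgn t by apply/cvg_ex; exists 0%R.
  move=> [M [Mr hM]]; exists (`|M| + 1)%R; split; first by rewrite ltr_wpDl.
  move=> k; have := hM (`|M| + 1)%R _ k I; apply.
  by rewrite (le_lt_trans (ler_norm _))// ltrDl.
have [M [M0 phiM]] : exists M : R, (0 <= M)%R /\ forall x, (`|psi x| <= M)%R.
  have cE : compact E by exact: segment_compact.
  have /compact_bounded[M [Mr hM]] := continuous_compact (continuous_subspaceT cphi : {within E, continuous phi}) cE.
  exists (`|M| + 1)%R; split; first by rewrite addr_ge0.
  move=> x; rewrite /psi indicE; case: (boolP (x \in E)) => xE; last by rewrite mulr0 normr0 addr_ge0.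
  rewrite mulr1; apply: (hM (`|M| + 1)%R); first by rewrite (le_lt_trans (ler_norm _))// ltrDl.
  by exists x => //; rewrite inE in xE.
pose B := `[(- (N + T))%R, (N + T)%R]%classic.
have mB : measurable B by exact: measurable_itv.
have Boo : leb B < +oo.
  by rewrite /B lebesgue_measure_itv/=; case: ifP => _; rewrite -?EFinB ltry.
apply: (@ge0_dominated_cvg0 _ _ _ leb (fun k x => `|psi (x - t k) - psi x|%:E) (fun x => (2 * M)%:E * (\1_B x)%:E)).
- move=> k; apply/measurable_EFinP; apply: measurableT_comp => //; apply: measurable_funB => //.
  exact: measurable_translate1.
- by move=> k x; rewrite lee_fin.
- exists [set (- N)%R; N]; split.
  + by apply: measurableU; exact: measurable_set1.
  + apply/eqP; rewrite eq_le measure_ge0 andbT.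
    have := @measureU2 _ _ R leb [set (- N)%R] [set N] (measurable_set1 _) (measurable_set1 _).
    have L0 r : leb [set r] <= 0.
      by rewrite (_ : leb _ = 0)//; exact: lebesgue_measure_set1.
    by move=> h; apply: (le_trans h); rewrite -[leRHS](adde0 0); apply: leeD; apply: L0.
  + move=> x /=; apply: contra_notP => /not_orP[xN1 xN2].
    have cx : psi (x - t k)%R @[k --> \oo] --> psi x.
      have xt : (x - t k)%R @[k --> \oo] --> x.
        by rewrite -[X in _ --> X]subr0; apply: cvgB => //; exact: cvg_cst.
      apply: cvgM; first exact: (cvg_comp _ _ xt (cphi x)).
      have [xE|xE] := boolP (x \in E).
      * rewrite [X in _ --> X]indicE xE/=; apply: cvg_near_cst.
        have [x1 x2] : (- N < x /\ x < N)%R.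
          by move: xE; rewrite inE /E/= in_itv/= => /andP[]; rewrite !le_eqVlt => /predU1P[/esym//|->] /predU1P[//|->].
        near=> k; rewrite /= indicE mem_set//= /E/= in_itv/=.
        apply/andP; split.
          by near: k; apply: (cvgr_ge x).
        by near: k; apply: (cvgr_le x).
      * rewrite [X in _ --> X]indicE (negbTE xE)/=; apply: cvg_near_cst.
        move: xE; rewrite notin_setE /E/= in_itv/= => /negP; rewrite negb_and -!ltNge => /orP[xN|xN].
          near=> k; rewrite /= indicE memNset//= /E/= in_itv/= => /andP[+ _]; apply/negP; rewrite -ltNge.
          by near: k; apply: (cvgr_lt x).
        near=> k; rewrite /= indicE memNset//= /E/= in_itv/= => /andP[_]; apply/negP; rewrite -ltNge.
        by near: k; apply: (cvgr_gt x).
    apply/fine_cvgP; split; first exact: nearW.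
    rewrite /comp/= -(normr0 R) -(subrr (psi x)).
    by apply: cvg_norm; apply: cvgB => //; exact: cvg_cst.
- by apply: measurable_funeM; apply/measurable_EFinP; exact: measurable_indic.
- rewrite ge0_integralZl_EFin//; last 2 first.
  + by apply/measurable_EFinP; exact: measurable_indic.
  + by rewrite mulr_ge0.
  by rewrite integral_indic// setIT lte_mul_pinfty// ?lee_fin ?mulr_ge0.
- move=> k x; rewrite -EFinM lee_fin indicE.
  have [xB|xB] := boolP (x \in B).
    rewrite mulr1 (le_trans (ler_normB _ _))// mulr_natl mulr2n lerD//.
  rewrite mulr0 /psi !indicE.
  have [xN|xN] : (x < - (N + T) \/ N + T < x)%R.
    move: xB; rewrite notin_setE /B/= in_itv/= => /negP; rewrite negb_and -!ltNge => /orP[]; [by left|by right].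
  + have := tT k; rewrite ler_norml => /andP[t1 t2].
    rewrite !memNset/= ?mulr0 ?subrr ?normr0//; rewrite /E/= in_itv/= => /andP[h1 h2]; lra.
  + have := tT k; rewrite ler_norml => /andP[t1 t2].
    rewrite !memNset/= ?mulr0 ?subrr ?normr0//; rewrite /E/= in_itv/= => /andP[h1 h2]; lra.
Unshelve. all: by end_near. Qed.

Lemma L1_translation1 (g : R -> R) (t : R^nat) : measurable_fun setT g ->
  \int[leb]_x `|g x|%:E < +oo -> t @ \oo --> (0 : R)%R ->
  \int[leb]_x `|g (x - t k) - g x|%:E @[k --> \oo] --> 0.
Proof.
move=> mg ig t0.
have mng : measurable_fun setT (fun x => `|g x|%:E).
  by apply/measurable_EFinP; exact: measurableT_comp.
have Ig : leb.-integrable setT (EFin \o g).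
  by apply/integrableP; split => //; exact/measurable_EFinP.
apply/ge0_cvge0P => [k|e e0]; first exact: osc_ge0.
have e4 : (0 < e / 5)%R by rewrite divr_gt0.
pose E N := `[(- (N.+1%:R) : R)%R, N.+1%:R]%classic.
have mE N : measurable (E N) by exact: measurable_itv.
have mEc N : measurable (~` E N) by exact: measurableC.
have tail : \int[leb]_x (`|g x| * \1_(~` E N) x)%:E @[N --> \oo] --> 0.
  apply: (@ge0_dominated_cvg0 _ _ _ leb (fun N x => (`|g x| * \1_(~` E N) x)%:E) (fun x => `|g x|%:E)) => //.
  - move=> N; apply/measurable_EFinP; apply: measurable_funM.
      exact: measurableT_comp.
    by apply: measurable_indic; exact: mEc.
  - apply: nearW => x.
    apply/ge0_cvge0P => [N|d d0]; first by rewrite lee_fin mulr_ge0.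
    exists (Num.bound `|x|) => // N /= hN; rewrite lee_fin indicE memNset ?mulr0 ?ltW//=.
    apply; rewrite /E/= in_itv/= -ler_norml (le_trans (ltW (archi_boundP (normr_ge0 _))))//.
    by rewrite ler_nat (leq_trans hN).
  - move=> N x; rewrite lee_fin indicE; case: (_ \in _); rewrite ?mulr1// mulr0//.
have [N tN] : exists N, \int[leb]_x (`|g x| * \1_(~` E N) x)%:E <= (e / 5)%:E.
  have h0 N : 0 <= \int[leb]_x (`|g x| * \1_(~` E N) x)%:E.
    by apply: integral_ge0 => x _; rewrite lee_fin mulr_ge0.
  have /(ge0_cvge0P h0)/(_ _ e4)[N _ hN] := tail.
  by exists N; exact: hN (leqnn N).
have ENoo : leb (E N) < +oo.
  by rewrite lebesgue_measure_itv/=; case: ifP => _; rewrite -?EFinB ltry.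
have IgE : leb.-integrable (E N) (EFin \o g).
  by apply: (@integrableS _ (measurableTypeR R) _ leb setT) => //; exact: mE.
have [phi_ [cphi iphi phig]] := approximation_continuous_integrable (mE N) ENoo IgE.
have [k0 phik] : exists k, \int[leb]_(x in E N) `|(g x - phi_ k x)%:E| <= (e / 5)%:E.
  have h0 k : 0 <= \int[leb]_(x in E N) `|(g x - phi_ k x)%:E| by exact: integral_ge0.
  have /(ge0_cvge0P h0)/(_ _ e4)[k _ hk] := phig.
  by exists k; exact: hk (leqnn k).
pose psi x := (phi_ k0 x * \1_(E N) x)%R.
have mphi : measurable_fun setT (phi_ k0) by exact: continuous_measurable_fun.
have m1 : measurable_fun setT (\1_(E N) : R -> R) by exact: measurable_indic.
have mpsi : measurable_fun setT psi by exact: measurable_funM.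
have gpsi : \int[leb]_x `|g x - psi x|%:E <= (e / 5 + e / 5)%:E.
  rewrite EFinD; apply: (le_trans _ (leeD phik tN)).
  rewrite [X in X + _]integral_mkcond -ge0_integralD//; first last.
  - apply/measurable_EFinP; apply: measurable_funM; first exact: measurableT_comp.
    by apply: measurable_indic; exact: mEc.
  - apply/(measurable_restrictT _ (mE N)).
    by apply: measurable_funTS; do 2 apply: measurableT_comp => //; exact: measurable_funB.
  - by move=> x _; rewrite erestrict_ge0.
  apply: ge0_le_integral => //.
  - apply/measurable_EFinP; apply: measurableT_comp => //; exact: measurable_funB.
  - apply: emeasurable_funD.
      apply/(measurable_restrictT _ (mE N)).
      by apply: measurable_funTS; do 2 apply: measurableT_comp => //; exact: measurable_funB.
    apply/measurable_EFinP; apply: measurable_funM; first exact: measurableT_comp.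
    by apply: measurable_indic; exact: mEc.
  - move=> x _; rewrite patchE /psi !indicE in_setC.
    case: (x \in E N) => /=.
      by rewrite mulr1 mulr0 adde0.
    by rewrite mulr0 mulr1 subr0 add0e.
have N0 : (0 < N.+1%:R :> R)%R by [].
have := osc_cutoff N0 (cphi k0) t0.
move=> /(ge0_cvge0P (fun k => osc_ge0 _ _))/(_ _ e4).
apply: filterS => k hk.
apply: (le_trans (osc_approx (t k) mg mpsi)).
have -> : e%:E = (e / 5 + e / 5)%:E + (e / 5)%:E + (e / 5 + e / 5)%:E.
  by rewrite -!EFinD; congr EFin; field.
by apply: leeD => //; apply: leeD.
Qed.

End L1_translation_real.

Section rV_change_of_variables.
Context {R : realType} {n : nat}.
Local Notation mu := (@lebesgue_rV R n).
Local Notation V := 'rV[R]_n.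
Local Open Scope ereal_scope.

Lemma measurable_rV_scale d (T : measurableType d) (c : R) (f : T -> V) :
  measurable_fun setT f -> measurable_fun setT (fun x => c *: f x)%R.
Proof.
move=> mf; apply: measurable_fun_rV => i; under eq_fun do rewrite mxE.
apply: measurable_funM => //; exact: (measurableT_comp (measurable_rV_coord i)).
Qed.

Lemma measurable_rV_sub d (T : measurableType d) (f g : T -> V) :
  measurable_fun setT f -> measurable_fun setT g ->
  measurable_fun setT (fun x => f x - g x)%R.
Proof.
move=> mf mg; apply: measurable_fun_rV => i; under eq_fun do rewrite !mxE.
by apply: measurable_funB; exact: (measurableT_comp (measurable_rV_coord i)).
Qed.

Lemma measurable_sub_snd (y : V) : measurable_fun setT (fun x : V => x - y)%R.
Proof. by apply: measurable_rV_sub => //; exact: measurable_cst. Qed.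

Lemma measurable_sub_fst (x : V) : measurable_fun setT (fun y : V => x - y)%R.
Proof. by apply: measurable_rV_sub => //; exact: measurable_cst. Qed.

Lemma measurable_sub_pair : measurable_fun setT (fun z : V * V => z.1 - z.2)%R.
Proof. by apply: measurable_rV_sub; [exact: measurable_fst|exact: measurable_snd]. Qed.

Lemma measurable_scale (c : R) : measurable_fun setT (fun x : V => c *: x)%R.
Proof. exact: measurable_rV_scale. Qed.

Lemma ge0_integral_translate (y : V) (g : V -> \bar R) :
  measurable_fun setT g -> (forall x, 0 <= g x) ->
  \int[mu]_x g (x - y)%R = \int[mu]_x g x.
Proof.
move=> mg g0; have := ge0_integral_affine (- y)%R (oner_neq0 R) mg g0.
rewrite normr1 expr1n invr1 mul1e => <-.
by apply: eq_integral => x _; rewrite scale1r.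
Qed.

Lemma ge0_integral_reflect (x : V) (g : V -> \bar R) :
  measurable_fun setT g -> (forall x, 0 <= g x) ->
  \int[mu]_y g (x - y)%R = \int[mu]_y g y.
Proof.
move=> mg g0; have c0 : (-1 != 0 :> R)%R by rewrite oppr_eq0 oner_neq0.
have := ge0_integral_affine x c0 mg g0.
rewrite normrN1 expr1n invr1 mul1e => <-.
by apply: eq_integral => y _; rewrite scaleN1r addrC.
Qed.

Lemma ge0_integral_scale (c : R) (g : V -> \bar R) : c != 0%R ->
  measurable_fun setT g -> (forall x, 0 <= g x) ->
  \int[mu]_x g (c *: x)%R = (`|c| ^- n)%:E * \int[mu]_x g x.
Proof.
move=> c0 mg g0; rewrite -(ge0_integral_affine 0%R c0 mg g0).
by apply: eq_integral => x _; rewrite addr0.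
Qed.

Lemma Rintegral_affine (c : R) (b : V) (g : V -> R) : c != 0%R ->
  measurable_fun setT g ->
  (\int[mu]_x g (c *: x + b) = `|c| ^- n * \int[mu]_x g x)%R.
Proof.
move=> c0 mg; rewrite /Rintegral.
have k0 : (0 < `|c| ^- n)%R by rewrite invr_gt0 exprn_gt0// normr_gt0.
rewrite integralE [in RHS]integralE.
have mp : measurable_fun setT (EFin \o g)^\+.
  by apply: measurable_funepos; exact/measurable_EFinP.
have mn : measurable_fun setT (EFin \o g)^\-.
  by apply: measurable_funeneg; exact/measurable_EFinP.
have -> : \int[mu]_x (fun x : V => (g (c *: x + b)%R)%:E)^\+ x =
    (`|c| ^- n)%:E * \int[mu]_x (EFin \o g)^\+ x.
  rewrite -(ge0_integral_affine b c0 mp (funepos_ge0 _)).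
  by apply: eq_integral => x _; rewrite !funeposE.
have -> : \int[mu]_x (fun x : V => (g (c *: x + b)%R)%:E)^\- x =
    (`|c| ^- n)%:E * \int[mu]_x (EFin \o g)^\- x.
  rewrite -(ge0_integral_affine b c0 mn (funeneg_ge0 _)).
  by apply: eq_integral => x _; rewrite !funenegE.
have : 0 <= \int[mu]_x (EFin \o g)^\+ x by apply: integral_ge0 => x _; exact: funepos_ge0.
have : 0 <= \int[mu]_x (EFin \o g)^\- x by apply: integral_ge0 => x _; exact: funeneg_ge0.
case: (\int[mu]_x (EFin \o g)^\- x) => [b'||]//; case: (\int[mu]_x (EFin \o g)^\+ x) => [a'||]// _ _ /=.
- by rewrite mulrBr.
- by rewrite gt0_muley ?lte_fin//= mulr0.
- by rewrite gt0_muley ?lte_fin//= mulr0.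
- by rewrite !gt0_muley ?lte_fin//= mulr0.
Qed.

Lemma cint_affine (c : R) (b : V) (f : V -> R[i]) : c != 0%R -> cmeas f ->
  cint mu (fun x => f (c *: x + b)%R) = ((`|c| ^- n)%:C%C * cint mu f)%R.
Proof.
move=> c0 [mf1 mf2]; rewrite /cint (Rintegral_affine b c0 mf1) (Rintegral_affine b c0 mf2).
by apply/eqP; rewrite eq_complex /= !mul0r subr0 addr0 !eqxx.
Qed.

Lemma cint_reflect (x : V) (f : V -> R[i]) : cmeas f ->
  cint mu (fun y => f (x - y)%R) = cint mu f.
Proof.
move=> mf; have c0 : (-1 != 0 :> R)%R by rewrite oppr_eq0 oner_neq0.
have := cint_affine x c0 mf.
rewrite normrN1 expr1n invr1 mul1r => <-; congr cint.
by apply/funext => y; rewrite scaleN1r addrC.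
Qed.

Lemma cint_scale (c : R) (f : V -> R[i]) : c != 0%R -> cmeas f ->
  cint mu (fun y => f (c *: y)%R) = ((`|c| ^- n)%:C%C * cint mu f)%R.
Proof.
move=> c0 mf; rewrite -(cint_affine 0%R c0 mf); congr cint.
by apply/funext => y; rewrite addr0.
Qed.

Lemma cint_translate (b : V) (f : V -> R[i]) : cmeas f ->
  cint mu (fun y => f (y - b)%R) = cint mu f.
Proof.
move=> mf; have := cint_affine (- b)%R (oner_neq0 R) mf.
rewrite normr1 expr1n invr1 mul1r => <-; congr cint.
by apply/funext => y; rewrite scale1r.
Qed.

Lemma ae_affine (c : R) (b : V) (P : V -> Prop) : c != 0%R ->
  {ae mu, forall x, P x} -> {ae mu, forall x, P (c *: x + b)%R}.
Proof.
move=> c0 [N [mN N0 PN]].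
have mA := @measurable_affine R n c b.
exists ((fun x : V => c *: x + b)%R @^-1` N); split.
- by rewrite -[X in measurable X]setTI; exact: mA.
- have mi : measurable_fun setT (fun x : V => (\1_N x)%:E : \bar R).
    by apply/measurable_EFinP; exact: measurable_indic.
  have i0 (x : V) : 0 <= (\1_N x)%:E :> \bar R by rewrite lee_fin.
  have z : \int[mu]_x (\1_N x)%:E = 0 by rewrite integral_indic// setIT; exact: N0.
  have mAN : measurable ((fun x : V => c *: x + b)%R @^-1` N).
    by rewrite -[X in measurable X]setTI; exact: mA.
  have z2 : \int[mu]_x (\1_((fun x : V => c *: x + b)%R @^-1` N) x)%:E = 0.
    by have := ge0_integral_affine b c0 mi i0; rewrite z mule0.
  by rewrite integral_indic// setIT in z2; exact: z2.
- by move=> x /= h; exact: (PN _ h).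
Qed.

Lemma ae_reflect (x : V) (P : V -> Prop) :
  {ae mu, forall y, P y} -> {ae mu, forall y, P (x - y)%R}.
Proof.
move=> h; have c0 : (-1 != 0 :> R)%R by rewrite oppr_eq0 oner_neq0.
by apply: filterS (ae_affine x c0 h) => y; rewrite scaleN1r addrC.
Qed.

End rV_change_of_variables.

Lemma ae_lty d (T : measurableType d) (R : realType) (m : {measure set T -> \bar R})
    (f : T -> \bar R) : measurable_fun setT f -> (forall x, 0 <= f x)%E ->
  (\int[m]_x f x < +oo)%E -> {ae m, forall x, (f x < +oo)%E}.
Proof.
move=> mf f0 fi.
have : m.-integrable setT f.
  by apply/integrableP; split => //; under eq_integral do rewrite gee0_abs//.
move=> /(integrable_ae measurableT); apply: filterS => x /(_ I).
by rewrite ge0_fin_numE.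
Qed.

Section L1_translation.
Context {R : realType}.
Local Notation leb := (@lebesgue_measure R).
Local Notation mu n := (@lebesgue_rV R n).
Local Open Scope ereal_scope.

Lemma rV_consB n (x y : 'rV[R]_n) (s t : R) :
  (rV_cons (x, s) - rV_cons (y, t) = rV_cons (x - y, s - t))%R.
Proof. by apply/rowP => i; rewrite !mxE; case: (unlift _ _) => [j|]; rewrite ?mxE. Qed.

Lemma rV_unconsK n (x : 'rV[R]_n.+1) : rV_cons (rV_uncons x) = x.
Proof.
by apply/rowP => i; rewrite !mxE; case: unliftP => [j ->|->]; rewrite ?mxE.
Qed.

Let mpair1 n (g : 'rV[R]_n.+1 -> R) (x : 'rV[R]_n) : measurable_fun setT g ->
  measurable_fun setT (fun t : measurableTypeR R => g (rV_cons (x, t))).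
Proof.
move=> mg; apply: (measurableT_comp mg); apply: (measurableT_comp (@measurable_rV_cons R n)).
exact: pair1_measurable.
Qed.

Let mpair2 n (g : 'rV[R]_n.+1 -> R) (t : measurableTypeR R) : measurable_fun setT g ->
  measurable_fun setT (fun x : 'rV[R]_n => g (rV_cons (x, t))).
Proof.
move=> mg; apply: (measurableT_comp mg); apply: (measurableT_comp (@measurable_rV_cons R n)).
exact: pair2_measurable.
Qed.

Lemma L1_translation_real n (g : 'rV[R]_n -> R) (h : nat -> 'rV[R]_n) :
  measurable_fun setT g -> \int[mu n]_x `|g x|%:E < +oo ->
  (forall i, h k 0%R i @[k --> \oo] --> (0 : R)%R) ->
  \int[mu n]_x `|g (x - h k) - g x|%:E @[k --> \oo] --> 0.
Proof.
elim: n g h => [|n IH] g h mg ig h0.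
  rewrite (_ : (fun _ => _) = cst 0); first exact: cvg_cst.
  apply/funext => k; rewrite integral0_eq// => x _.
  by rewrite (_ : (x - h k)%R = x) ?subrr ?normr0//; apply/rowP => -[].
pose h' k := (rV_uncons (h k)).1.
pose t k := (rV_uncons (h k)).2.
have hE k : h k = rV_cons (h' k, t k) by rewrite /h' /t -surjective_pairing rV_unconsK.
have mng : measurable_fun setT (fun x => `|g x|%:E).
  by apply/measurable_EFinP; exact: measurableT_comp.
have mnc : measurable_fun setT (fun z : 'rV[R]_n * measurableTypeR R => `|g (rV_cons z)|%:E).
  exact: measurableT_comp mng (@measurable_rV_cons R n).
have ig2 : \int[mu n]_x \int[leb]_t `|g (rV_cons (x, t))|%:E < +oo.
  by move: ig; rewrite ge0_integral_rVS.
have ig2' : \int[leb]_t \int[mu n]_x `|g (rV_cons (x, t))|%:E < +oo.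
  move: ig2; rewrite (@fubini_tonelli _ _ _ _ _ (mu n) leb (fun z => `|g (rV_cons z)|%:E))//.
pose G k (z : 'rV[R]_n * measurableTypeR R) := `|g (rV_cons (z.1, z.2 - t k)%R) - g (rV_cons z)|%:E.
pose H k (z : 'rV[R]_n * measurableTypeR R) := `|g (rV_cons (z.1 - h' k, z.2)%R) - g (rV_cons z)|%:E.
have mc1 k : measurable_fun setT (fun z : 'rV[R]_n * measurableTypeR R => g (rV_cons (z.1, z.2 - t k)%R)).
  apply: (measurableT_comp mg); apply: (measurableT_comp (@measurable_rV_cons R n)).
  apply: measurable_fun_pair; first exact: measurable_fst.
  apply: (@measurable_funB _ _ R setT snd (cst (t k))) => //; exact: measurable_snd.
have mc2 k : measurable_fun setT (fun z : 'rV[R]_n * measurableTypeR R => g (rV_cons (z.1 - h' k, z.2)%R)).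
  apply: (measurableT_comp mg); apply: (measurableT_comp (@measurable_rV_cons R n)).
  apply: measurable_fun_pair; last exact: measurable_snd.
  apply: measurable_rV_sub; [exact: measurable_fst|exact: measurable_cst].
have mc0 : measurable_fun setT (fun z : 'rV[R]_n * measurableTypeR R => g (rV_cons z)).
  exact: (measurableT_comp mg (@measurable_rV_cons R n)).
have mG k : measurable_fun setT (G k).
  by apply/measurable_EFinP; apply: measurableT_comp => //; exact: measurable_funB.
have mH k : measurable_fun setT (H k).
  by apply/measurable_EFinP; apply: measurableT_comp => //; exact: measurable_funB.
have G0 k z : 0 <= G k z by rewrite lee_fin.
have H0 k z : 0 <= H k z by rewrite lee_fin.
pose u k := \int[mu n]_x \int[leb]_s G k (x, s).
pose v k := \int[leb]_s \int[mu n]_x H k (x, s).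
have mN1 : measurable_fun setT (fun x : 'rV[R]_n => \int[leb]_s `|g (rV_cons (x, s))|%:E).
  exact: (@measurable_fun_fubini_tonelli_F _ _ _ _ _ leb (fun z => `|g (rV_cons z)|%:E)).
have mN2 : measurable_fun setT (fun s : measurableTypeR R => \int[mu n]_x `|g (rV_cons (x, s))|%:E).
  exact: (@measurable_fun_fubini_tonelli_G _ _ _ _ _ (mu n) (fun z => `|g (rV_cons z)|%:E)).
have N10 x : 0 <= \int[leb]_s `|g (rV_cons (x, s))|%:E by exact: integral_ge0.
have N20 s : 0 <= \int[mu n]_x `|g (rV_cons (x, s))|%:E by exact: integral_ge0.
have u_0 : u k @[k --> \oo] --> 0.
  apply: (@ge0_dominated_cvg0 _ _ _ (mu n) (fun k x => \int[leb]_s G k (x, s))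
    (fun x => 2%:E * \int[leb]_s `|g (rV_cons (x, s))|%:E)).
  - by move=> k; exact: (@measurable_fun_fubini_tonelli_F _ _ _ _ _ leb (G k)).
  - by move=> k x; exact: integral_ge0.
  - apply: filterS (ae_lty mN1 N10 ig2) => x xi.
    apply: L1_translation1 => //; first exact: mpair1.
    by have := h0 ord0; under eq_fun do rewrite hE mxE unlift_none/=.
  - exact: measurable_funeM.
  - by rewrite ge0_integralZl_EFin// lte_mul_pinfty.
  - move=> k x; have mg1 := mpair1 x mg.
    have mg2 : measurable_fun setT (fun s : measurableTypeR R => `|g (rV_cons (x, s))|%:E).
      by apply/measurable_EFinP; exact: measurableT_comp.
    have mg3 : measurable_fun setT (fun s : measurableTypeR R => `|g (rV_cons (x, s - t k)%R)|%:E).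
      apply/measurable_EFinP; apply: measurableT_comp => //.
      exact: (@measurable_translate1 _ (t k) (fun s => g (rV_cons (x, s)))).
    rewrite mule_natl mule2n -{1}(ge0_integral_translate1 (t k) mg2)// -ge0_integralD//.
    apply: ge0_le_integral => //.
    + apply: (measurableT_comp (mG k)); exact: pair1_measurable.
    + exact: emeasurable_funD.
    + by move=> s _; rewrite -EFinD lee_fin ler_normB.
have v_0 : v k @[k --> \oo] --> 0.
  apply: (@ge0_dominated_cvg0 _ _ _ leb (fun k s => \int[mu n]_x H k (x, s))
    (fun s => 2%:E * \int[mu n]_x `|g (rV_cons (x, s))|%:E)).
  - by move=> k; exact: (@measurable_fun_fubini_tonelli_G _ _ _ _ _ (mu n) (H k)).
  - by move=> k x; exact: integral_ge0.
  - apply: filterS (ae_lty mN2 N20 ig2') => s si.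
    apply: IH => //; first exact: mpair2.
    move=> i; have := h0 (lift ord0 i); by under eq_fun do rewrite hE mxE liftK/=.
  - exact: measurable_funeM.
  - by rewrite ge0_integralZl_EFin// lte_mul_pinfty.
  - move=> k s; have mg1 := mpair2 s mg.
    have mg2 : measurable_fun setT (fun x : 'rV[R]_n => `|g (rV_cons (x, s))|%:E).
      by apply/measurable_EFinP; exact: measurableT_comp.
    have mg3 : measurable_fun setT (fun x : 'rV[R]_n => `|g (rV_cons (x - h' k, s)%R)|%:E).
      exact: (measurableT_comp mg2 (measurable_sub_snd (h' k))).
    rewrite mule_natl mule2n -{1}(ge0_integral_translate (h' k) mg2)// -ge0_integralD//.
    apply: ge0_le_integral => //.
    + apply: (measurableT_comp (mH k)); exact: pair2_measurable.
    + exact: emeasurable_funD.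
    + by move=> x _; rewrite -EFinD lee_fin ler_normB.
apply: (@ge0_squeeze_cvg0 _ _ (fun k => u k + v k)).
- by move=> k; exact: integral_ge0.
- move=> k; rewrite ge0_integral_rVS//; last first.
    apply/measurable_EFinP; apply: measurableT_comp => //; apply: measurable_funB => //.
    exact: (measurableT_comp mg (measurable_sub_snd (h k))).
  rewrite /u /v.
  pose Gs (z : 'rV[R]_n * measurableTypeR R) := G k (z.1 - h' k, z.2)%R.
  have mGs : measurable_fun setT Gs.
    apply: (measurableT_comp (mG k)); apply: measurable_fun_pair; last exact: measurable_snd.
    apply: measurable_rV_sub; [exact: measurable_fst|exact: measurable_cst].
  have mIG : measurable_fun setT (fun x => \int[leb]_s G k (x, s)).
    exact: (@measurable_fun_fubini_tonelli_F _ _ _ _ _ leb (G k)).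
  rewrite -(ge0_integral_translate (h' k) mIG); last by move=> x; exact: integral_ge0.
  rewrite -(@fubini_tonelli _ _ _ _ _ (mu n) leb (H k))//.
  rewrite -ge0_integralD//; last 4 first.
  + by move=> x _; exact: integral_ge0.
  + exact: (measurableT_comp mIG (measurable_sub_snd (h' k))).
  + by move=> x _; exact: integral_ge0.
  + exact: (@measurable_fun_fubini_tonelli_F _ _ _ _ _ leb (H k)).
  apply: ge0_le_integral => //.
  + by move=> x _; exact: integral_ge0.
  + apply: (@measurable_fun_fubini_tonelli_F _ _ _ _ _ leb
      (fun z => `|g (rV_cons z - h k)%R - g (rV_cons z)|%:E)) => //.
    apply/measurable_EFinP; apply: measurableT_comp => //; apply: measurable_funB => //.
    exact: (measurableT_comp (measurableT_comp mg (measurable_sub_snd (h k))) (@measurable_rV_cons R n)).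
  + apply: emeasurable_funD.
      exact: (measurableT_comp mIG (measurable_sub_snd (h' k))).
    exact: (@measurable_fun_fubini_tonelli_F _ _ _ _ _ leb (H k)).
  + move=> x _; rewrite -ge0_integralD//; last 2 first.
    * by apply: (measurableT_comp (mG k)); exact: pair1_measurable.
    * by apply: (measurableT_comp (mH k)); exact: pair1_measurable.
    apply: ge0_le_integral => //.
    * apply/measurable_EFinP; apply: measurableT_comp => //; apply: measurable_funB; last exact: mpair1.
      apply: (measurableT_comp mg); apply: (measurableT_comp (measurable_sub_snd (h k))).
      by apply: (measurableT_comp (@measurable_rV_cons R n)); exact: pair1_measurable.
    * apply: emeasurable_funD.
        by apply: (measurableT_comp (mG k)); exact: pair1_measurable.
      by apply: (measurableT_comp (mH k)); exact: pair1_measurable.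
    * move=> s _; rewrite -EFinD lee_fin hE rV_consB /=.
      by rewrite (le_trans _ (ler_normD _ _))// addrA subrK.
- by rewrite -[X in _ --> X](adde0 0); apply: cvgeD.
Qed.

Lemma L1_translation n (f : 'rV[R]_n -> R[i]) (h : nat -> 'rV[R]_n) :
  cintegrable (mu n) f -> (forall i, h k 0%R i @[k --> \oo] --> (0 : R)%R) ->
  \int[mu n]_x (normc (f (x - h k) - f x))%:E @[k --> \oo] --> 0.
Proof.
move=> fi h0; have [[mf1 mf2] _] := fi.
have /integrableP[_ i1] := cintegrable_Re fi.
have /integrableP[_ i2] := cintegrable_Im fi.
have c1 := L1_translation_real mf1 i1 h0.
have c2 := L1_translation_real mf2 i2 h0.
have mt k (g : 'rV[R]_n -> R) : measurable_fun setT g ->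
    measurable_fun setT (fun x : 'rV[R]_n => `|g (x - h k)%R - g x|%:E).
  move=> mg; apply/measurable_EFinP; apply: measurableT_comp => //; apply: measurable_funB => //.
  exact: (measurableT_comp mg (measurable_sub_snd (h k))).
apply: (@ge0_squeeze_cvg0 _ _ (fun k =>
    \int[mu n]_x `|complex.Re (f (x - h k)) - complex.Re (f x)|%:E +
    \int[mu n]_x `|complex.Im (f (x - h k)) - complex.Im (f x)|%:E)) => [k|k|]; last first.
- by rewrite -[X in _ --> X](adde0 0); apply: cvgeD.
- rewrite -ge0_integralD//; [|exact: mt|exact: mt].
  apply: ge0_le_integral => //.
  + by move=> x _; rewrite lee_fin normc_ge0.
  + apply: cmeas_enormc; apply: cmeasB => //.
    exact: cmeas_comp (measurable_sub_snd (h k)).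
  + by apply: emeasurable_funD; exact: mt.
  + move=> x _; rewrite -EFinD lee_fin (le_trans (normc_le _))//.
    by case: (f (x - h k)%R) (f x) => [a b] [c d].
- by apply: integral_ge0 => x _; rewrite lee_fin normc_ge0.
Qed.

End L1_translation.

Section jensen.
Context d (T : measurableType d) (R : realType) (m : {measure set T -> \bar R}).
Local Open Scope ereal_scope.

Lemma le_poweR (a b : \bar R) (r : R) : (0 <= r)%R -> 0 <= a -> a <= b ->
  a `^ r <= b `^ r.
Proof.
move=> r0 a0 ab; apply: gt0_ler_poweR => //; rewrite in_itv/= leey andbT//.
exact: le_trans ab.
Qed.

Lemma poweRK (a : \bar R) (r : R) : (r != 0)%R -> 0 <= a -> (a `^ r) `^ r^-1 = a.
Proof. by move=> r0 a0; rewrite -poweRrM mulfV// poweRe1. Qed.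

Lemma poweRVK (a : \bar R) (r : R) : (r != 0)%R -> 0 <= a -> (a `^ r^-1) `^ r = a.
Proof. by move=> r0 a0; rewrite -poweRrM mulVf// poweRe1. Qed.

(* Hölder's inequality for K = K^(1/q) K^(1/p), with 1/p + 1/q = 1. *)
Lemma jensen_poweR (K F : T -> R) (p : R) : (1 <= p)%R ->
  measurable_fun setT K -> measurable_fun setT F ->
  (forall x, 0 <= K x)%R -> (forall x, 0 <= F x)%R ->
  (\int[m]_x (K x * F x)%:E) `^ p <=
  (\int[m]_x (K x)%:E) `^ (p - 1) * \int[m]_x (K x * F x `^ p)%:E.
Proof.
move=> p1 mK mF K0 F0.
have I0 (h : T -> R) : (forall x, 0 <= h x)%R -> 0 <= \int[m]_x (h x)%:E.
  by move=> h0; apply: integral_ge0 => x _; rewrite lee_fin.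
move: p1; rewrite le_eqVlt => /predU1P[<-|p1].
  rewrite subrr poweRe0 mul1e poweRe1; last by apply: I0 => x; rewrite mulr_ge0.
  by under [leRHS]eq_integral do rewrite powRr1//.
have p0 : (0 < p)%R by rewrite (lt_trans _ p1).
pose q := (p / (p - 1))%R.
have pm0 : (0 < p - 1)%R by rewrite subr_gt0.
have q0 : (0 < q)%R by rewrite divr_gt0.
have pq : (p^-1 + q^-1 = 1)%R by rewrite /q; field; rewrite !gt_eqF.
pose f1 x := (K x `^ q^-1)%R.
pose f2 x := (K x `^ p^-1 * F x)%R.
have mf1 : measurable_fun setT f1.
  by apply: (measurableT_comp (measurable_powR _) mK).
have mf2 : measurable_fun setT f2.
  by apply: measurable_funM => //; apply: (measurableT_comp (measurable_powR _) mK).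
have := hoelder m mf2 mf1 p0 q0 pq.
have -> : 'N[m]_1[EFin \o (f2 \* f1)%R] = \int[m]_x (K x * F x)%:E.
  rewrite Lnorm1; apply: eq_integral => x _ /=.
  rewrite ger0_norm ?mulr_ge0 ?powR_ge0//; congr EFin.
  rewrite /f1 /f2 mulrAC -powRD ?pq ?powRr1//.
  by rewrite oner_eq0.
have -> : 'N[m]_p%:E[EFin \o f2] = (\int[m]_x (K x * F x `^ p)%:E) `^ p^-1.
  rewrite unlock; congr (_ `^ _); apply: eq_integral => x _ /=.
  rewrite ger0_norm ?mulr_ge0 ?powR_ge0// /f2 powRM ?powR_ge0// -powRrM mulVf ?gt_eqF//.
  by rewrite powRr1.
have -> : 'N[m]_q%:E[EFin \o f1] = (\int[m]_x (K x)%:E) `^ q^-1.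
  rewrite unlock; congr (_ `^ _); apply: eq_integral => x _ /=.
  rewrite ger0_norm ?powR_ge0// /f1 -powRrM mulVf ?gt_eqF//.
  by rewrite powRr1.
move=> /(le_poweR (ltW p0)) h.
apply: (le_trans (h _)); first by apply: I0 => x; rewrite mulr_ge0.
rewrite poweRM ?poweR_ge0// poweRVK ?gt_eqF//; last first.
  by apply: I0 => x; rewrite mulr_ge0 ?powR_ge0.
rewrite -poweRrM muleC (_ : (q^-1 * p)%R = (p - 1)%R)//.
by rewrite /q; field; rewrite !gt_eqF.
Qed.

End jensen.

Section Lnorm_nonneg.
Context d (T : measurableType d) (R : realType) (m : {measure set T -> \bar R}).
Local Open Scope ereal_scope.
Implicit Types (F G : T -> \bar R) (p : \bar R).

Lemma ge1_cases p : 1 <= p -> p = +oo \/ exists2 r : R, (1 <= r)%R & p = r%:E.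
Proof. by case: p => [r||]//; [right; exists r|left]. Qed.

Lemma measurable_abse_poweR F (r : R) : measurable_fun setT F ->
  measurable_fun setT (fun x => `|F x| `^ r).
Proof.
move=> mF; apply: (measurableT_comp (measurable_poweR _)).
exact: measurableT_comp.
Qed.

Lemma ae_le_Lnorm p F G : 1 <= p -> measurable_fun setT F -> measurable_fun setT G ->
  {ae m, forall x, `|F x| <= `|G x|} -> 'N[m]_p[F] <= 'N[m]_p[G].
Proof.
move=> /ge1_cases[->|[r r1 ->]] mF mG FG; rewrite unlock /Lnorm.
- by case: ifPn => // _; apply: le_ess_sup.
- have r0 : (0 <= r)%R by rewrite (le_trans _ r1).
  apply: le_poweR; first by rewrite invr_ge0.
    by apply: integral_ge0 => x _; exact: poweR_ge0.
  apply: ae_ge0_le_integral => //.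
  + by move=> x _; exact: poweR_ge0.
  + exact: measurable_abse_poweR.
  + by move=> x _; exact: poweR_ge0.
  + exact: measurable_abse_poweR.
  + by apply: filterS FG => x h _; exact: le_poweR.
Qed.

Lemma Lnorm_lty_ae p F : 1 <= p -> measurable_fun setT F -> 'N[m]_p[F] < +oo ->
  {ae m, forall x, `|F x| < +oo}.
Proof.
move=> /ge1_cases[->|[r r1 ->]] mF; rewrite unlock /Lnorm.
- case: ifPn => [m0 h|/negP m0 _]; last first.
    exists setT; split => //.
    by apply/eqP; rewrite eq_le measure_ge0 andbT leNgt; exact/negP.
  by apply: filterS (ess_sup_ge m (abse \o F)) => x /= hx; exact: le_lt_trans h.
- have r0 : (0 < r)%R by rewrite (lt_le_trans _ r1).
  have I0 : 0 <= \int[m]_x `|F x| `^ r by apply: integral_ge0 => x _; exact: poweR_ge0.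
  move=> h.
  have h' : \int[m]_x `|F x| `^ r < +oo.
    by move: h; apply: lty_poweRy; rewrite invr_eq0 gt_eqF.
  have := ae_lty (measurable_abse_poweR r mF) (fun x => poweR_ge0 _ _) h'.
  by apply: filterS => x; apply: lty_poweRy; rewrite gt_eqF.
Qed.

Lemma LnormyE F :
  'N[m]_+oo[F] = if 0 < m setT then ess_sup m (abse \o F) else 0.
Proof. by rewrite unlock. Qed.

Lemma LnormrE (r : R) F : 'N[m]_r%:E[F] = (\int[m]_x `|F x| `^ r) `^ r^-1.
Proof. by rewrite unlock. Qed.

Lemma Lnorm_nneseries p (F : (T -> \bar R)^nat) : 1 <= p ->
  (forall k, measurable_fun setT (F k)) -> (forall k x, 0 <= F k x) ->
  (forall k, {ae m, forall x, F k x < +oo}) ->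
  'N[m]_p[(fun x => \sum_(k <oo) F k x)] <= \sum_(k <oo) 'N[m]_p[F k].
Proof.
move=> p1 mF F0 Foo.
have S0 x : 0 <= \sum_(k <oo) F k x by apply: nneseries_ge0.
have [pE|[r r1 pE]] := ge1_cases p1; subst p.
- rewrite [X in X <= _]LnormyE; case: ifPn => m0; last first.
    by apply: nneseries_ge0 => k _ _; exact: Lnorm_ge0.
  apply/ess_supP.
  have : {ae m, forall x, forall k, F k x <= 'N[m]_+oo[F k]}.
    apply/ae_foralln => k; rewrite LnormyE m0.
    by apply: filterS (ess_sup_ge m (abse \o F k)) => x /=; rewrite gee0_abs.
  apply: filterS => x h /=; rewrite gee0_abs//.
  by apply: lee_nneseries => // k _.
- have r0 : (0 < r)%R by rewrite (lt_le_trans _ r1).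
  pose S n x := \sum_(0 <= k < n) F k x.
  have Sn0 n x : 0 <= S n x by exact: sume_ge0.
  have mS n : measurable_fun setT (S n).
    by apply: emeasurable_sum => k.
  have fin n : 'N[m]_r%:E[S n] <= \sum_(0 <= k < n) 'N[m]_r%:E[F k].
    elim: n => [|n IH].
      rewrite big_geq// (_ : S 0%N = cst 0) ?Lnorm0// ?eqe ?gt_eqF//.
      by apply/funext => x; rewrite /S big_geq.
    rewrite big_nat_recr//=; apply: (le_trans _ (leeD IH (lexx _))).
    pose S' x := fine (S n x); pose F' x := fine (F n x).
    have mS' : measurable_fun setT S' by apply: measurableT_comp => //; exact: fine_measurable.
    have mF' : measurable_fun setT F' by apply: measurableT_comp => //; exact: fine_measurable.
    have fine_ae : {ae m, forall x, forall k, F k x < +oo} by exact/ae_foralln.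
    have eS : {ae m, forall x, (S' x)%:E = S n x /\ (F' x)%:E = F n x}.
      apply: filterS fine_ae => x h; split; rewrite fineK// ge0_fin_numE//.
      by apply/lte_sum_pinfty => k _.
    apply: (@le_trans _ _ 'N[m]_r%:E[EFin \o (S' \+ F')%R]).
      apply: ae_le_Lnorm => //; first by apply/measurable_EFinP; exact: measurable_funD.
      apply: filterS eS => x [h1 h2] /=.
      by have -> : S n.+1 x = (S' x + F' x)%:E by rewrite EFinD h1 h2 /S big_nat_recr.
    apply: (le_trans (eminkowski m mS' mF' p1)); apply: leeD.
    + apply: ae_le_Lnorm => //; first exact/measurable_EFinP.
      by apply: filterS eS => x [h1 h2] /=; rewrite -h1.
    + apply: ae_le_Lnorm => //; first exact/measurable_EFinP.
      by apply: filterS eS => x [h1 h2] /=; rewrite -h2.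
  have N0 k : 0 <= 'N[m]_r%:E[F k] by exact: Lnorm_ge0.
  rewrite -[leRHS](@poweRK _ _ r) ?gt_eqF//; last exact: nneseries_ge0.
  rewrite [X in X <= _]LnormrE; apply: le_poweR; first by rewrite invr_ge0 ltW.
    by apply: integral_ge0 => x _; exact: poweR_ge0.
  pose G n x := `|S n x| `^ r.
  have ndG x : nondecreasing_seq (G ^~ x).
    apply/nondecreasing_seqP => k; apply: le_poweR; rewrite ?(ltW r0)//.
    by rewrite !gee0_abs// /S big_nat_recr//= leeDl.
  have mG k : measurable_fun setT (G k) by exact: measurable_abse_poweR.
  have G0 k x : 0 <= G k x by exact: poweR_ge0.
  have GE x : limn (G ^~ x) = ereal_sup (range (G ^~ x)).
    by apply/cvg_lim => //; exact: ereal_nondecreasing_cvgn.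
  have LE x : `|\sum_(k <oo) F k x| `^ r <= limn (G ^~ x).
    have L0 : 0 <= limn (G ^~ x).
      by rewrite GE; apply: (le_trans (G0 0%N x)); apply: ereal_sup_ubound; exists 0%N.
    rewrite -[leRHS](@poweRVK _ _ r) ?gt_eqF//; apply: le_poweR => //; first exact: ltW.
    rewrite gee0_abs//; apply: lime_le; first by apply: is_cvg_nneseries => k _ _.
    apply: nearW => k; rewrite -[leLHS](@poweRK _ _ r) ?gt_eqF//; last exact: Sn0.
    apply: le_poweR; [by rewrite invr_ge0 ltW|exact: poweR_ge0|].
    by rewrite GE; apply: ereal_sup_ubound; exists k => //; rewrite /G gee0_abs.
  have mL : measurable_fun setT (fun x => limn (G ^~ x)).
    apply: (emeasurable_fun_cvg G) => // x _.
    exact: ereal_nondecreasing_is_cvgn.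
  apply: (@le_trans _ _ (\int[m]_x limn (G ^~ x))).
    apply: ge0_le_integral => //; first by move=> x _; exact: poweR_ge0.
    by apply: measurable_abse_poweR; exact: ge0_emeasurable_sum.
  rewrite monotone_convergence//.
  apply: lime_le.
    apply: ereal_nondecreasing_is_cvgn => a b ab; apply: ge0_le_integral => //.
    by move=> x _; exact: ndG.
  apply: nearW => k; rewrite -poweR_Lnorm ?gt_eqF//.
  apply: le_poweR; [exact: ltW|exact: Lnorm_ge0|].
  by apply: (le_trans (fin k)); exact: nneseries_lim_ge.
Qed.

End Lnorm_nonneg.

Section young.
Context {R : realType} {n : nat}.
Local Notation mu := (@lebesgue_rV R n).
Local Notation V := 'rV[R]_n.
Local Open Scope ereal_scope.

Lemma measurable_conv_integrand (F G : V -> R) :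
  measurable_fun setT F -> measurable_fun setT G ->
  measurable_fun setT (fun z : V * V => (F (z.1 - z.2) * G z.2)%R).
Proof.
move=> mF mG; apply: measurable_funM.
  exact: (measurableT_comp mF measurable_sub_pair).
exact: (measurableT_comp mG measurable_snd).
Qed.

Lemma measurable_conv_ge0 (F G : V -> R) :
  measurable_fun setT F -> measurable_fun setT G ->
  (forall x, 0 <= F x)%R -> (forall x, 0 <= G x)%R ->
  measurable_fun setT (fun x : V => \int[mu]_y (F (x - y) * G y)%:E).
Proof.
move=> mF mG F0 G0.
apply: (@measurable_fun_fubini_tonelli_F _ _ _ _ _ mu
  (fun z : V * V => (F (z.1 - z.2) * G z.2)%:E)).
  by apply/measurable_EFinP; exact: measurable_conv_integrand.
by move=> z; rewrite lee_fin mulr_ge0.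
Qed.

Lemma integral_conv_ge0 (F G : V -> R) :
  measurable_fun setT F -> measurable_fun setT G ->
  (forall x, 0 <= F x)%R -> (forall x, 0 <= G x)%R ->
  \int[mu]_x \int[mu]_y (F (x - y) * G y)%:E =
  \int[mu]_x (F x)%:E * \int[mu]_y (G y)%:E.
Proof.
move=> mF mG F0 G0.
have mFG : measurable_fun setT (fun z : V * V => (F (z.1 - z.2) * G z.2)%:E).
  by apply/measurable_EFinP; exact: measurable_conv_integrand.
rewrite (@fubini_tonelli _ _ _ _ _ mu mu (fun z : V * V => (F (z.1 - z.2) * G z.2)%:E))//; last first.
  by move=> z; rewrite lee_fin mulr_ge0.
have IF0 : 0 <= \int[mu]_x (F x)%:E by apply: integral_ge0 => x _; rewrite lee_fin.
rewrite -ge0_integralZl//; first last.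
- by move=> x _; rewrite lee_fin.
- exact/measurable_EFinP.
apply: eq_integral => y _.
under eq_integral do rewrite mulrC EFinM /=.
rewrite ge0_integralZl_EFin//; last 2 first.
- by move=> x _; rewrite lee_fin.
- by apply/measurable_EFinP; exact: (measurableT_comp mF (measurable_sub_snd y)).
rewrite muleC (ge0_integral_translate y (g := fun x => (F x)%:E))//.
exact/measurable_EFinP.
Qed.

Lemma young (p : \bar R) (F G : V -> R) : 1 <= p ->
  measurable_fun setT F -> measurable_fun setT G ->
  (forall x, 0 <= F x)%R -> (forall x, 0 <= G x)%R ->
  \int[mu]_y (G y)%:E < +oo ->
  'N[mu]_p[(fun x => \int[mu]_y (F (x - y) * G y)%:E)] <=
  'N[mu]_p[EFin \o F] * \int[mu]_y (G y)%:E.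
Proof.
move=> p1 mF mG F0 G0 Goo.
have IG0 : 0 <= \int[mu]_y (G y)%:E by apply: integral_ge0 => y _; rewrite lee_fin.
have A0 x : 0 <= \int[mu]_y (F (x - y) * G y)%:E.
  by apply: integral_ge0 => y _; rewrite lee_fin mulr_ge0.
have mA := measurable_conv_ge0 mF mG F0 G0.
have mFx (x : V) : measurable_fun setT (fun y : V => F (x - y)%R).
  exact: (measurableT_comp mF (measurable_sub_fst x)).
have [pE|[r r1 pE]] := ge1_cases p1; subst p.
- rewrite !LnormyE; case: ifPn => m0; last by rewrite mul0e.
  apply/ess_supP; apply: nearW => x /=; rewrite gee0_abs//.
  set S := ess_sup mu _.
  have FS : {ae mu, forall y, (F y)%:E <= S}.
    apply: filterS (ess_sup_ge mu (abse \o (EFin \o F))) => y /=.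
    by rewrite ger0_norm.
  have S0 : 0 <= S.
    apply: ess_sup_gee => //; apply: nearW => y /=; rewrite lee_fin normr_ge0//.
  rewrite -ge0_integralZl//; first last.
  + by move=> y _; rewrite lee_fin.
  + exact/measurable_EFinP.
  apply: ae_ge0_le_integral => //.
  + by move=> y _; rewrite lee_fin mulr_ge0.
  + by apply/measurable_EFinP; exact: measurable_funM.
  + by move=> y _; rewrite mule_ge0// lee_fin.
  + by apply: measurable_funeM; exact/measurable_EFinP.
  + apply: filterS (ae_reflect x FS) => y h _.
    by rewrite EFinM lee_wpmul2r// lee_fin.
- have r0 : (0 < r)%R by rewrite (lt_le_trans _ r1).
  rewrite !LnormrE.
  set A := fun x : V => _ in A0 mA *.
  have Fr0 x : (0 <= F x `^ r)%R by exact: powR_ge0.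
  have mFr : measurable_fun setT (fun x => F x `^ r)%R.
    exact: (measurableT_comp (measurable_powR _) mF).
  rewrite -[X in _ * X](@poweRK _ _ r) ?gt_eqF//.
  have FE : \int[mu]_x `|(EFin \o F) x| `^ r = \int[mu]_x (F x `^ r)%:E.
    by apply: eq_integral => x _ /=; rewrite ger0_norm.
  have IF0 : 0 <= \int[mu]_x (F x `^ r)%:E by apply: integral_ge0 => x _; rewrite lee_fin.
  rewrite FE -poweRM ?poweR_ge0//; apply: le_poweR.
  + by rewrite invr_ge0 ltW.
  + by apply: integral_ge0 => x _; exact: poweR_ge0.
  apply: (@le_trans _ _ (\int[mu]_x ((\int[mu]_y (G y)%:E) `^ (r - 1) *
      \int[mu]_y (F (x - y)%R `^ r * G y)%:E))).
    apply: ge0_le_integral => //.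
    * by move=> x _; exact: poweR_ge0.
    * exact: measurable_abse_poweR.
    * by apply: measurable_funeM; exact: (measurable_conv_ge0 mFr mG Fr0 G0).
    * move=> x _; rewrite gee0_abs//.
      have := jensen_poweR mu r1 mG (mFx x) G0 (fun y => F0 _).
      under [in X in X -> _]eq_integral do rewrite mulrC.
      by under [X in _ <= _ * X -> _]eq_integral do rewrite mulrC.
  rewrite ge0_integralZl//; last 3 first.
  + exact: (measurable_conv_ge0 mFr mG Fr0 G0).
  + by move=> x _; apply: integral_ge0 => y _; rewrite lee_fin mulr_ge0.
  + exact: poweR_ge0.
  rewrite (integral_conv_ge0 mFr mG Fr0 G0) muleCA; apply: lee_wpmul2l => //.
  have Gfin : \int[mu]_y (G y)%:E \is a fin_num by rewrite ge0_fin_numE.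
  rewrite -(fineK Gfin) !poweR_EFin -EFinM lee_fin mulrC mulr_powRB1//.
  by rewrite fine_ge0.
Qed.

End young.

Section Lp_norm_theory.
Context {R : realType} {n : nat}.
Local Notation mu := (@lebesgue_rV R n).
Local Notation V := 'rV[R]_n.
Local Open Scope ereal_scope.
Implicit Types (f g : V -> R[i]) (p : \bar R).

Lemma Lp1E f : Lp_norm 1%:E f = \int[mu]_x (normc (f x))%:E.
Proof.
rewrite /Lp_norm Lnorm1; apply: eq_integral => x _ /=.
by rewrite ger0_norm ?normc_ge0.
Qed.

Lemma in_L1P f : in_Lp 1%:E f <-> cintegrable mu f.
Proof. by rewrite /in_Lp Lp1E. Qed.

Lemma Lp_norm_ge0 p f : 0 <= Lp_norm p f.
Proof. exact: Lnorm_ge0. Qed.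

Lemma in_Lp_fin p f : in_Lp p f -> Lp_norm p f \is a fin_num.
Proof. by move=> [_ h]; rewrite ge0_fin_numE// Lp_norm_ge0. Qed.

Lemma ae_le_Lp_norm p f g : 1 <= p -> cmeas f -> cmeas g ->
  {ae mu, forall x, normc (f x) <= normc (g x)}%R -> Lp_norm p f <= Lp_norm p g.
Proof.
move=> p1 mf mg fg; apply: ae_le_Lnorm => //; try exact: cmeas_enormc.
by apply: filterS fg => x h; rewrite /= !ger0_norm ?normc_ge0.
Qed.

Lemma ae_eq_Lp_norm p f g : 1 <= p -> cmeas f -> cmeas g ->
  {ae mu, forall x, f x = g x} -> Lp_norm p f = Lp_norm p g.
Proof.
move=> p1 mf mg fg; apply/eqP; rewrite eq_le; apply/andP; split.
  by apply: ae_le_Lp_norm => //; apply: filterS fg => x ->.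
by apply: ae_le_Lp_norm => //; apply: filterS fg => x ->.
Qed.

Lemma Lp_normD p f g : 1 <= p -> cmeas f -> cmeas g ->
  Lp_norm p (fun x => f x + g x)%R <= Lp_norm p f + Lp_norm p g.
Proof.
move=> p1 mf mg.
apply: (le_trans _ (eminkowski mu (cmeas_normc mf) (cmeas_normc mg) p1)).
apply: ae_le_Lnorm => //.
- by apply: cmeas_enormc; exact: cmeasD.
- by apply/measurable_EFinP; apply: measurable_funD; exact: cmeas_normc.
- apply: nearW => x /=.
  by rewrite lee_fin !ger0_norm ?addr_ge0 ?normc_ge0// normcD.
Qed.

Lemma Lp_normN p f : Lp_norm p (fun x => - f x)%R = Lp_norm p f.
Proof. by apply: eq_Lnorm => x; rewrite normcN. Qed.

Lemma Lp_normB p f g : 1 <= p -> cmeas f -> cmeas g ->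
  Lp_norm p (fun x => f x - g x)%R <= Lp_norm p f + Lp_norm p g.
Proof.
move=> p1 mf mg; apply: (le_trans (Lp_normD p1 mf (cmeasN mg))).
by rewrite Lp_normN.
Qed.

Lemma in_LpB p f g : 1 <= p -> in_Lp p f -> in_Lp p g ->
  in_Lp p (fun x => f x - g x)%R.
Proof.
move=> p1 [mf fi] [mg gi]; split; first exact: cmeasB.
by apply: (le_lt_trans (Lp_normB p1 mf mg)); rewrite lte_add_pinfty.
Qed.

End Lp_norm_theory.

Section convolution_theory.
Context {R : realType} {n : nat}.
Local Notation mu := (@lebesgue_rV R n).
Local Notation V := 'rV[R]_n.
Local Open Scope ereal_scope.
Implicit Types (f g k : V -> R[i]) (p : \bar R).

Lemma convE f g x : convolution f g x = cint mu (fun y => f (x - y) * g y)%R.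
Proof. by []. Qed.

Lemma cmeas_conv_integrand f g : cmeas f -> cmeas g ->
  cmeas (fun z : V * V => f (z.1 - z.2) * g z.2)%R.
Proof.
move=> mf mg; apply: cmeasM.
  exact: (cmeas_comp mf measurable_sub_pair).
exact: (cmeas_comp mg measurable_snd).
Qed.

Lemma cmeas_conv f g : cmeas f -> cmeas g -> cmeas (convolution f g).
Proof.
move=> mf mg.
exact: (cmeas_cint_snd mu (cmeas_conv_integrand mf mg)).
Qed.

Lemma cmeas_conv_fst f g (x : V) : cmeas f -> cmeas g ->
  cmeas (fun y : V => f (x - y) * g y)%R.
Proof.
by move=> mf mg; apply: cmeasM => //; exact: (cmeas_comp mf (measurable_sub_fst x)).
Qed.

Let mconv f g : cmeas f -> cmeas g ->
  measurable_fun setT (fun x : V => \int[mu]_y (normc (f (x - y)) * normc (g y))%:E).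
Proof.
move=> mf mg; exact: (measurable_conv_ge0 (cmeas_normc mf) (cmeas_normc mg)
  (fun x => normc_ge0 _) (fun x => normc_ge0 _)).
Qed.

Let conv0 f g (x : V) : 0 <= \int[mu]_y (normc (f (x - y)) * normc (g y))%:E.
Proof. by apply: integral_ge0 => y _; rewrite lee_fin mulr_ge0 ?normc_ge0. Qed.

Lemma normc_conv_le f g (x : V) : cmeas f -> cmeas g ->
  (normc (convolution f g x))%:E <= \int[mu]_y (normc (f (x - y)) * normc (g y))%:E.
Proof.
move=> mf mg; rewrite convE; apply: (le_trans (normc_cint_le _ (cmeas_conv_fst x mf mg))).
by under eq_integral do rewrite normcM.
Qed.

Let young_normc p f g : 1 <= p -> cmeas f -> cintegrable mu g ->
  'N[mu]_p[(fun x : V => \int[mu]_y (normc (f (x - y)) * normc (g y))%:E)] <=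
  Lp_norm p f * Lp_norm 1%:E g.
Proof.
move=> p1 mf [mg gi]; rewrite Lp1E.
apply: (young p1 (cmeas_normc mf) (cmeas_normc mg)) => //.
- by move=> x; exact: normc_ge0.
- by move=> x; exact: normc_ge0.
Qed.

Lemma Lp_conv_le p f g : 1 <= p -> cmeas f -> cintegrable mu g ->
  Lp_norm p (convolution f g) <= Lp_norm p f * Lp_norm 1%:E g.
Proof.
move=> p1 mf gi; have [mg _] := gi.
apply: (le_trans _ (young_normc p1 mf gi)).
apply: ae_le_Lnorm => //.
- by apply: cmeas_enormc; exact: cmeas_conv.
- exact: mconv.
- apply: nearW => x /=; rewrite ger0_norm ?normc_ge0// gee0_abs//.
  exact: normc_conv_le.
Qed.

Lemma in_Lp_conv p f g : 1 <= p -> in_Lp p f -> cintegrable mu g ->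
  in_Lp p (convolution f g).
Proof.
move=> p1 fp gi; have [mf fi] := fp; have [mg gi'] := gi; split; first exact: cmeas_conv.
apply: (le_lt_trans (Lp_conv_le p1 mf gi)).
rewrite lte_mul_pinfty ?Lp_norm_ge0//; first exact: (in_Lp_fin fp).
by rewrite Lp1E.
Qed.

Lemma cintegrable_conv f g : cintegrable mu f -> cintegrable mu g ->
  cintegrable mu (convolution f g).
Proof. by move=> /in_L1P fi gi; apply/in_L1P; apply: in_Lp_conv. Qed.

Lemma ae_conv_lty p f g : 1 <= p -> in_Lp p f -> cintegrable mu g ->
  {ae mu, forall x, \int[mu]_y (normc (f (x - y)) * normc (g y))%:E < +oo}.
Proof.
move=> p1 fp gi; have [mf fi] := fp; have [mg gi'] := gi.
have : 'N[mu]_p[(fun x : V => \int[mu]_y (normc (f (x - y)) * normc (g y))%:E)] < +oo.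
  apply: (le_lt_trans (young_normc p1 mf gi)).
  rewrite lte_mul_pinfty ?Lp_norm_ge0//; first exact: (in_Lp_fin fp).
  by rewrite Lp1E.
move=> /(Lnorm_lty_ae p1 (mconv mf mg)); apply: filterS => x /=.
by rewrite gee0_abs.
Qed.

Lemma ae_cintegrable_conv p f g : 1 <= p -> in_Lp p f -> cintegrable mu g ->
  {ae mu, forall x, cintegrable mu (fun y => f (x - y) * g y)%R}.
Proof.
move=> p1 fp gi; have [mf fi] := fp; have [mg gi'] := gi.
apply: filterS (ae_conv_lty p1 fp gi) => x h; split; first exact: cmeas_conv_fst.
by under eq_integral do rewrite normcM.
Qed.

Lemma convC f g : cmeas f -> cmeas g -> convolution f g = convolution g f.
Proof.
move=> mf mg; apply/funext => x; rewrite !convE.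
rewrite -(cint_reflect x (f := fun y => (f (x - y) * g y)%R)); last exact: cmeas_conv_fst.
by congr cint; apply/funext => y; rewrite opprB addrC subrK mulrC.
Qed.

Lemma conv_ae_eqr f g k : cmeas f -> cmeas g -> cmeas k ->
  {ae mu, forall x, g x = k x} -> convolution f g = convolution f k.
Proof.
move=> mf mg mk gk; apply/funext => x; rewrite !convE; apply: ae_eq_cint.
- exact: cmeas_conv_fst.
- exact: cmeas_conv_fst.
- by apply: filterS gk => y ->.
Qed.

Lemma conv_ae_eql f g k : cmeas f -> cmeas g -> cmeas k ->
  {ae mu, forall x, f x = g x} -> convolution f k = convolution g k.
Proof. by move=> mf mg mk fg; rewrite convC// [RHS]convC//; exact: conv_ae_eqr. Qed.

Lemma conv_ae_Br p f g k : 1 <= p -> in_Lp p f -> cintegrable mu g -> cintegrable mu k ->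
  {ae mu, forall x, convolution f (fun y => g y - k y)%R x =
    convolution f g x - convolution f k x}%R.
Proof.
move=> p1 fp gi ki.
have [mf fi] := fp; have [mg gi'] := gi; have [mk ki'] := ki.
apply: filterS2 (ae_cintegrable_conv p1 fp gi) (ae_cintegrable_conv p1 fp ki) => x h1 h2.
rewrite !convE -cintB//; congr cint; apply/funext => y.
by rewrite mulrBr.
Qed.

Lemma conv_ae_Bl p f g k : 1 <= p -> in_Lp p f -> in_Lp p g -> cintegrable mu k ->
  {ae mu, forall x, convolution (fun y => f y - g y)%R k x =
    convolution f k x - convolution g k x}%R.
Proof.
move=> p1 fp gp ki.
apply: filterS2 (ae_cintegrable_conv p1 fp ki) (ae_cintegrable_conv p1 gp ki) => x h1 h2.
rewrite !convE -cintB//; congr cint; apply/funext => y.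
by rewrite mulrBl.
Qed.

Lemma conv_ae_A p f g k : 1 <= p -> in_Lp p f -> cintegrable mu g -> cintegrable mu k ->
  {ae mu, forall x, convolution (convolution f g) k x =
    convolution f (convolution g k) x}.
Proof.
move=> p1 fp gi ki.
have [mf fi] := fp; have [mg gi'] := gi; have [mk ki'] := ki.
pose A (x : V) := \int[mu]_y (normc (f (x - y)) * normc (g y))%:E.
have mA : measurable_fun setT A by exact: mconv.
have A0 x : 0 <= A x by exact: conv0.
have Aoo : {ae mu, forall x, A x < +oo} by exact: ae_conv_lty fp gi.
pose B (x : V) := fine (A x).
have mB : measurable_fun setT B by apply: measurableT_comp => //; exact: fine_measurable.
have B0 x : (0 <= B x)%R by rewrite fine_ge0.
have BA : {ae mu, forall x, (B x)%:E = A x}.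
  by apply: filterS Aoo => x h; rewrite fineK// ge0_fin_numE.
have Boo : {ae mu, forall x, \int[mu]_z (B (x - z)%R * normc (k z))%:E < +oo}.
  have mK := cmeas_normc mk.
  have K0 x : (0 <= normc (k x))%R by exact: normc_ge0.
  have mC := measurable_conv_ge0 mB mK B0 K0.
  have : 'N[mu]_p[(fun x : V => \int[mu]_z (B (x - z)%R * normc (k z))%:E)] < +oo.
    apply: (le_lt_trans (young p1 mB mK B0 K0 ki')).
    have NB : 'N[mu]_p[EFin \o B] <= Lp_norm p f * Lp_norm 1%:E g.
      apply: (le_trans _ (young_normc p1 mf gi)); apply: ae_le_Lnorm => //.
        exact/measurable_EFinP.
      by apply: filterS BA => x h; rewrite -/(A x) -h.
    have NB' : 'N[mu]_p[EFin \o B] < +oo.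
      apply: (le_lt_trans NB); rewrite lte_mul_pinfty ?Lp_norm_ge0//.
        exact: (in_Lp_fin fp).
      by rewrite Lp1E.
    rewrite lte_mul_pinfty ?Lnorm_ge0//.
    by rewrite ge0_fin_numE ?Lnorm_ge0.
  move=> /(Lnorm_lty_ae p1 mC); apply: filterS => x /=.
  rewrite gee0_abs//; apply: integral_ge0 => z _.
  by rewrite lee_fin mulr_ge0.
apply: filterS Boo => x Bx.
pose F (w : V * V) := (f (x - w.2) * g (w.2 - w.1) * k w.1)%R.
have mF : cmeas F.
  apply: cmeasM; last exact: cmeas_comp measurable_fst.
  apply: cmeasM.
    apply: (cmeas_comp mf); apply: (measurableT_comp (measurable_sub_fst x)).
    exact: measurable_snd.
  apply: (cmeas_comp mg); apply: measurable_rV_sub; [exact: measurable_snd|exact: measurable_fst].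
have FE z y : F (z, y)%R = (f (x - z - (y - z)) * g (y - z) * k z)%R.
  by rewrite /F /= opprB addrA subrK.
have mh z : cmeas (fun y : V => f (x - z - y) * g y * k z)%R.
  apply: cmeasM; last exact: cmeas_cst.
  exact: cmeas_conv_fst.
have Foo : \int[mu]_z \int[mu]_y (normc (F (z, y)))%:E < +oo.
  apply: le_lt_trans Bx.
  apply: (@le_trans _ _ (\int[mu]_z (A (x - z)%R * (normc (k z))%:E))).
    rewrite le_eqVlt; apply/orP; left; apply/eqP; apply: eq_integral => z _.
    under eq_integral do rewrite FE.
    rewrite (ge0_integral_translate z (g := fun y => (normc (f (x - z - y) * g y * k z)%R)%:E)).
    - under eq_integral do rewrite !normcM EFinM.
      rewrite ge0_integralZr ?lee_fin ?normc_ge0//.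
      + apply/measurable_EFinP; apply: measurable_funM; last exact: cmeas_normc.
        apply: cmeas_normc; exact: (cmeas_comp mf (measurable_sub_fst (x - z)%R)).
      + by move=> y _; rewrite lee_fin mulr_ge0 ?normc_ge0.
    - exact: cmeas_enormc.
    - by move=> y; rewrite lee_fin normc_ge0.
  apply: ae_ge0_le_integral => //.
  - by move=> z _; rewrite mule_ge0// lee_fin normc_ge0.
  - apply: emeasurable_funM; last exact: cmeas_enormc.
    exact: (measurableT_comp mA (measurable_sub_fst x)).
  - by move=> z _; rewrite lee_fin mulr_ge0 ?normc_ge0.
  - apply/measurable_EFinP; apply: measurable_funM; last exact: cmeas_normc.
    exact: (measurableT_comp mB (measurable_sub_fst x)).
  - by apply: filterS (ae_reflect x BA) => z h _; rewrite EFinM h.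
transitivity (cint mu (fun z => cint mu (fun y => F (z, y)))).
  rewrite convE; apply: ae_eq_cint.
  - by apply: cmeas_conv_fst => //; exact: cmeas_conv.
  - exact: cmeas_cint_snd.
  - apply: filterS (ae_reflect x (ae_cintegrable_conv p1 fp gi)) => z h.
    rewrite (_ : (fun y => F (z, y)) = (fun y => (fun y => f (x - z - y) * g y * k z)%R (y - z)%R)); last first.
      by apply/funext => y; rewrite FE.
    rewrite (cint_translate z (mh z)) convE mulrC -cintZl//; congr cint.
    by apply/funext => y; rewrite mulrC.
rewrite (cint_fubini mF Foo) convE; apply: ae_eq_cint.
- apply: (@cmeas_cint_snd _ _ _ _ _ mu (fun w => F (w.2, w.1))).
  by apply: (cmeas_comp mF); exact: measurable_swap.
- by apply: cmeas_conv_fst => //; exact: cmeas_conv.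
- have g1 : in_Lp 1%:E g by apply/in_L1P.
  apply: filterS (ae_cintegrable_conv (lexx 1%:E) g1 ki) => y h.
  rewrite convE -cintZl//; congr cint; apply/funext => z.
  by rewrite /F /= mulrA.
Qed.

End convolution_theory.

Lemma fineB_scale {R : realType} (k : R) (a b : \bar R) : 0 < k ->
  (0 <= a)%E -> (0 <= b)%E ->
  fine (k%:E * a - k%:E * b)%E = k * fine (a - b)%E.
Proof.
move=> k0; case: a => [a||]//; case: b => [b||]// _ _ /=.
- by rewrite mulrBr.
- by rewrite gt0_muley ?lte_fin//= mulr0.
- by rewrite gt0_muley ?lte_fin//= mulr0.
- by rewrite !gt0_muley ?lte_fin//= mulr0.
Qed.

(* No integrability is needed: both sides are 0 when the integral diverges. *)
Lemma cintRZl d (T : measurableType d) (R : realType) (m : {measure set T -> \bar R})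
    (k : R) (f : T -> R[i]) : 0 < k -> cmeas f ->
  cint m (fun x => k%:C%C * f x) = k%:C%C * cint m f.
Proof.
move=> k0 [mf1 mf2].
have ZR (g : T -> R) : measurable_fun setT g ->
    \int[m]_x (k * g x) = k * \int[m]_x g x.
  move=> mg; rewrite /Rintegral integralE [in RHS]integralE -fineB_scale//; last 2 first.
  - by apply: integral_ge0 => x _; exact: funepos_ge0.
  - by apply: integral_ge0 => x _; exact: funeneg_ge0.
  have mg' : measurable_fun setT (EFin \o g) by exact/measurable_EFinP.
  congr (fine (_ - _)%E).
  - rewrite -ge0_integralZl_EFin ?ltW//; [|exact: measurable_funepos].
    apply: eq_integral => x _; rewrite !funeposE /=.
    by rewrite maxe_pMr// ?mule0// ltW.
  - rewrite -ge0_integralZl_EFin ?ltW//; [|exact: measurable_funeneg].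
    apply: eq_integral => x _; rewrite !funenegE /=.
    by rewrite maxe_pMr ?ltW// mule0 -EFinM mulrN.
rewrite /cint.
rewrite (_ : (fun _ => complex.Re _) = (fun x => k * complex.Re (f x))); last first.
  by apply/funext => x; case: (f x) => a b /=; rewrite mul0r subr0.
rewrite (_ : (fun _ => complex.Im _) = (fun x => k * complex.Im (f x))); last first.
  by apply/funext => x; case: (f x) => a b /=; rewrite mul0r addr0.
rewrite (ZR _ mf1) (ZR _ mf2); apply/eqP; rewrite eq_complex /=.
by rewrite !mul0r subr0 addr0 !eqxx.
Qed.

Section dilations.
Context {R : realType} {n : nat}.
Local Notation mu := (@lebesgue_rV R n).
Local Notation V := 'rV[R]_n.
Implicit Types (f g k : V -> R[i]) (d : R).

Lemma cmeas_dilate d g : cmeas g -> cmeas (dilate d g).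
Proof.
move=> mg; apply: cmeasM; first exact: cmeas_cst.
exact: (cmeas_comp mg (measurable_scale _)).
Qed.

Lemma normc_dilate d g x : 0 < d ->
  normc (dilate d g x) = d ^- n * normc (g (d^-1 *: x)).
Proof.
by move=> d0; rewrite /dilate normcM normcR ger0_norm// invr_ge0 exprn_ge0// ltW.
Qed.

Lemma dilate_comp a b g : dilate a (dilate b g) = dilate (a * b) g.
Proof.
apply/funext => x; rewrite /dilate mulrA -rmorphM/= scalerA.
have -> : a ^- n * b ^- n = (a * b) ^- n by rewrite exprMn invfM.
by have -> : b^-1 * a^-1 = (a * b)^-1 by rewrite invfM mulrC.
Qed.

Lemma dilateB d f g : dilate d (fun x => f x - g x) = (fun x => dilate d f x - dilate d g x).
Proof. by apply/funext => x; rewrite /dilate mulrBr. Qed.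

Lemma dilate1 g : dilate 1 g = g.
Proof. by apply/funext => x; rewrite /dilate expr1n invr1 scale1r mul1r. Qed.

Local Open Scope ereal_scope.

Lemma ge0_integral_dilate d g (w : V -> \bar R) : (0 < d)%R -> cmeas g ->
  measurable_fun setT w -> (forall x, 0 <= w x) ->
  \int[mu]_y (w y * (normc (dilate d g y))%:E) =
  \int[mu]_y (w (d *: y)%R * (normc (g y))%:E).
Proof.
move=> d0 mg mw w0.
have dn0 : (0 < d ^- n)%R by rewrite invr_gt0 exprn_gt0.
pose H (y : V) := w (d *: y)%R * (normc (g y))%:E.
have mH : measurable_fun setT H.
  apply: emeasurable_funM; last exact: cmeas_enormc.
  exact: (measurableT_comp mw (measurable_scale d)).
have H0 y : 0 <= H y by rewrite mule_ge0// lee_fin normc_ge0.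
have di0 : (d^-1 != 0)%R by rewrite invr_eq0 gt_eqF.
have := ge0_integral_scale di0 mH H0.
rewrite gtr0_norm ?invr_gt0// exprVn invrK => h.
transitivity (\int[mu]_y ((d ^- n)%:E * H (d^-1 *: y)%R)).
  apply: eq_integral => y _; rewrite normc_dilate// /H scalerA divff ?gt_eqF// scale1r.
  by rewrite EFinM muleCA.
rewrite ge0_integralZl_EFin// ?ltW//; last first.
  exact: (measurableT_comp mH (measurable_scale _)).
by rewrite h muleA -EFinM mulVf ?mul1e// expf_neq0// gt_eqF.
Qed.

Lemma ge0_integral_normc_dilate d g : (0 < d)%R -> cmeas g ->
  \int[mu]_y (normc (dilate d g y))%:E = \int[mu]_y (normc (g y))%:E.
Proof.
move=> d0 mg; have := ge0_integral_dilate d0 mg (measurable_cst 1) (fun=> lee01).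
by under eq_integral do rewrite mul1e; under [in X in _ = X -> _]eq_integral do rewrite mul1e.
Qed.

Lemma cintegrable_dilate d g : (0 < d)%R -> cintegrable mu g ->
  cintegrable mu (dilate d g).
Proof.
move=> d0 [mg gi]; split; first exact: cmeas_dilate.
by rewrite ge0_integral_normc_dilate.
Qed.

Lemma Lp1_dilate d g : (0 < d)%R -> cmeas g ->
  Lp_norm 1%:E (dilate d g) = Lp_norm 1%:E g.
Proof. by move=> d0 mg; rewrite !Lp1E ge0_integral_normc_dilate. Qed.

Lemma cint_dilate d g (w : V -> R[i]) : (0 < d)%R -> cmeas g -> cmeas w ->
  (cint mu (fun y => w y * dilate d g y) = cint mu (fun y => w (d *: y) * g y))%R.
Proof.
move=> d0 mg mw.
pose H (y : V) := (w (d *: y) * g y)%R.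
have mH : cmeas H.
  by apply: cmeasM => //; exact: (cmeas_comp mw (measurable_scale d)).
have di0 : (d^-1 != 0)%R by rewrite invr_eq0 gt_eqF.
have := cint_scale di0 mH.
rewrite gtr0_norm ?invr_gt0// exprVn invrK => h.
have dn0 : (0 < d ^- n)%R by rewrite invr_gt0 exprn_gt0.
transitivity (cint mu (fun y => (d ^- n)%:C%C * H (d^-1 *: y)))%R.
  congr cint; apply/funext => y; rewrite /H /dilate scalerA divff ?gt_eqF// scale1r.
  by rewrite mulrCA.
rewrite cintRZl//; last exact: (cmeas_comp mH (measurable_scale _)).
rewrite h mulrA -rmorphM/= mulVf ?mul1r// expf_neq0// gt_eqF//.
Qed.

Lemma conv_dilate d f g (x : V) : (0 < d)%R -> cmeas f -> cmeas g ->
  convolution f (dilate d g) x = cint mu (fun y => f (x - d *: y) * g y)%R.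
Proof.
move=> d0 mf mg; rewrite convE (cint_dilate d0 mg (w := fun y => f (x - y)%R))//.
exact: (cmeas_comp mf (measurable_sub_fst x)).
Qed.

Lemma cint_dilate1 d g : (0 < d)%R -> cmeas g -> cint mu (dilate d g) = cint mu g.
Proof.
move=> d0 mg; have := cint_dilate d0 mg (cmeas_cst _ 1%R).
under eq_fun do rewrite mul1r.
by under [in X in _ = X -> _]eq_fun do rewrite mul1r.
Qed.

End dilations.

Section boxes.
Context {R : realType} {n : nat}.
Local Notation mu := (@lebesgue_rV R n).
Local Notation V := 'rV[R]_n.
Local Open Scope ereal_scope.

Definition box (r : R) : set V := [set x | forall i, (`|x 0%R i| <= r)%R].

Let boxE r : box r = [set x : V | forall i, `[(- r)%R, r]%classic (x 0%R i)].
Proof.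
by apply/seteqP; split => x /= h i; have := h i; rewrite in_itv/= -ler_norml.
Qed.

Lemma measurable_box r : measurable (box r).
Proof.
rewrite boxE (_ : mkset _ =
    \bigcap_(i in [set: 'I_n]) [set x : V | `[(- r)%R, r]%classic (x 0%R i)]).
  apply: fin_bigcap_measurable => // i _.
  rewrite -[X in measurable X]setTI.
  by apply: (measurable_rV_coord i measurableT); exact: measurable_itv.
by apply/seteqP; split => [x /= h i _|x /= h i]; [exact: h|exact: h].
Qed.

Lemma mu_box_lty r : mu (box r) < +oo.
Proof.
rewrite boxE (@lebesgue_rV_box R n (fun=> `[(- r)%R, r]%classic)) => [|i]; last exact: measurable_itv.
rewrite -ge0_fin_numE; last by apply: prode_ge0 => i _; exact: measure_ge0.
apply: prode_fin_num => i _; rewrite ge0_fin_numE//.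
by rewrite lebesgue_measure_itv/=; case: ifP => _; rewrite -?EFinB ltry.
Qed.

Lemma mu_box_gt0 r : (0 < r)%R -> 0 < mu (box r).
Proof.
move=> r0; rewrite boxE (@lebesgue_rV_box R n (fun=> `[(- r)%R, r]%classic)) => [|i]; last exact: measurable_itv.
apply: (big_ind (fun z : \bar R => 0 < z)) => // [x y|i _]; first exact: mule_gt0.
rewrite lebesgue_measure_itv/= lte_fin gtrN// -EFinB lte_fin; lra.
Qed.

Lemma in_bigbox (x : V) : exists N : nat, box N%:R x.
Proof.
exists (\max_(i < n) Num.bound `|x 0%R i|)%N => i.
rewrite (le_trans (ltW (archi_boundP (normr_ge0 _))))// ler_nat.
exact: (@leq_bigmax _ (fun i => Num.bound `|x 0%R i|)).
Qed.

Lemma measurable_indic_box r : measurable_fun setT (\1_(box r) : V -> R).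
Proof. by apply: measurable_indic; exact: measurable_box. Qed.

(* Convergence in L^1_loc gives almost everywhere convergence along subsequences
   only, but Fatou's lemma makes the liminf of the whole sequence vanish. *)
Lemma ae_limn_einf0 (u : nat -> V -> R) :
  (forall J, measurable_fun setT (u J)) -> (forall J x, 0 <= u J x)%R ->
  (forall N : nat, \int[mu]_x (u J x * \1_(box N%:R) x)%:E @[J --> \oo] --> 0) ->
  {ae mu, forall x, limn_einf (fun J => (u J x)%:E) = 0}.
Proof.
move=> mu_ u0 uc.
have mU J : measurable_fun setT (EFin \o u J) by exact/measurable_EFinP.
have mL : measurable_fun setT (fun x => limn_einf (fun J => (u J x)%:E)).
  rewrite (_ : (fun _ => _) = (fun x => limn (einfs (fun J => (u J x)%:E)))); last first.
    by apply/funext => x; rewrite limn_einf_lim.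
  apply: (emeasurable_fun_cvg (fun N x => einfs (fun J => (u J x)%:E) N)).
    by move=> N; apply: (@measurable_fun_einfs _ _ _ setT (fun J => EFin \o u J)).
  by move=> x _; exact: is_cvg_einfs.
have L0 x : 0 <= limn_einf (fun J => (u J x)%:E).
  rewrite limn_einf_lim; apply: lime_ge; first exact: is_cvg_einfs.
  by apply: nearW => N; apply: le_ereal_inf_tmp => _ [J _ <-]; rewrite lee_fin.
suff : {ae mu, forall x, forall N : nat, box N%:R x ->
    limn_einf (fun J => (u J x)%:E) = 0}.
  by apply: filterS => x h; have [N /h] := in_bigbox x.
apply/ae_foralln => N.
have mB := measurable_box N%:R.
have : \int[mu]_(x in box N%:R) `|limn_einf (fun J => (u J x)%:E)| = 0.
  apply/eqP; rewrite eq_le integral_ge0// andbT.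
  under eq_integral do rewrite gee0_abs//.
  apply: (le_trans (fatou mu mB (fun J => measurable_funTS (mU J)) (fun J x _ => _))).
    by move=> J x; rewrite lee_fin.
  have -> : (fun J => \int[mu]_(x in box N%:R) (EFin \o u J) x) =
      (fun J => \int[mu]_x (u J x * \1_(box N%:R) x)%:E).
    apply/funext => J; rewrite integral_mkcond; apply: eq_integral => x _.
    by rewrite patchE indicE; case: ifP => _; rewrite ?mulr1// mulr0.
  by have [-> _] := cvg_limn_einf_sup (uc N).
move/(ae_eq_integral_abs mu mB (measurable_funTS mL)).
by apply: filterS => x h /h.
Qed.

End boxes.

Section approximate_identity.
Context {R : realType} {n : nat}.
Local Notation mu := (@lebesgue_rV R n).
Local Notation V := 'rV[R]_n.
Local Open Scope ereal_scope.
Implicit Types (f g k : V -> R[i]) (p : \bar R).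

(* On a set of finite measure L^p is contained in L^1, since t <= 1 + t^r for r >= 1;
   the bound does not depend on the translation h. *)
Lemma Lp_local_bound p f (r : R) : 1 <= p -> in_Lp p f ->
  exists2 C : R, (0 <= C)%R &
    forall h : V, \int[mu]_x (normc (f (x - h)) * \1_(box r) x)%:E <= C%:E.
Proof.
move=> p1 [mf fi]; have mB := @measurable_box R n r.
have mB1 := @measurable_indic_box R n r.
have Boo := @mu_box_lty R n r.
have Bfin : mu (box r) \is a fin_num by rewrite ge0_fin_numE.
have mt h : measurable_fun setT (fun x : V => normc (f (x - h)%R)).
  exact: cmeas_normc (cmeas_comp mf (measurable_sub_snd h)).
have [pE|[q q1 pE]] := ge1_cases p1; subst p.
- move: fi; rewrite /Lp_norm LnormyE; case: ifPn => [m0|m0 _]; last first.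
    exists 0%R => // h.
    have muT : mu setT = 0 by apply/eqP; rewrite eq_le measure_ge0 andbT leNgt.
    have z : {ae mu, forall x : V, False} by exists setT; split.
    rewrite (ae_eq_integral (cst 0)) ?integral0//.
    + by apply/measurable_EFinP; exact: measurable_funM.
    + by apply: filterS z.
  set S := ess_sup _ _ => Soo.
  have S0 : 0 <= S.
    by apply: ess_sup_gee => //; apply: nearW => y /=; rewrite lee_fin.
  have Sfin : S \is a fin_num by rewrite ge0_fin_numE.
  have fS : {ae mu, forall x, (normc (f x))%:E <= S}.
    apply: filterS (ess_sup_ge mu (abse \o (fun x => (normc (f x))%:E))) => x /=.
    by rewrite ger0_norm ?normc_ge0.
  exists (fine S * fine (mu (box r)))%R; first by rewrite mulr_ge0// fine_ge0.
  have muB : mu (box r) = \int[mu]_x (\1_(box r) x)%:E by rewrite integral_indic// setIT.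
  move=> h; rewrite EFinM !fineK// muB.
  have mB2 : measurable_fun setT (fun x : V => (\1_(box r) x)%:E : \bar R).
    exact/measurable_EFinP.
  rewrite -ge0_integralZl//.
  apply: ae_ge0_le_integral => //.
  + by move=> x _; rewrite lee_fin mulr_ge0 ?normc_ge0.
  + by apply/measurable_EFinP; exact: measurable_funM.
  + by move=> x _; rewrite mule_ge0// lee_fin.
  + by apply: measurable_funeM; exact/measurable_EFinP.
  + have := ae_affine (- h)%R (oner_neq0 R) fS; apply: filterS => x + _.
    by rewrite scale1r => hx; rewrite EFinM lee_wpmul2r// lee_fin.
- have q0 : (0 < q)%R by rewrite (lt_le_trans _ q1).
  have fE : \int[mu]_x (normc (f x) `^ q)%:E = Lp_norm q%:E f `^ q.
    rewrite poweR_Lnorm ?gt_eqF//; apply: eq_integral => x _ /=.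
    by rewrite ger0_norm ?normc_ge0.
  have mfq : measurable_fun setT (fun x => (normc (f x) `^ q)%:E).
    apply/measurable_EFinP; apply: (measurableT_comp (measurable_powR q)).
    exact: cmeas_normc.
  have Ffin : Lp_norm q%:E f `^ q \is a fin_num.
    by rewrite ge0_fin_numE ?poweR_ge0// poweR_lty.
  exists (fine (mu (box r)) + fine (Lp_norm q%:E f `^ q))%R.
    by rewrite addr_ge0// fine_ge0// poweR_ge0.
  move=> h; rewrite EFinD !fineK// -fE.
  rewrite -(ge0_integral_translate h mfq); last by move=> x; rewrite lee_fin powR_ge0.
  have muB : mu (box r) = \int[mu]_x (\1_(box r) x)%:E by rewrite integral_indic// setIT.
  rewrite muB -ge0_integralD//; last 3 first.
  + exact/measurable_EFinP.
  + by move=> x _; rewrite lee_fin powR_ge0.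
  + exact: (measurableT_comp mfq (measurable_sub_snd h)).
  apply: ge0_le_integral => //.
  + by move=> x _; rewrite lee_fin mulr_ge0 ?normc_ge0.
  + by apply/measurable_EFinP; exact: measurable_funM.
  + apply: emeasurable_funD; first exact/measurable_EFinP.
    exact: (measurableT_comp mfq (measurable_sub_snd h)).
  + move=> x _; rewrite -EFinD lee_fin indicE; case: (x \in _) => /=; last first.
      by rewrite mulr0 add0r powR_ge0.
    rewrite mulr1; have [t1|t1] := leP (normc (f (x - h)%R)) 1%R.
      by rewrite (le_trans t1)// lerDl powR_ge0.
    by rewrite (le_trans (le1r_powR (ltW t1) q1))// lerDr.
Qed.

Lemma Lp_local_cintegrable p f (r : R) : 1 <= p -> in_Lp p f ->
  cintegrable mu (fun x => f x * (\1_(box r) x)%:C%C)%R.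
Proof.
move=> p1 fp; have [mf fi] := fp.
have m1 : cmeas (fun x : V => (\1_(box r) x)%:C%C : R[i]).
  by split; [exact: measurable_indic_box|exact: measurable_cst].
split; first exact: cmeasM.
have [C C0 hC] := Lp_local_bound r p1 fp.
apply: (@le_lt_trans _ _ C%:E); last exact: ltry.
apply: (le_trans _ (hC 0%R)); rewrite le_eqVlt; apply/orP; left; apply/eqP.
by apply: eq_integral => x _; rewrite subr0 normcM normcR ger0_norm.
Qed.

Let osc f (r : R) (h : V) := \int[mu]_x (normc (f (x - h) - f x)%R * \1_(box r) x)%:E.

Let osc_ge0 f r h : 0 <= osc f r h.
Proof. by apply: integral_ge0 => x _; rewrite lee_fin mulr_ge0 ?normc_ge0. Qed.

Let mosc_integrand f h : cmeas f -> cmeas (fun x : V => f (x - h) - f x)%R.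
Proof. by move=> mf; apply: cmeasB => //; exact: (cmeas_comp mf (measurable_sub_snd h)). Qed.

Let osc_bounded p f (r : R) : 1 <= p -> in_Lp p f ->
  exists2 C : R, (0 <= C)%R & forall h, osc f r h <= C%:E.
Proof.
move=> p1 fp; have [mf _] := fp.
have mB1 := @measurable_indic_box R n r.
have [C C0 hC] := Lp_local_bound r p1 fp.
exists (C + C)%R; first exact: addr_ge0.
move=> h; rewrite EFinD.
apply: (le_trans _ (leeD (hC h) (hC 0%R))).
have mt (h' : V) : measurable_fun setT (fun x : V => (normc (f (x - h')) * \1_(box r) x)%:E).
  apply/measurable_EFinP; apply: measurable_funM => //.
  exact: cmeas_normc (cmeas_comp mf (measurable_sub_snd h')).
rewrite -ge0_integralD//; last 2 first.
- by move=> x _; rewrite lee_fin mulr_ge0 ?normc_ge0.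
- by move=> x _; rewrite lee_fin mulr_ge0 ?normc_ge0.
apply: ge0_le_integral => //.
- by move=> x _; rewrite lee_fin mulr_ge0 ?normc_ge0.
- apply/measurable_EFinP; apply: measurable_funM => //.
  by apply: cmeas_normc; exact: mosc_integrand.
- exact: emeasurable_funD.
- by move=> x _; rewrite -EFinD lee_fin subr0 -mulrDl ler_wpM2r// normcB.
Qed.

Let osc_cvg0 p f (N : nat) (h : nat -> V) : 1 <= p -> in_Lp p f ->
  (forall i, h k 0%R i @[k --> \oo] --> (0 : R)%R) ->
  osc f N%:R (h k) @[k --> \oo] --> 0.
Proof.
move=> p1 fp h0; have [mf _] := fp.
have mB1 := @measurable_indic_box R n N%:R.
have Fi := Lp_local_cintegrable N.+1%:R p1 fp.
set F := (fun x => _) in Fi.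
have F0' (k : nat) : 0 <= \int[mu]_x (normc (F (x - h k) - F x)%R)%:E.
  by apply: integral_ge0 => x _; rewrite lee_fin normc_ge0.
apply/ge0_cvge0P => [k|e e0]; first exact: osc_ge0.
have cF := (ge0_cvge0P F0').1 (L1_translation Fi h0) e e0.
near=> k.
have hk : forall i, (`|h k 0%R i| <= 1)%R.
  near: k; apply: filter_forall => i.
  have /cvgrPdist_le/(_ 1%R ltr01) := h0 i.
  by apply: filterS => k; rewrite sub0r normrN.
apply: (@le_trans _ _ (\int[mu]_x (normc (F (x - h k) - F x)%R)%:E)); last first.
  by near: k; exact: cF.
apply: ge0_le_integral => //.
- by move=> x _; rewrite lee_fin mulr_ge0 ?normc_ge0.
- apply/measurable_EFinP; apply: measurable_funM => //.
  by apply: cmeas_normc; exact: mosc_integrand.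
- by apply: cmeas_enormc; apply: mosc_integrand; case: Fi.
- move=> x _; rewrite lee_fin indicE; have [xB|xB] := boolP (x \in box N%:R); last first.
    by rewrite mulr0 normc_ge0.
  rewrite mulr1 /F.
  have xB' : box N%:R x by rewrite inE in xB.
  rewrite !indicE !mem_set ?mulr1//.
  + by move=> i; rewrite (le_trans (xB' i))// ler_nat.
  + move=> i; rewrite !mxE (le_trans (ler_normB _ _))// -natr1 lerD//; exact: xB'.
Unshelve. all: by end_near. Qed.

Lemma approximate_identity p f k (d : R^nat) (N : nat) : 1 <= p ->
  in_Lp p f -> cintegrable mu k -> (forall J, 0 < d J)%R -> d @ \oo --> (0 : R)%R ->
  \int[mu]_x (normc (convolution f (dilate (d J) k) x - cint mu k * f x)%R
    * \1_(box N%:R) x)%:E @[J --> \oo] --> 0.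
Proof.
move=> p1 fp ki d0 dc; have [mf _] := fp; have [mk ki'] := ki.
have mB1 := @measurable_indic_box R n N%:R.
have [C C0 hC] := osc_bounded N%:R p1 fp.
pose W J (z : V * V) := (normc (f (z.1 - d J *: z.2) - f z.1)%R * \1_(box N%:R) z.1 * normc (k z.2))%R.
have mW J : measurable_fun setT (fun z => (W J z)%:E).
  apply/measurable_EFinP; apply: measurable_funM.
    apply: measurable_funM; last exact: (measurableT_comp mB1 measurable_fst).
    apply: cmeas_normc; apply: cmeasB; last exact: (cmeas_comp mf measurable_fst).
    apply: (cmeas_comp mf); apply: measurable_rV_sub; first exact: measurable_fst.
    apply: measurable_rV_scale; exact: measurable_snd.
  exact: (measurableT_comp (cmeas_normc mk) measurable_snd).
have W0 J z : (0 <= W J z)%R by rewrite !mulr_ge0 ?normc_ge0.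
have WE J y : \int[mu]_x (W J (x, y))%:E = osc f N%:R (d J *: y)%R * (normc (k y))%:E.
  rewrite /osc -ge0_integralZr ?lee_fin ?normc_ge0//.
  - apply/measurable_EFinP; apply: measurable_funM => //.
    by apply: cmeas_normc; exact: mosc_integrand.
  - by move=> x _; rewrite lee_fin mulr_ge0 ?normc_ge0.
have cW : \int[mu]_y \int[mu]_x (W J (x, y))%:E @[J --> \oo] --> 0.
  apply: (@ge0_dominated_cvg0 _ _ _ mu (fun J y => \int[mu]_x (W J (x, y))%:E)
    (fun y => C%:E * (normc (k y))%:E)).
  - move=> J; apply: (@measurable_fun_fubini_tonelli_G _ _ _ _ _ mu (fun z => (W J z)%:E)) => //.
    by move=> z; rewrite lee_fin.
  - by move=> J y; apply: integral_ge0 => x _; rewrite lee_fin.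
  - apply: nearW => y.
    rewrite (_ : (fun J => _) = (fun J => osc f N%:R (d J *: y)%R * (normc (k y))%:E)); last first.
      by apply/funext => J; exact: WE.
    rewrite -[X in _ --> X](mul0e (normc (k y))%:E).
    apply: cvgeZr => //.
    apply: (@osc_cvg0 _ _ _ (fun J => d J *: y)%R p1 fp) => i.
    rewrite (_ : (fun J => _) = (fun J => d J * y 0 i)%R); last first.
      by apply/funext => J; rewrite mxE.
    by rewrite -[X in _ --> X](mul0r (y 0%R i)); apply: cvgM => //; exact: cvg_cst.
  - by apply: measurable_funeM; exact: cmeas_enormc.
  - rewrite ge0_integralZl_EFin//; [|by move=> x _; rewrite lee_fin normc_ge0|exact: cmeas_enormc].
    by rewrite lte_mul_pinfty.
  - by move=> J y; rewrite WE lee_wpmul2r// lee_fin normc_ge0.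
apply: (ge0_squeeze_cvg0 _ _ cW) => J.
  by apply: integral_ge0 => x _; rewrite lee_fin mulr_ge0 ?normc_ge0.
rewrite -(@fubini_tonelli _ _ _ _ _ mu mu (fun z => (W J z)%:E))//; last by move=> z; rewrite lee_fin.
apply: ae_ge0_le_integral => //.
- by move=> x _; rewrite lee_fin mulr_ge0 ?normc_ge0.
- apply/measurable_EFinP; apply: measurable_funM => //; apply: cmeas_normc.
  apply: cmeasB; first by apply: cmeas_conv => //; exact: cmeas_dilate.
  by apply: cmeasM => //; exact: cmeas_cst.
- by move=> x _; apply: integral_ge0 => y _; rewrite lee_fin.
- apply: (@measurable_fun_fubini_tonelli_F _ _ _ _ _ mu (fun z => (W J z)%:E)) => //.
  by move=> z; rewrite lee_fin.
- apply: filterS (ae_cintegrable_conv p1 fp (cintegrable_dilate (d0 J) ki)) => x [m1 i1] _.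
  rewrite conv_dilate//.
  have mfx : cmeas (fun y : V => f (x - y)%R) by exact: (cmeas_comp mf (measurable_sub_fst x)).
  have i2 : cintegrable mu (fun y => f (x - d J *: y) * k y)%R.
    split.
      by apply: cmeasM => //; exact: (cmeas_comp mfx (measurable_scale _)).
    move: i1; under eq_integral do rewrite normcM EFinM.
    rewrite (ge0_integral_dilate (d0 J) mk (w := fun y => (normc (f (x - y)%R))%:E)).
    + by under [in X in _ -> X]eq_integral do rewrite normcM EFinM.
    + exact: cmeas_enormc.
    + by move=> y; rewrite lee_fin normc_ge0.
  have i3 : cintegrable mu (fun y => f x * k y)%R by exact: cintegrableZl.
  rewrite mulrC mulrC (mulrC (cint mu k)) -cintZl// -cintB//.
  rewrite EFinM muleC.
  apply: (@le_trans _ _ ((\1_(box N%:R) x)%:E * \int[mu]_y (normc (f (x - d J *: y) * k y - f x * k y)%R)%:E)).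
    rewrite lee_wpmul2l ?lee_fin//; apply: normc_cint_le.
    by have [] := cintegrableB i2 i3.
  rewrite -ge0_integralZl_EFin//; last 2 first.
  + by move=> y _; rewrite lee_fin normc_ge0.
  + by apply: cmeas_enormc; have [] := cintegrableB i2 i3.
  rewrite le_eqVlt; apply/orP; left; apply/eqP; apply: eq_integral => y _.
  by rewrite -EFinM /W /= -mulrBl normcM; congr EFin; ring.
Qed.

End approximate_identity.

Section enorm_theory.
Context {R : realType} {n : nat}.
Implicit Types x y : 'rV[R]_n.

Lemma dotp_ge0 x : 0 <= dotp x x.
Proof. by apply: sumr_ge0 => i _; rewrite -expr2 sqr_ge0. Qed.

Lemma enorm_ge0 x : 0 <= enorm x.
Proof. exact: sqrtr_ge0. Qed.

Lemma enorm_sqr x : enorm x ^+ 2 = \sum_i x 0 i ^+ 2.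
Proof. by rewrite sqr_sqrtr ?dotp_ge0//; apply: eq_bigr => i _; rewrite expr2. Qed.

Lemma enorm_coord x i : `|x 0 i| <= enorm x.
Proof.
rewrite -(@ler_pXn2r _ 2) ?nnegrE ?enorm_ge0// enorm_sqr real_normK ?num_real//.
by rewrite (bigD1 i)//= lerDl sumr_ge0// => j _; exact: sqr_ge0.
Qed.

Lemma enormZ (c : R) x : enorm (c *: x) = `|c| * enorm x.
Proof.
rewrite /enorm -sqrtr_sqr -sqrtrM ?sqr_ge0//; congr Num.sqrt.
by rewrite /dotp mulr_sumr; apply: eq_bigr => i _; rewrite !mxE; ring.
Qed.

End enorm_theory.

Section rV_continuous.
Context {R : realType} {n : nat}.
Local Notation V := 'rV[R]_n.

Lemma rV_norm_le (x : V) (e : R) : 0 <= e -> (forall i, `|x 0 i| <= e) -> `|x| <= e.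
Proof.
move=> e0 h; rewrite [leLHS]/Num.Def.normr/= mx_normrE (bigmax_le _ e0)//= => -[i j] _.
by rewrite (ord1 i)/=.
Qed.

(* h is the pointwise limit of the functions obtained by rounding the argument
   to a grid, which take countably many values. *)
Lemma continuous_measurable_rV (h : V -> R) : continuous h -> measurable_fun setT h.
Proof.
move=> ch.
pose a (k : nat) (x : V) : V := \row_i ((Num.floor (k.+1%:R * x 0 i))%:~R / k.+1%:R).
apply: (@measurable_fun_cvg _ _ _ _ (fun k x => h (a k x))); last first.
  move=> x _.
  have ax : a k x @[k --> \oo] --> x.
    apply/cvgrPdist_le => e e0; near=> k.
    apply: rV_norm_le; first exact: ltW.
    move=> i; rewrite !mxE.
    have k0 : 0 < k.+1%:R :> R by [].
    have f1 := floor_le (k.+1%:R * x 0 i); have f2 := floorD1_gt (k.+1%:R * x 0 i).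
    rewrite intrD1 in f2.
    rewrite -(ler_pM2l k0) -{1}(gtr0_norm k0) -normrM mulrBr mulrCA divff ?gt_eqF// mulr1.
    rewrite (@le_trans _ _ 1)//.
      by rewrite ler_norml; apply/andP; split; lra.
    have : e^-1 <= k.+1%:R.
      near: k; exists (Num.bound e^-1) => // k /= hk.
      rewrite (le_trans (ltW (archi_boundP _)))//; first by rewrite invr_ge0 ltW.
      by rewrite ler_nat (leq_trans hk).
    by rewrite -(ler_pM2r e0) mulVf ?gt_eqF.
  exact: (cvg_comp _ _ ax (ch x)).
move=> k _ B mB; rewrite setTI.
pose C (v : 'rV[int]_n) : set V :=
  [set x | forall i, (v 0 i)%:~R <= k.+1%:R * x 0 i < (v 0 i)%:~R + 1].
pose b (v : 'rV[int]_n) : V := \row_i ((v 0 i)%:~R / k.+1%:R).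
have mC v : measurable (C v).
  rewrite (_ : C v = \bigcap_(i in [set: 'I_n])
      ((fun x : V => k.+1%:R * x 0 i) @^-1` `[(v 0 i)%:~R, (v 0 i)%:~R + 1[%classic)).
    apply: fin_bigcap_measurable => // i _.
    rewrite -[X in measurable X]setTI.
    have mi : measurable_fun setT (fun x : V => k.+1%:R * x 0 i).
      by apply: measurable_funM => //; exact: measurable_rV_coord.
    by apply: mi => //; exact: measurable_itv.
  by apply/seteqP; split => x /= hx i => [_|]; [have := hx i|have := hx i I]; rewrite /= in_itv.
rewrite (_ : _ @^-1` _ = \bigcup_m (if unpickle m is Some v then
    (if h (b v) \in B then C v else set0) else set0)).
  apply: bigcupT_measurable => m; case: (unpickle m) => // v.
  by case: ifP.
apply/seteqP; split => x /=.
- move=> hx; pose v : 'rV[int]_n := \row_i Num.floor (k.+1%:R * x 0 i).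
  exists (pickle v) => //; rewrite pickleK.
  have bv : b v = a k x by apply/rowP => i; rewrite !mxE.
  rewrite bv mem_set// => i; rewrite mxE floor_le/=.
  by rewrite -intrD1 floorD1_gt.
- move=> [m _]; case: (unpickle m) => // v; case: ifP => // /set_mem hB Cx.
  suff -> : a k x = b v by [].
  apply/rowP => i; rewrite !mxE; congr (_%:~R / _).
  by apply: floor_def; have := Cx i; rewrite intrD.
Unshelve. all: by end_near. Qed.

End rV_continuous.

Section weight.
Context {R : realType}.
Local Notation mu n := (@lebesgue_rV R n).
Local Notation leb := (@lebesgue_measure R).

Definition rV_weight n (x : 'rV[R]_n) : R := \prod_i (1 + x 0 i ^+ 2)^-1.

Lemma onesq_gt0 (t : R) : 0 < 1 + t ^+ 2.
Proof. by rewrite ltr_wpDr// sqr_ge0. Qed.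

Lemma rV_weight_gt0 n (x : 'rV[R]_n) : 0 < rV_weight x.
Proof. by apply: prodr_gt0 => i _; rewrite invr_gt0 onesq_gt0. Qed.

Lemma measurable_rV_weight n : measurable_fun setT (@rV_weight n).
Proof.
apply: measurable_prod => i _.
apply: (measurableT_comp (f := fun t : R => (1 + t ^+ 2)^-1)) (measurable_rV_coord i).
apply: continuous_measurable_fun => t.
exact: (@continuous_oneDsqrV R t).
Qed.

Lemma integral_onesq : (\int[leb]_t ((1 + t ^+ 2)^-1)%:E < +oo)%E.
Proof.
have m1 : measurable_fun setT (fun t : R => ((1 + t ^+ 2)^-1)%:E).
  apply/measurable_EFinP; apply: continuous_measurable_fun => t.
  exact: (@continuous_oneDsqrV R t).
have p0 (t : R) : (0 <= ((1 + t ^+ 2)^-1)%:E)%E by rewrite lee_fin invr_ge0 ltW// onesq_gt0.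
have I1 : (\int[leb]_(t in `[0%R, +oo[) ((1 + t ^+ 2)^-1)%:E < +oo)%E.
  have := @integral0y_oneDsqr R; rewrite /oneDsqr => ->; exact: ltry.
have I2 : (\int[leb]_(t in `]-oo, 0%R]) ((1 + t ^+ 2)^-1)%:E < +oo)%E.
  have := ge0_integration_by_substitution0 m1 p0.
  by under [in X in _ = X -> _]eq_integral do rewrite sqrrN; move=> <-.
rewrite (_ : [set: R] = `]-oo, 0%R]%classic `|` `]0%R, +oo[%classic); last first.
  by apply/seteqP; split => // t _ /=; rewrite !in_itv/= andbT; case: (leP t 0); [left|right].
rewrite ge0_integral_setU//=.
- apply: lte_add_pinfty => //; apply: le_lt_trans I1.
  apply: ge0_subset_integral => //.
  + exact: measurable_funS m1.
  + by move=> t /=; rewrite !in_itv/= !andbT => /ltW.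
- exact: measurable_funS m1.
- by apply/disj_setPS => t /= []; rewrite !in_itv/= andbT => h1 h2; have := le_lt_trans h1 h2; rewrite ltxx.
Qed.

Lemma integral_rV_weight n : (\int[mu n]_x (rV_weight x)%:E < +oo)%E.
Proof.
elim: n => [|n IH].
  rewrite (eq_integral (cst 1%E)); last by move=> x _; rewrite /rV_weight big_ord0.
  by rewrite integral_cst//= mul1e diracE ltry.
have mw m : measurable_fun setT (fun x : 'rV[R]_m => (rV_weight x)%:E).
  by apply/measurable_EFinP; exact: measurable_rV_weight.
have w0 m (x : 'rV[R]_m) : (0 <= (rV_weight x)%:E)%E by rewrite lee_fin ltW// rV_weight_gt0.
rewrite ge0_integral_rVS//.
pose K := (\int[leb]_t ((1 + t ^+ 2)^-1)%:E)%E.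
rewrite (eq_integral (fun x => (rV_weight x)%:E * K)%E); last first.
  move=> x _; rewrite /K -ge0_integralZl_EFin//; last 3 first.
  - by move=> t _; rewrite lee_fin invr_ge0 ltW// onesq_gt0.
  - apply/measurable_EFinP; apply: continuous_measurable_fun => t.
    exact: (@continuous_oneDsqrV R t).
  - by rewrite ltW// rV_weight_gt0.
  apply: eq_integral => t _; rewrite -EFinM /rV_weight big_ord_recl mulrC; congr (_ * _)%:E.
    by apply: eq_bigr => i _; rewrite mxE liftK.
  by rewrite mxE unlift_none.
have K0 : (0 <= K)%E.
  by apply: integral_ge0 => t _; rewrite lee_fin invr_ge0 ltW// onesq_gt0.
rewrite ge0_integralZr//; last exact: mw.
rewrite lte_mul_pinfty//.
- by apply: integral_ge0.
- by rewrite ge0_fin_numE//; exact: integral_ge0.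
- exact: integral_onesq.
Qed.

(* Moving the argument by at most 1 changes each factor by at most 3. *)
Lemma rV_weight_shift n (x z : 'rV[R]_n) : (forall i, `|z 0 i| <= 1) ->
  rV_weight (x - z) <= 3 ^+ n * rV_weight x.
Proof.
move=> z1; rewrite /rV_weight.
rewrite -[X in 3 ^+ X](card_ord n) -prodr_const -big_split/=.
apply: ler_prod => i _; apply/andP; split; first by rewrite invr_ge0 ltW// onesq_gt0.
rewrite !mxE; have := z1 i; rewrite ler_norml => /andP[l1 l2].
have p1 := onesq_gt0 (x 0 i - z 0 i); have p2 := onesq_gt0 (x 0 i).
rewrite -(ler_pM2r p2) mulfVK ?gt_eqF// -(ler_pM2l p1) mulrA mulfV ?gt_eqF// mul1r.
have : 0 <= (2 * x 0 i - 3 * z 0 i) ^+ 2 by exact: sqr_ge0.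
have : z 0 i ^+ 2 <= 1 by nra.
set a := x 0 i; set b := z 0 i => hb hs.
nra.
Qed.

Lemma rV_weight_enorm n (x : 'rV[R]_n) :
  (rV_weight x)^-1 <= 2 ^+ n * (1 + enorm x ^+ (2 * n)).
Proof.
have t0 : 0 <= enorm x ^+ 2 by rewrite sqr_ge0.
apply: (@le_trans _ _ ((1 + enorm x ^+ 2) ^+ n)).
  rewrite /rV_weight -prodfV -[X in _ <= _ ^+ X](card_ord n) -prodr_const.
  apply: ler_prod => i _; rewrite invrK (ltW (onesq_gt0 _))/= lerD2l.
  rewrite -[x 0 i ^+ 2]real_normK ?num_real// ler_pXn2r ?nnegrE ?enorm_ge0//.
  exact: enorm_coord.
rewrite exprM; set t := enorm x ^+ 2 in t0 *.
have [t1|t1] := leP t 1.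
  apply: (@le_trans _ _ (2 ^+ n)).
    by rewrite lerXn2r ?nnegrE ?addr_ge0//; lra.
  by rewrite ler_peMr ?exprn_ge0// lerDl exprn_ge0.
apply: (@le_trans _ _ ((2 * t) ^+ n)).
  have h1 : 0 <= 1 + t by lra.
  have h2 : 0 <= 2 * t by lra.
  by rewrite lerXn2r ?nnegrE//; lra.
by rewrite exprMn ler_wpM2l ?exprn_ge0// lerDr.
Qed.

End weight.

Section schwartz_theory.
Context {R : realType} {n : nat}.
Local Notation mu := (@lebesgue_rV R n).
Local Notation V := 'rV[R]_n.
Implicit Types h : V -> R.

Lemma real_schwartz_measurable h : real_schwartz h -> measurable_fun setT h.
Proof.
move=> /(_ [::])[hd _]; apply: continuous_measurable_rV => x.
exact: differentiable_continuous.
Qed.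

Lemma real_schwartz_decay h (l : seq 'I_n) : real_schwartz h ->
  exists2 M : R, 0 <= M & forall x, `|partials l h x| <= M * rV_weight x.
Proof.
move=> /(_ l)[_ hk]; have [M0 hM0] := hk 0%N; have [M1 hM1] := hk (2 * n)%N.
have h0 x : 0 <= enorm x ^+ 0 * `|partials l h x| by rewrite mulr_ge0 ?exprn_ge0 ?enorm_ge0.
have h1 x : 0 <= enorm x ^+ (2 * n) * `|partials l h x| by rewrite mulr_ge0 ?exprn_ge0 ?enorm_ge0.
have M00 : 0 <= M0 by rewrite (le_trans (h0 0)).
have M10 : 0 <= M1 by rewrite (le_trans (h1 0)).
exists (2 ^+ n * (M0 + M1)); first by rewrite mulr_ge0 ?exprn_ge0 ?addr_ge0.
move=> x; have w0 := rV_weight_gt0 x.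
rewrite -ler_pdivrMr// mulrC.
apply: (@le_trans _ _ (2 ^+ n * (1 + enorm x ^+ (2 * n)) * `|partials l h x|)).
  by rewrite ler_wpM2r// rV_weight_enorm.
rewrite -mulrA ler_wpM2l ?exprn_ge0// mulrDl lerD//.
by rewrite (le_trans _ (hM0 x))// expr0.
Qed.

Lemma derive_along_line h (x v : V) (t : R) : (forall y, differentiable h y) ->
  is_derive t (1 : R) (fun s : R => h (s *: v + x)) ('D_v h (t *: v + x)).
Proof.
move=> hd.
have E : (fun s : R => s^-1 *: (h ((s *: (1 : R) + t) *: v + x) - h (t *: v + x))) =
    (fun s : R => s^-1 *: (h (s *: v + (t *: v + x)) - h (t *: v + x))).
  by apply/funext => s; rewrite scalerDl addrA -[s *: (1 : R)]/(s * 1) mulr1.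
have dv : derivable h (t *: v + x) v by exact: diff_derivable.
apply: DeriveDef.
- by rewrite /derivable /= E.
- by rewrite /derive /= E.
Qed.

Lemma derive_sum_partials h (x v : V) : differentiable h x ->
  'D_v h x = \sum_i v 0 i * 'D_(delta_mx 0 i) h x.
Proof.
move=> hd; rewrite deriveE// [in LHS](row_sum_delta v) linear_sum.
by apply: eq_bigr => i _; rewrite linearZ deriveE.
Qed.

Lemma real_schwartz_lipschitz h : real_schwartz h ->
  exists2 C : R, 0 <= C & forall x z : V, (forall i, `|z 0 i| <= 1) ->
    `|h (x - z) - h x| <= C * enorm z * rV_weight x.
Proof.
move=> hs; have hd y : differentiable h y by have [] := hs [::].
have /choice[M hM] : forall i : 'I_n, exists M : R, 0 <= M /\
    forall x, `|'D_(delta_mx 0 i) h x| <= M * rV_weight x.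
  by move=> i; have [M M0 hM] := real_schwartz_decay [:: i] hs; exists M.
exists (3 ^+ n * \sum_i M i).
  by rewrite mulr_ge0 ?exprn_ge0// sumr_ge0// => i _; have [] := hM i.
move=> x z z1.
pose g (s : R) := h (s *: (- z) + x).
have dg (s : R) : is_derive s (1 : R) g ('D_(- z) h (s *: (- z) + x)).
  exact: derive_along_line.
have cg : {within `[0, 1], continuous g}.
  apply: derivable_within_continuous => s _.
  by have [] := dg s.
have [c c01 gE] := MVT ltr01 (fun s _ => dg s) cg.
have -> : h (x - z) - h x = g 1 - g 0 by rewrite /g scale1r scale0r add0r (addrC (- z)).
rewrite gE subr0 mulr1 derive_sum_partials//.
apply: (le_trans (ler_norm_sum _ _ _)).
have cz i : `|(c *: z) 0 i| <= 1.
  move: c01; rewrite in_itv/= => /andP[c0 c1].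
  rewrite mxE normrM (gtr0_norm c0) (le_trans (ler_wpM2l (ltW c0) (z1 i)))// mulr1 ltW//.
have wz : rV_weight (c *: (- z) + x) <= 3 ^+ n * rV_weight x.
  by rewrite scalerN addrC rV_weight_shift.
have -> : 3 ^+ n * (\sum_i M i) * enorm z * rV_weight x =
    \sum_i enorm z * (M i * (3 ^+ n * rV_weight x)).
  by rewrite -mulr_sumr -mulr_suml; ring.
apply: ler_sum => i _.
have [Mi0 hMi] := hM i.
rewrite normrM !mxE normrN.
apply: ler_pM => //; first exact: enorm_coord.
by rewrite (le_trans (hMi _))// ler_wpM2l.
Qed.

Local Open Scope ereal_scope.

Lemma schwartz_cintegrable (zeta : V -> R[i]) : schwartz zeta -> cintegrable mu zeta.
Proof.
move=> [h1 h2]; split.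
  by split; exact: real_schwartz_measurable.
have [M1 M10 hM1] := real_schwartz_decay [::] h1.
have [M2 M20 hM2] := real_schwartz_decay [::] h2.
apply: (@le_lt_trans _ _ (\int[mu]_x ((M1 + M2)%:E * (rV_weight x)%:E))).
  apply: ge0_le_integral => //.
  - by move=> x _; rewrite lee_fin normc_ge0.
  - by apply: cmeas_enormc; split; exact: real_schwartz_measurable.
  - by apply: measurable_funeM; apply/measurable_EFinP; exact: measurable_rV_weight.
  - move=> x _; rewrite -EFinM lee_fin (le_trans (normc_le _))// mulrDl lerD//.
    + exact: hM1.
    + exact: hM2.
rewrite ge0_integralZl_EFin//.
- by rewrite lte_mul_pinfty ?integral_rV_weight// lee_fin addr_ge0.
- by move=> x _; rewrite lee_fin ltW// rV_weight_gt0.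
- by apply/measurable_EFinP; exact: measurable_rV_weight.
- exact: addr_ge0.
Qed.

Lemma schwartz_modulus (zeta : V -> R[i]) : schwartz zeta ->
  exists2 C : R, (0 <= C)%R & forall z : V,
    \int[mu]_x (normc (zeta (x - z) - zeta x)%R)%:E <= (C * Num.min 1 (enorm z))%:E.
Proof.
move=> zs; have [mz zi] := schwartz_cintegrable zs; have [h1 h2] := zs.
have [C1 C10 hC1] := real_schwartz_lipschitz h1.
have [C2 C20 hC2] := real_schwartz_lipschitz h2.
pose W := fine (\int[mu]_x (@rV_weight R n x)%:E).
have W0 : 0 <= \int[mu]_x (@rV_weight R n x)%:E.
  by apply: integral_ge0 => x _; rewrite lee_fin ltW// rV_weight_gt0.
have WE : W%:E = \int[mu]_x (@rV_weight R n x)%:E.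
  by rewrite fineK// ge0_fin_numE// integral_rV_weight.
pose Z := fine (\int[mu]_x (normc (zeta x))%:E).
have Z0 : 0 <= \int[mu]_x (normc (zeta x))%:E.
  by apply: integral_ge0 => x _; rewrite lee_fin normc_ge0.
have ZE : Z%:E = \int[mu]_x (normc (zeta x))%:E by rewrite fineK// ge0_fin_numE.
have W0' : (0 <= W)%R by rewrite fine_ge0.
have Z0' : (0 <= Z)%R by rewrite fine_ge0.
have mzz z : cmeas (fun x : V => zeta (x - z) - zeta x)%R.
  by apply: cmeasB => //; exact: (cmeas_comp mz (measurable_sub_snd z)).
exists ((C1 + C2) * W + 2 * Z)%R.
  by rewrite addr_ge0 ?mulr_ge0 ?addr_ge0.
move=> z; have [z1|z1] := leP (enorm z) 1%R.
- have zi1 i : (`|z 0%R i| <= 1)%R by rewrite (le_trans (enorm_coord z i)).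
  apply: (@le_trans _ _ (\int[mu]_x (((C1 + C2) * enorm z)%:E * (rV_weight x)%:E))).
    apply: ge0_le_integral => //.
    + by move=> x _; rewrite lee_fin normc_ge0.
    + exact: cmeas_enormc.
    + by apply: measurable_funeM; apply/measurable_EFinP; exact: measurable_rV_weight.
    + move=> x _; rewrite -EFinM lee_fin (le_trans (normc_le _))// !mulrDl.
      have := hC1 x z zi1; have := hC2 x z zi1.
      by case: (zeta (x - z)%R) (zeta x) => [a b] [c d] /= ? ?; exact: lerD.
  rewrite ge0_integralZl_EFin//; last 3 first.
  + by move=> x _; rewrite lee_fin ltW// rV_weight_gt0.
  + by apply/measurable_EFinP; exact: measurable_rV_weight.
  + by rewrite mulr_ge0 ?addr_ge0 ?enorm_ge0.
  rewrite -WE -EFinM lee_fin mulrAC ler_wpM2r ?enorm_ge0//.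
  by rewrite lerDl mulr_ge0.
- rewrite mulr1.
  apply: (@le_trans _ _ (\int[mu]_x ((normc (zeta (x - z)%R))%:E + (normc (zeta x))%:E))).
    apply: ge0_le_integral => //.
    + by move=> x _; rewrite lee_fin normc_ge0.
    + exact: cmeas_enormc.
    + apply: emeasurable_funD; apply: cmeas_enormc => //.
      exact: (cmeas_comp mz (measurable_sub_snd z)).
    + by move=> x _; rewrite -EFinD lee_fin normcB.
  have mn := cmeas_enormc mz.
  have mn2 : measurable_fun setT (fun x : V => (normc (zeta (x - z)%R))%:E).
    exact: (measurableT_comp mn (measurable_sub_snd z)).
  have nn (y : V) : 0 <= (normc (zeta y))%:E by rewrite lee_fin normc_ge0.
  rewrite ge0_integralD//.
  rewrite (ge0_integral_translate z mn); last by move=> x; rewrite lee_fin normc_ge0.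
  rewrite -ZE -EFinD lee_fin mulr_natl mulr2n lerDr.
  by rewrite mulr_ge0 ?addr_ge0.
Qed.

End schwartz_theory.

Section character.
Context {R : realType} {n : nat}.
Local Notation V := 'rV[R]_n.
Implicit Types x y xi : V.

Definition echar x xi : R[i] := Complex (cos (dotp x xi)) (- sin (dotp x xi)).

Lemma dotpC x y : dotp x y = dotp y x.
Proof. by apply: eq_bigr => i _; rewrite mulrC. Qed.

Lemma dotpDl x y xi : dotp (x + y) xi = dotp x xi + dotp y xi.
Proof. by rewrite /dotp -big_split; apply: eq_bigr => i _; rewrite mxE mulrDl. Qed.

Lemma dotpZl c x xi : dotp (c *: x) xi = c * dotp x xi.
Proof. by rewrite /dotp mulr_sumr; apply: eq_bigr => i _; rewrite mxE mulrA. Qed.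

Lemma echarC x xi : echar x xi = echar xi x.
Proof. by rewrite /echar dotpC. Qed.

Lemma normc_echar x xi : normc (echar x xi) = 1.
Proof. by rewrite /echar /= sqrrN cos2Dsin2 sqrtr1. Qed.

Lemma echarD x y xi : echar (x + y) xi = echar x xi * echar y xi.
Proof.
rewrite /echar dotpDl cosD sinD; apply/eqP; rewrite eq_complex /=.
by apply/andP; split; apply/eqP; ring.
Qed.

Lemma echarZ c x xi : echar (c *: x) xi = echar x (c *: xi).
Proof. by rewrite /echar dotpZl dotpC -dotpZl dotpC. Qed.

Lemma conj_echar x xi : ((echar x xi)^*)%C = echar (- x) xi.
Proof. by rewrite /echar -(scaleN1r x) dotpZl mulN1r cosN sinN /= opprK. Qed.

Lemma cmeas_echar d (T : measurableType d) (f g : T -> V) :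
  measurable_fun setT f -> measurable_fun setT g ->
  cmeas (fun t => echar (f t) (g t)).
Proof.
move=> mf mg.
have md : measurable_fun setT (fun t => dotp (f t) (g t)).
  apply: measurable_sum => i; apply: measurable_funM.
    exact: (measurableT_comp (measurable_rV_coord i) mf).
  exact: (measurableT_comp (measurable_rV_coord i) mg).
split => /=.
- apply: (measurableT_comp (f := cos)) md; apply: continuous_measurable_fun.
  exact: continuous_cos.
- apply: measurable_funN; apply: (measurableT_comp (f := sin)) md.
  by apply: continuous_measurable_fun; exact: continuous_sin.
Qed.

End character.

Section fourier_theory.
Context {R : realType} {n : nat}.
Local Notation mu := (@lebesgue_rV R n).
Local Notation V := 'rV[R]_n.
Implicit Types (f g h u : V -> R[i]) (x y xi : V).

Lemma fourierE g xi : fourier g xi = cint mu (fun x => echar x xi * g x).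
Proof. by []. Qed.

Lemma cmeas_fourier_integrand g xi : cmeas g -> cmeas (fun x => echar x xi * g x).
Proof. by move=> mg; apply: cmeasM => //; apply: cmeas_echar => //; exact: measurable_cst. Qed.

Lemma cintegrable_fourier g xi : cintegrable mu g ->
  cintegrable mu (fun x => echar x xi * g x).
Proof.
move=> [mg gi]; split; first exact: cmeas_fourier_integrand.
by under eq_integral do rewrite normcM normc_echar mul1r.
Qed.

Lemma normc_fourier_le g xi : cmeas g ->
  ((normc (fourier g xi))%:E <= \int[mu]_x (normc (g x))%:E)%E.
Proof.
move=> mg; rewrite fourierE.
apply: (le_trans (normc_cint_le _ (cmeas_fourier_integrand xi mg))).
by under eq_integral do rewrite normcM normc_echar mul1r.
Qed.

Lemma cmeas_fourier g : cmeas g -> cmeas (fourier g).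
Proof.
move=> mg; apply: (@cmeas_cint_snd _ _ _ _ _ mu (fun z => echar z.2 z.1 * g z.2)).
apply: cmeasM; last exact: (cmeas_comp mg measurable_snd).
by apply: cmeas_echar; [exact: measurable_snd|exact: measurable_fst].
Qed.

Lemma fourierB f g xi : cintegrable mu f -> cintegrable mu g ->
  fourier (fun x => f x - g x) xi = fourier f xi - fourier g xi.
Proof.
move=> fi gi; rewrite !fourierE -cintB; [|exact: cintegrable_fourier..].
by congr cint; apply/funext => x; rewrite mulrBr.
Qed.

Lemma fourier_dilate a g xi : 0 < a -> cmeas g ->
  fourier (dilate a g) xi = fourier g (a *: xi).
Proof.
move=> a0 mg; rewrite !fourierE (cint_dilate a0 mg (w := fun x => echar x xi)).
  by congr cint; apply/funext => x; rewrite echarZ.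
by apply: cmeas_echar => //; exact: measurable_cst.
Qed.

Lemma fourier_conv f g xi : cintegrable mu f -> cintegrable mu g ->
  fourier (convolution f g) xi = fourier f xi * fourier g xi.
Proof.
move=> fi gi; have [mf fi'] := fi; have [mg gi'] := gi.
pose F (z : V * V) := echar z.1 xi * (f (z.1 - z.2) * g z.2).
have mF : cmeas F.
  apply: cmeasM; last exact: cmeas_conv_integrand.
  by apply: cmeas_echar; [exact: measurable_fst|exact: measurable_cst].
have Foo : (\int[mu]_x \int[mu]_y (normc (F (x, y)))%:E < +oo)%E.
  under eq_integral => x _ do under eq_integral do rewrite normcM normc_echar mul1r normcM.
  rewrite (integral_conv_ge0 (cmeas_normc mf) (cmeas_normc mg)); last 2 first.
  - by move=> x; exact: normc_ge0.
  - by move=> x; exact: normc_ge0.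
  rewrite lte_mul_pinfty//; last exact: cintegrable_fin.
  by apply: integral_ge0 => x _; rewrite lee_fin normc_ge0.
have f1 : in_Lp 1%:E f by apply/in_L1P.
transitivity (cint mu (fun x => cint mu (fun y => F (x, y)))).
  rewrite fourierE; apply: ae_eq_cint.
  - by apply: cmeas_fourier_integrand; exact: cmeas_conv.
  - exact: cmeas_cint_snd.
  - apply: filterS (ae_cintegrable_conv (lexx 1%:E) f1 gi) => x hx.
    by rewrite convE -cintZl.
rewrite (cint_fubini mF Foo).
rewrite [fourier g xi]fourierE -cintZl; last exact: cintegrable_fourier.
congr cint; apply/funext => y.
rewrite fourierE [RHS]mulrC -cintZl; last exact: cintegrable_fourier.
rewrite -(cint_translate y (f := fun x => echar y xi * g y * (echar x xi * f x))).
  congr cint; apply/funext => x; rewrite /F /=.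
  by have -> : echar x xi = echar (x - y) xi * echar y xi; [rewrite -echarD subrK|ring].
by apply: cmeasM; [exact: cmeas_cst|exact: cmeas_fourier_integrand].
Qed.

Lemma cint_conj f : cintegrable mu f ->
  cint mu (fun x => ((f x)^*)%C) = ((cint mu f)^*)%C.
Proof.
move=> fi; rewrite /cint /=.
rewrite (_ : (fun x => complex.Re (f x)^*%C) = (fun x => complex.Re (f x))); last first.
  by apply/funext => x; case: (f x).
rewrite (_ : (fun x => complex.Im (f x)^*%C) = (fun x => -1 * complex.Im (f x))); last first.
  by apply/funext => x; case: (f x) => a b /=; rewrite mulN1r.
by rewrite RintegralZl ?mulN1r//; exact: cintegrable_Im.
Qed.

Definition conj_reflect g : V -> R[i] := fun x => ((g (- x))^*)%C.

Lemma cmeas_conj_reflect g : cmeas g -> cmeas (conj_reflect g).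
Proof.
move=> mg; apply: cmeas_conj; apply: (cmeas_comp mg).
by apply: (eq_measurable_fun (fun x : V => -1 *: x)) => [x _|]; [rewrite scaleN1r|exact: measurable_scale].
Qed.

Lemma normc_conj (z : R[i]) : normc (z^*)%C = normc z.
Proof. by case: z => a b /=; rewrite sqrrN. Qed.

Lemma cintegrable_conj_reflect g : cintegrable mu g -> cintegrable mu (conj_reflect g).
Proof.
move=> [mg gi]; split; first exact: cmeas_conj_reflect.
rewrite -(ge0_integral_reflect 0 (g := fun x => (normc (conj_reflect g x))%:E)).
- rewrite (eq_integral (fun x => (normc (g x))%:E))// => x _.
  by rewrite /conj_reflect sub0r opprK normc_conj.
- by apply: cmeas_enormc; exact: cmeas_conj_reflect.
- by move=> x; rewrite lee_fin normc_ge0.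
Qed.

Lemma fourier_conj_reflect g xi : cintegrable mu g ->
  fourier (conj_reflect g) xi = ((fourier g xi)^*)%C.
Proof.
move=> gi; have [mg _] := gi.
rewrite !fourierE -cint_conj; last exact: cintegrable_fourier.
rewrite -(cint_reflect 0 (f := fun x => echar x xi * conj_reflect g x)); last first.
  by apply: cmeas_fourier_integrand; exact: cmeas_conj_reflect.
congr cint; apply/funext => x; rewrite /conj_reflect sub0r opprK -conj_echar.
by rewrite -rmorphM.
Qed.

(* By Fubini, the dilated convolution is an integral of values of [fourier u]. *)
Lemma conv_fourier_eq0 u h d x : 0 < d -> cintegrable mu u -> cintegrable mu h ->
  (forall xi, fourier u xi = 0) ->
  convolution u (dilate d (fourier h)) x = 0.
Proof.
move=> d0 ui hi u0; have [mu' ui'] := ui; have [mh hi'] := hi.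
rewrite conv_dilate//; last exact: cmeas_fourier.
have dn0 : - d != 0 by rewrite oppr_eq0 gt_eqF.
have mux : cmeas (fun y : V => u (x - d *: y)).
  apply: (cmeas_comp mu'); apply: (measurableT_comp (measurable_sub_fst x)).
  exact: measurable_scale.
pose F (z : V * V) := u (x - d *: z.1) * (echar z.2 z.1 * h z.2).
have mF : cmeas F.
  apply: cmeasM; first exact: (cmeas_comp mux measurable_fst).
  apply: cmeasM; last exact: (cmeas_comp mh measurable_snd).
  by apply: cmeas_echar; [exact: measurable_snd|exact: measurable_fst].
have uxi : cintegrable mu (fun y : V => u (x - d *: y)).
  split => //.
  have := ge0_integral_affine x dn0 (cmeas_enormc mu') (fun y => _ : (0 <= (normc (u y))%:E)%E).
  move=> h1; rewrite (eq_integral (fun y => (normc (u (- d *: y + x)))%:E)); last first.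
    by move=> y _; rewrite scaleNr addrC.
  rewrite h1; last by move=> y; rewrite lee_fin normc_ge0.
  by rewrite lte_mul_pinfty// lee_fin invr_ge0 exprn_ge0.
have Foo : (\int[mu]_y \int[mu]_z (normc (F (y, z)))%:E < +oo)%E.
  rewrite (eq_integral (fun y => (normc (u (x - d *: y)))%:E * \int[mu]_z (normc (h z))%:E)%E).
    rewrite ge0_integralZr//.
    - rewrite lte_mul_pinfty//; last exact: (cintegrable_fin uxi).
      by apply: integral_ge0 => y _; rewrite lee_fin normc_ge0.
    - exact: cmeas_enormc.
    - by move=> y _; rewrite lee_fin normc_ge0.
    - by apply: integral_ge0 => y _; rewrite lee_fin normc_ge0.
  move=> y _; rewrite -ge0_integralZl_EFin ?normc_ge0//.
  - by apply: eq_integral => z _; rewrite !normcM normc_echar mul1r EFinM.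
  - by move=> z _; rewrite lee_fin normc_ge0.
  - exact: cmeas_enormc.
transitivity (cint mu (fun y => cint mu (fun z => F (y, z)))).
  congr cint; apply/funext => y; rewrite fourierE -cintZl//.
  exact: cintegrable_fourier.
rewrite (cint_fubini mF Foo).
rewrite (_ : (fun z => _) = (fun=> 0)); last first.
  apply/funext => z.
  pose G (w : V) := u w * echar z (d^-1 *: (x - w)).
  have mG : cmeas G.
    apply: cmeasM => //; apply: cmeas_echar; first exact: measurable_cst.
    apply: measurable_rV_scale; exact: measurable_sub_fst.
  have G0 : cint mu G = 0.
    rewrite (_ : G = (fun w => echar z (d^-1 *: x) * (echar w (- d^-1 *: z) * u w))).
      rewrite cintZl; last exact: cintegrable_fourier.
      by rewrite -fourierE u0 mulr0.
    apply/funext => w; rewrite /G -echarZ -[in RHS]echarZ echarC echarD mulrC.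
    rewrite -mulrA; congr (_ * (_ * _)).
      by rewrite echarC echarZ.
    by rewrite -scaleN1r echarZ scaleN1r scaleNr.
  rewrite (_ : (fun y => F (y, z)) = (fun y => h z * G (- d *: y + x))); last first.
    apply/funext => y; rewrite /F /G /=.
    have -> : - d *: y + x = x - d *: y by rewrite scaleNr addrC.
    rewrite opprB addrCA subrr addr0 scalerA mulVf ?gt_eqF// scale1r; ring.
  rewrite cintZl; last first.
    apply: (le_cintegrable (g := fun y => u (x - d *: y))) => //.
      exact: (cmeas_comp mG (measurable_affine _ _)).
    by move=> y; rewrite /G normcM normc_echar mulr1 scaleNr addrC.
  by rewrite (cint_affine x dn0 mG) G0 !mulr0.
by rewrite /cint /Rintegral integral0.
Qed.

End fourier_theory.

Section littlewood_paley_generator.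
Context {R : realType} {n : nat}.
Local Notation mu := (@lebesgue_rV R n).
Local Notation V := 'rV[R]_n.
Variable zeta : V -> R[i].
Hypothesis hzeta : LP_generator zeta.
Implicit Types (f g h u : V -> R[i]) (x y xi : V).

Lemma LP_schwartz : schwartz zeta. Proof. by case: hzeta. Qed.

Lemma LP_cintegrable : cintegrable mu zeta.
Proof. exact: schwartz_cintegrable LP_schwartz. Qed.

Lemma LP_fourier_supp xi : fourier zeta xi != 0 -> enorm xi < 2.
Proof. by case: hzeta => _ h _ hxi; apply: (h xi); exact: subset_closure. Qed.

Lemma LP_fourier_eq1 xi : enorm xi <= 1 -> fourier zeta xi = 1.
Proof. by case: hzeta => _ _ [U [_ h1 h2]] hxi; apply: h2; exact: h1. Qed.

(* |hat zeta|^2 is the Fourier transform of zeta * conj (zeta (- .)); being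
   nonnegative, integrable and not null it serves as a summability kernel. *)
Lemma fourier_square xi :
  fourier (convolution zeta (conj_reflect zeta)) xi = (normc (fourier zeta xi) ^+ 2)%:C%C.
Proof.
have zi := LP_cintegrable; have zi' := cintegrable_conj_reflect zi.
rewrite (fourier_conv _ zi zi') (fourier_conj_reflect _ zi).
case: (fourier zeta xi) => a b; rewrite [normc _]/=.
rewrite sqr_sqrtr ?addr_ge0 ?sqr_ge0//.
by apply/eqP; rewrite eq_complex /=; apply/andP; split; apply/eqP; ring.
Qed.

Lemma summability_kernel : exists h, [/\ cintegrable mu h,
  cintegrable mu (fourier h) & cint mu (fourier h) != 0].
Proof.
have zi := LP_cintegrable; have [mz _] := zi.
have hi := cintegrable_conv zi (cintegrable_conj_reflect zi).
exists (convolution zeta (conj_reflect zeta)).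
have mk : cmeas (fourier (convolution zeta (conj_reflect zeta))).
  by apply: cmeas_fourier; case: hi.
have kE := fourier_square.
move: (fourier (convolution _ _)) mk kE => k mk kE.
have Z_ge xi : normc (fourier zeta xi) <= fine (\int[mu]_x (normc (zeta x))%:E)%E.
  rewrite -lee_fin fineK; first exact: normc_fourier_le.
  exact: (cintegrable_fin zi).
have supp := LP_fourier_supp; have one := LP_fourier_eq1.
move: (fourier zeta) kE Z_ge supp one => zh kE Z_ge supp one.
move: (fine _) Z_ge => Z Z_ge.
have Z0 : 0 <= Z by rewrite (le_trans (normc_ge0 _) (Z_ge 0)).
have ki : cintegrable mu k.
  split => //.
  apply: (@le_lt_trans _ _ (\int[mu]_xi ((Z ^+ 2)%:E * (\1_(box 2) xi)%:E))%E).
    apply: ge0_le_integral => //.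
    - by move=> x _; rewrite lee_fin normc_ge0.
    - exact: cmeas_enormc.
    - by apply: measurable_funeM; apply/measurable_EFinP; exact: measurable_indic_box.
    - move=> xi _; rewrite -EFinM lee_fin indicE kE normcR ger0_norm ?exprn_ge0 ?normc_ge0//.
      have [xB|xB] := boolP (xi \in box 2).
        by rewrite mulr1 ler_pXn2r ?nnegrE ?normc_ge0.
      rewrite mulr0; have [->|/supp h] := eqVneq (zh xi) 0; first by rewrite normc0 expr0n.
      move: xB; rewrite notin_setE => -[] i.
      by rewrite (le_trans (enorm_coord xi i))// ltW.
  rewrite ge0_integralZl_EFin//.
  - rewrite integral_indic//; last exact: measurable_box.
    by rewrite setIT lte_mul_pinfty ?mu_box_lty// lee_fin exprn_ge0.
  - by apply/measurable_EFinP; exact: measurable_indic_box.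
  - by rewrite exprn_ge0.
split => //.
pose r : R := n.+1%:R^-1.
have r0 : 0 < r by rewrite invr_gt0.
have sub xi : box r xi -> enorm xi <= 1.
  move=> hx; rewrite -(@ler_pXn2r _ 2) ?nnegrE ?enorm_ge0// enorm_sqr expr1n.
  apply: (@le_trans _ _ (\sum_(i < n) r)).
    apply: ler_sum => i _; rewrite -[xi 0 i ^+ 2]real_normK ?num_real//.
    have r1 : r <= 1 by rewrite invf_le1// ler1n.
    rewrite (@le_trans _ _ (r ^+ 2))//; last by rewrite expr2 ler_piMl// ltW.
    by rewrite ler_pXn2r ?nnegrE ?(ltW r0)//; exact: hx.
  by rewrite sumr_const card_ord -mulr_natl /r ler_pdivrMr// mul1r ler_nat.
have mB := @measurable_box R n r.
have I : (mu (box r) <= \int[mu]_x (complex.Re (k x))%:E)%E.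
  have -> : mu (box r) = (\int[mu]_x (\1_(box r) x)%:E)%E by rewrite integral_indic// setIT.
  apply: ge0_le_integral => //.
  - by apply/measurable_EFinP; exact: measurable_indic_box.
  - by apply/measurable_EFinP; case: mk.
  - move=> xi _; have kx : complex.Re (k xi) = normc (zh xi) ^+ 2 by rewrite kE.
    rewrite lee_fin kx indicE; have [xB|xB] := boolP (xi \in box r).
      rewrite one ?normc1 ?expr1n//; apply: sub.
      by rewrite inE in xB.
    by rewrite exprn_ge0// normc_ge0.
have Ifin : (\int[mu]_x (complex.Re (k x))%:E)%E \is a fin_num.
  exact: integrable_fin_num (cintegrable_Re ki).
apply/negP => /eqP/(congr1 (@complex.Re R)) /= k0.
have := lt_le_trans (@mu_box_gt0 R n r r0) I.
by rewrite -(fineK Ifin) lte_fin -[X in _ < X]/(\int[mu]_x complex.Re (k x)) k0 ltxx.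
Qed.

Lemma fourier_inj u : cintegrable mu u -> (forall xi, fourier u xi = 0) ->
  {ae mu, forall x, u x = 0}.
Proof.
move=> ui u0; have [mu' _] := ui.
have u1 : in_Lp 1%:E u by apply/in_L1P.
have [h [hi ki k0]] := summability_kernel; have [mk _] := ki.
have u_k d x : 0 < d -> convolution u (dilate d (fourier h)) x = 0.
  by move=> d0; exact: conv_fourier_eq0.
move: (fourier h) ki k0 mk u_k => k ki k0 mk u_k.
pose d (J : nat) : R := 2 ^- J.
have d0 J : 0 < d J by rewrite invr_gt0 exprn_gt0.
have dc : d @ \oo --> (0 : R).
  have := @cvg_geometric R 1 2^-1.
  rewrite ger0_norm// invf_lt1// ltr1n => /(_ isT).
  by rewrite (_ : geometric _ _ = d)//; apply/funext => J; rewrite /geometric /= mul1r exprVn.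
pose U (J : nat) x := normc (convolution u (dilate (d J) k) x - cint mu k * u x).
have UE J x : U J x = normc (cint mu k * u x).
  by rewrite /U u_k// sub0r normcN.
have mU J : measurable_fun setT (U J).
  apply: cmeas_normc; apply: cmeasB.
    by apply: cmeas_conv => //; exact: cmeas_dilate.
  by apply: cmeasM => //; exact: cmeas_cst.
have := ae_limn_einf0 mU (fun J x => normc_ge0 _)
  (fun N => approximate_identity N (lexx 1%:E) u1 ki d0 dc).
apply: filterS => x.
rewrite (_ : (fun J => (U J x)%:E) = cst (normc (cint mu k * u x))%:E); last first.
  by apply/funext => J; rewrite UE.
have [-> _] := @cvg_limn_einf_sup R _ _ (cvg_cst (normc (cint mu k * u x))%:E : _ @ \oo --> _).
move=> [/eq0_normc/eqP]; rewrite mulf_eq0 (negbTE k0)/= => /eqP//.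
Qed.

Lemma LP_conv_dilate a b : 0 < b -> 2 * b <= a ->
  {ae mu, forall x, convolution (dilate a zeta) (dilate b zeta) x = dilate a zeta x}.
Proof.
move=> b0 ba; have a0 : 0 < a by rewrite (lt_le_trans _ ba)// mulr_gt0.
have zi := LP_cintegrable; have [mz _] := zi.
have ia := cintegrable_dilate a0 zi; have ib := cintegrable_dilate b0 zi.
have iab := cintegrable_conv ia ib.
have := fourier_inj (cintegrableB iab ia).
case/(_ _)/Wrap => [xi|].
  rewrite fourierB// fourier_conv// !fourier_dilate//.
  have [->|h] := eqVneq (fourier zeta (a *: xi)) 0; first by rewrite mul0r subrr.
  rewrite (LP_fourier_eq1 (xi := b *: xi)) ?mulr1 ?subrr//.
  have := LP_fourier_supp h; rewrite !enormZ !gtr0_norm// => h2.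
  have e0 := enorm_ge0 xi.
  have : 2 * b * enorm xi <= a * enorm xi by rewrite ler_wpM2r.
  lra.
by apply: filterS => x /eqP; rewrite subr_eq0 => /eqP.
Qed.

End littlewood_paley_generator.

Section dyadic_sum.
Context {R : realType} (s : R).
Hypotheses (s_gt0 : 0 < s) (s_lt1 : s < 1).

Let b1 (t : R) := Num.min t 2 `^ (1 - s) / (2 `^ (1 - s) - 1).
Let b2 (t : R) := - (Num.max t 1 `^ (- s) / (1 - 2 `^ (- s))).
Definition dyadic_const : R := 2 `^ (1 - s) / (2 `^ (1 - s) - 1) + (1 - 2 `^ (- s))^-1.

Let p1 : 0 < 2 `^ (1 - s) - 1.
Proof.
rewrite subr_gt0 -[X in X < _](powRr0 2); rewrite /powR pnatr_eq0/= ltr_expR.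
by rewrite ltr_pM2r ?subr_gt0// ln_gt0// ltr1n.
Qed.

Let p2 : 0 < 1 - 2 `^ (- s).
Proof.
rewrite subr_gt0 -[X in _ < X](powRr0 2); rewrite /powR pnatr_eq0/= ltr_expR.
by rewrite ltr_pM2r ?oppr_lt0// ln_gt0// ltr1n.
Qed.

Lemma dyadic_const_ge0 : 0 <= dyadic_const.
Proof. by rewrite addr_ge0// ?invr_ge0 ?divr_ge0 ?powR_ge0// ltW. Qed.

Let le_b1 (t t' : R) : 0 <= t -> t <= t' -> b1 t <= b1 t'.
Proof.
move=> t0 tt'; rewrite ler_pM2r ?invr_gt0//.
have H : Num.min t 2 <= Num.min t' 2 by rewrite le_min !ge_min tt' lexx orbT.
have H0 : 0 <= Num.min t 2 by rewrite le_min t0 ler0n.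
by apply: ge0_ler_powR; rewrite ?subr_ge0 ?(ltW s_lt1)// nnegrE// (le_trans H0).
Qed.

Let le_b2 (t t' : R) : 0 <= t -> t <= t' -> b2 t <= b2 t'.
Proof.
move=> t0 tt'; rewrite lerN2 ler_pM2r ?invr_gt0// !powRN.
have m1 (u : R) : 0 < Num.max u 1 by rewrite lt_max ltr01 orbT.
rewrite lef_pV2 ?posrE ?powR_gt0//.
apply: ge0_ler_powR; rewrite ?(ltW s_gt0)// ?nnegrE ?(ltW (m1 _))//.
by rewrite ge_max le_max tt' le_max lexx orbT.
Qed.

(* Both ranges of t telescope along t, 2 t, 4 t, ... *)
Let telescope_step (t : R) : 0 < t ->
  t `^ (- s) * Num.min 1 t <= (b1 (2 * t) + b2 (2 * t)) - (b1 t + b2 t).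
Proof.
move=> t0; have t20 : t <= 2 * t by lra.
have h1 := le_b1 (ltW t0) t20; have h2 := le_b2 (ltW t0) t20.
have [t1|t1] := leP t 1.
- have -> : t `^ (- s) * t = b1 (2 * t) - b1 t.
    rewrite /b1 !min_l; [|lra|lra].
    have -> : t `^ (- s) * t = t `^ (1 - s).
      by rewrite -{2}(powRr1 (ltW t0)) -powRD ?(gt_eqF t0) ?implybT// addrC.
    rewrite powRM ?ltW//; have := gt_eqF p1; move/negbT.
    by move: (_ `^ _) (t `^ _) => a b a1; field.
  lra.
- rewrite mulr1.
  have -> : t `^ (- s) = b2 (2 * t) - b2 t.
    rewrite /b2 !max_l; [|lra|lra].
    rewrite powRM ?ltW//; have := gt_eqF p2; move/negbT.
    by move: (2 `^ _) (t `^ _) => a b a1; field.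
  lra.
Qed.

Lemma dyadic_sum_le (c r : R) (N : nat) : 0 < c -> 0 <= r ->
  \sum_(0 <= i < N) (2 ^+ i * c) `^ (- s) * Num.min 1 (2 ^+ i * c * r) <=
  dyadic_const * r `^ s.
Proof.
move=> c0; rewrite le_eqVlt => /predU1P[<-|r0].
  rewrite big1 ?mulr_ge0 ?dyadic_const_ge0 ?powR_ge0// => i _.
  by rewrite mulr0 min_r ?ler01// mulr0.
pose t i := 2 ^+ i * c * r.
have t0 i : 0 < t i by rewrite !mulr_gt0// exprn_gt0.
have E i : (2 ^+ i * c) `^ (- s) * Num.min 1 (2 ^+ i * c * r) =
    (t i `^ (- s) * Num.min 1 (t i)) * r `^ s.
  rewrite /t; have : 0 <= 2 ^+ i * c by rewrite mulr_ge0 ?exprn_ge0 ?ltW.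
  move: (2 ^+ i * c) => d d0; rewrite (powRM _ d0 (ltW r0)) !powRN.
  have : r `^ s != 0 by rewrite gt_eqF// powR_gt0.
  move: (r `^ s) (d `^ s)^-1 (Num.min _ _) => a b m a0.
  by rewrite mulrAC -(mulrA b) mulVf// mulr1.
under eq_bigr do rewrite E.
rewrite -mulr_suml ler_wpM2r ?powR_ge0//.
have S : \sum_(0 <= i < N) t i `^ (- s) * Num.min 1 (t i) <=
    (b1 (t N) + b2 (t N)) - (b1 (t 0%N) + b2 (t 0%N)).
  elim: N => [|N IH]; first by rewrite big_geq// subrr.
  rewrite big_nat_recr//=.
  have := telescope_step (t0 N).
  have -> : 2 * t N = t N.+1 by rewrite /t exprS !mulrA.
  lra.
rewrite (le_trans S)// /dyadic_const.
have B1 : b1 (t N) <= 2 `^ (1 - s) / (2 `^ (1 - s) - 1).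
  rewrite ler_pM2r ?invr_gt0//; apply: ge0_ler_powR;
    rewrite ?subr_ge0 ?(ltW s_lt1)// ?nnegrE ?le_min ?(ltW (t0 N)) ?ler0n//.
  by rewrite ge_min lexx orbT.
have B1' : 0 <= b1 (t 0%N) by rewrite divr_ge0 ?powR_ge0// ltW.
have B2 : b2 (t N) <= 0 by rewrite oppr_le0 divr_ge0 ?powR_ge0// ltW.
have B2' : - b2 (t 0%N) <= (1 - 2 `^ (- s))^-1.
  rewrite opprK ler_pdivrMr// mulVf ?gt_eqF// powRN invf_le1.
    by rewrite -{1}(congr1 (@^~ s) (@powR1 R)); apply: ge0_ler_powR;
      rewrite ?(ltW s_gt0)// ?nnegrE ?le_max ?lexx ?ler01 ?orbT.
  by rewrite powR_gt0// lt_max ltr01 orbT.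
lra.
Qed.

End dyadic_sum.

Section schur_test.
Context {R : realType}.
Local Open Scope ereal_scope.

Lemma nneseries_jensen (K b : nat -> R) (q : R) : (1 <= q)%R ->
  (forall j, 0 <= K j)%R -> (forall j, 0 <= b j)%R ->
  (\sum_(j <oo) (K j * b j)%:E) `^ q <=
  (\sum_(j <oo) (K j)%:E) `^ (q - 1) * \sum_(j <oo) (K j * b j `^ q)%:E.
Proof.
move=> q1 K0 b0.
have := @jensen_poweR _ nat R counting K b q q1 (fun _ _ _ => I) (fun _ _ _ => I) K0 b0.
rewrite !ge0_integral_count// => j; rewrite lee_fin ?mulr_ge0 ?powR_ge0//.
Qed.

Lemma schur_test (K : nat -> nat -> R) (b : nat -> R) (A q : R) : (1 <= q)%R -> (0 <= A)%R ->
  (forall k j, 0 <= K k j)%R -> (forall j, 0 <= b j)%R ->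
  (forall k, \sum_(j <oo) (K k j)%:E <= A%:E) ->
  (forall j, \sum_(k <oo) (K k j)%:E <= A%:E) ->
  \sum_(k <oo) (\sum_(j <oo) (K k j * b j)%:E) `^ q <=
  (A `^ q)%:E * \sum_(j <oo) (b j `^ q)%:E.
Proof.
move=> q1 A0 K0 b0 Kj Kk.
have q0 : (0 < q)%R by rewrite (lt_le_trans _ q1).
have Kb0 k j : 0 <= (K k j * b j `^ q)%:E by rewrite lee_fin mulr_ge0 ?powR_ge0.
apply: (@le_trans _ _ (\sum_(k <oo) ((A `^ (q - 1))%:E * \sum_(j <oo) (K k j * b j `^ q)%:E))).
  apply: lee_nneseries => [k _ _|k _]; first exact: poweR_ge0.
  apply: (le_trans (nneseries_jensen q1 (K0 k) b0)).
  rewrite lee_wpmul2r//; first exact: nneseries_ge0.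
  rewrite -poweR_EFin; apply: le_poweR => //; first by rewrite subr_ge0.
  by apply: nneseries_ge0 => j _ _; rewrite lee_fin.
rewrite nneseriesZl//; last by move=> k _; exact: nneseries_ge0.
rewrite nneseries_interchange//.
apply: (@le_trans _ _ ((A `^ (q - 1))%:E * \sum_(j <oo) (A%:E * (b j `^ q)%:E))).
  rewrite lee_wpmul2l ?lee_fin ?powR_ge0//.
  apply: lee_nneseries => [j _ _|j _]; first by apply: nneseries_ge0.
  rewrite (_ : \sum_(k <oo) (K k j * b j `^ q)%:E = (b j `^ q)%:E * \sum_(k <oo) (K k j)%:E); last first.
    rewrite -nneseriesZl//; last by move=> k _; rewrite lee_fin.
    by apply: eq_eseriesr => k _; rewrite -EFinM mulrC.
  by rewrite muleC lee_wpmul2r ?lee_fin ?powR_ge0.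
rewrite nneseriesZl//; last by move=> j _; rewrite lee_fin powR_ge0.
by rewrite muleA -EFinM mulrC mulr_powRB1.
Qed.

End schur_test.

Section modulus_of_continuity.
Context {R : realType} {n : nat}.
Local Notation mu := (@lebesgue_rV R n).
Local Notation V := 'rV[R]_n.
Implicit Types (f g k : V -> R[i]) (h : V).
Local Open Scope ereal_scope.

Definition L1_modulus g h : \bar R := \int[mu]_x (normc (g (x - h) - g x)%R)%:E.

Lemma L1_modulus_ge0 g h : 0 <= L1_modulus g h.
Proof. by apply: integral_ge0 => x _; rewrite lee_fin normc_ge0. Qed.

Lemma cmeas_sub_translate g h : cmeas g -> cmeas (fun x : V => g (x - h) - g x)%R.
Proof. by move=> mg; apply: cmeasB => //; exact: (cmeas_comp mg (measurable_sub_snd h)). Qed.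

Lemma measurable_L1_modulus g : cmeas g -> measurable_fun setT (L1_modulus g).
Proof.
move=> mg.
apply: (@measurable_fun_fubini_tonelli_F _ _ _ _ _ mu
  (fun z : V * V => (normc (g (z.2 - z.1) - g z.2)%R)%:E)).
- apply: cmeas_enormc; apply: cmeasB; last exact: (cmeas_comp mg measurable_snd).
  by apply: (cmeas_comp mg); apply: measurable_rV_sub; [exact: measurable_snd|exact: measurable_fst].
- by move=> z; rewrite lee_fin normc_ge0.
Qed.

Lemma L1_modulus_le g h : cintegrable mu g -> L1_modulus g h <= 2%:E * Lp_norm 1%:E g.
Proof.
move=> [mg gi]; rewrite Lp1E.
have mt : cmeas (fun x : V => g (x - h)%R) by exact: (cmeas_comp mg (measurable_sub_snd h)).
apply: (@le_trans _ _ (\int[mu]_x ((normc (g (x - h)%R))%:E + (normc (g x))%:E))).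
  apply: ge0_le_integral => //.
  - by move=> x _; rewrite lee_fin normc_ge0.
  - by apply: cmeas_enormc; exact: cmeas_sub_translate.
  - by apply: emeasurable_funD; exact: cmeas_enormc.
  - by move=> x _; rewrite -EFinD lee_fin normcB.
rewrite ge0_integralD//; last 4 first.
- by move=> x _; rewrite lee_fin normc_ge0.
- exact: cmeas_enormc.
- by move=> x _; rewrite lee_fin normc_ge0.
- exact: cmeas_enormc.
rewrite (ge0_integral_translate h (g := fun y => (normc (g y))%:E)).
- by rewrite -mule2n mule_natl.
- exact: cmeas_enormc.
- by move=> x; rewrite lee_fin normc_ge0.
Qed.

Lemma L1_modulus_dilate d g h : (0 < d)%R -> cmeas g ->
  L1_modulus (dilate d g) h = L1_modulus g (d^-1 *: h)%R.
Proof.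
move=> d0 mg.
rewrite /L1_modulus -(ge0_integral_normc_dilate d0 (cmeas_sub_translate (d^-1 *: h)%R mg)).
by apply: eq_integral => x _; rewrite /dilate mulrBr scalerBr.
Qed.

Lemma conv_diff_L1 g k : cintegrable mu g -> cintegrable mu k ->
  Lp_norm 1%:E (fun x => convolution g k x - cint mu k * g x)%R <=
  \int[mu]_y (L1_modulus g y * (normc (k y))%:E).
Proof.
move=> gi ki; have [mg _] := gi; have [mk ki'] := ki.
have g1 : in_Lp 1%:E g by apply/in_L1P.
pose W (z : V * V) := (normc (g (z.1 - z.2) - g z.1)%R * normc (k z.2))%R.
have mW : measurable_fun setT (fun z => (W z)%:E).
  apply/measurable_EFinP; apply: measurable_funM.
    apply: cmeas_normc; apply: cmeasB; last exact: (cmeas_comp mg measurable_fst).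
    apply: (cmeas_comp mg); apply: measurable_rV_sub; first exact: measurable_fst.
    exact: measurable_snd.
  exact: (measurableT_comp (cmeas_normc mk) measurable_snd).
have W0 z : (0 <= W z)%R by rewrite mulr_ge0 ?normc_ge0.
have W0' z : 0 <= (W z)%:E by rewrite lee_fin.
have WE y : \int[mu]_x (W (x, y))%:E = L1_modulus g y * (normc (k y))%:E.
  rewrite /L1_modulus -ge0_integralZr ?lee_fin ?normc_ge0//.
  - by apply: cmeas_enormc; exact: cmeas_sub_translate.
  - by move=> x _; rewrite lee_fin normc_ge0.
under eq_integral do rewrite -WE.
rewrite Lp1E -(@fubini_tonelli _ _ _ _ _ mu mu (fun z => (W z)%:E))//.
apply: ae_ge0_le_integral => //.
- by move=> x _; rewrite lee_fin normc_ge0.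
- apply: cmeas_enormc; apply: cmeasB; first exact: cmeas_conv.
  by apply: cmeasM => //; exact: cmeas_cst.
- by move=> x _; apply: integral_ge0 => y _.
- exact: (@measurable_fun_fubini_tonelli_F _ _ _ _ _ mu (fun z => (W z)%:E)).
- apply: filterS (ae_cintegrable_conv (lexx 1%:E) g1 ki) => x i2 _.
  have i3 : cintegrable mu (fun y => g x * k y)%R by exact: cintegrableZl.
  rewrite convE (mulrC (cint mu k)) -cintZl// -cintB//.
  apply: (le_trans (normc_cint_le _ _)); first by have [] := cintegrableB i2 i3.
  rewrite le_eqVlt; apply/orP; left; apply/eqP; apply: eq_integral => y _.
  by rewrite /W /= -mulrBl normcM.
Qed.

Lemma L1_modulus_small g k (e : R) : (0 < e)%R -> cintegrable mu g -> cintegrable mu k ->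
  exists2 d0 : R, (0 < d0)%R & forall d, (0 < d <= d0)%R ->
    \int[mu]_y (L1_modulus g (d *: y)%R * (normc (k y))%:E) <= e%:E.
Proof.
move=> e0 gi ki; have [mg _] := gi; have [mk ki'] := ki.
apply: contrapT => hN.
have /choice[d dP] : forall N : nat, exists d : R, (0 < d <= N.+1%:R^-1)%R /\
    e%:E < \int[mu]_y (L1_modulus g (d *: y)%R * (normc (k y))%:E).
  move=> N; apply: contrapT => h; apply: hN; exists N.+1%:R^-1%R => // d dN.
  by rewrite leNgt; apply/negP => lt; apply: h; exists d.
have d0 : d @ \oo --> (0 : R)%R.
  apply: (@squeeze_cvgr _ _ _ _ (cst 0%R) (fun N => N.+1%:R^-1%R)).
  - by apply: nearW => N; have [/andP[/ltW -> ->] _] := dP N.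
  - exact: cvg_cst.
  - exact: cvg_harmonic.
have mZ (c : R) : measurable_fun setT (fun y : V => L1_modulus g (c *: y)%R).
  exact: (measurableT_comp (measurable_L1_modulus mg) (measurable_scale _)).
have F0 N y : 0 <= L1_modulus g (d N *: y)%R * (normc (k y))%:E.
  by rewrite mule_ge0 ?L1_modulus_ge0// lee_fin normc_ge0.
have := @ge0_dominated_cvg0 _ _ _ mu
  (fun N y => L1_modulus g (d N *: y)%R * (normc (k y))%:E)
  (fun y => 2%:E * Lp_norm 1%:E g * (normc (k y))%:E).
case/(_ _ _ _ _ _ _)/Wrap => //.
- by move=> N; apply: emeasurable_funM => //; exact: cmeas_enormc.
- apply: nearW => y; rewrite -[X in _ --> X](mul0e (normc (k y))%:E).
  apply: cvgeZr => //; apply: (L1_translation gi) => i.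
  rewrite (_ : (fun N => _) = (fun N => d N * y 0 i)%R); last first.
    by apply/funext => J; rewrite mxE.
  by rewrite -[X in _ --> X](mul0r (y 0%R i)); apply: cvgM => //; exact: cvg_cst.
- by apply: emeasurable_funM => //; exact: cmeas_enormc.
- have /fineK <- : 2%:E * Lp_norm 1%:E g \is a fin_num.
    by rewrite fin_numM// in_Lp_fin//; apply/in_L1P.
  rewrite ge0_integralZl_EFin ?fine_ge0 ?mule_ge0 ?Lp_norm_ge0//; last 2 first.
  + by move=> x _; rewrite lee_fin normc_ge0.
  + exact: cmeas_enormc.
  by rewrite lte_mul_pinfty// lee_fin fine_ge0// mule_ge0 ?Lp_norm_ge0.
- by move=> N y; rewrite lee_wpmul2r ?L1_modulus_le// lee_fin normc_ge0.
have I0 N : 0 <= \int[mu]_y (L1_modulus g (d N *: y)%R * (normc (k y))%:E).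
  by apply: integral_ge0 => y _; exact: F0.
move=> /(ge0_cvge0P I0)/(_ e e0)[N _ /(_ N (leqnn N))] /=.
by have [_] := dP N; rewrite ltNge => /negP.
Qed.

End modulus_of_continuity.

Section conv_reproducing.
Context {R : realType} {n : nat}.
Local Notation mu := (@lebesgue_rV R n).
Local Notation V := 'rV[R]_n.
Variables (p : \bar R) (f psi chi rho : V -> R[i]).
Hypotheses (p1 : (1 <= p)%E) (fp : in_Lp p f).
Hypotheses (psii : cintegrable mu psi) (chii : cintegrable mu chi) (rhoi : cintegrable mu rho).
Hypothesis psi_chi : {ae mu, forall x, convolution psi chi x = psi x}.
Local Open Scope ereal_scope.

Let mpsi : cmeas psi. Proof. by case: psii. Qed.
Let mchi : cmeas chi. Proof. by case: chii. Qed.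
Let mrho : cmeas rho. Proof. by case: rhoi. Qed.

Lemma conv_ae_reproducing :
  {ae mu, forall x, convolution (convolution f psi) chi x = convolution f psi x}.
Proof.
apply: filterS (conv_ae_A p1 fp psii chii) => x ->; have [mf _] := fp.
by rewrite (conv_ae_eqr mf _ mpsi psi_chi)//; exact: cmeas_conv.
Qed.

(* psi * rho = (psi * chi) * rho, so only chi has to be convolved with rho. *)
Lemma conv_ae_residual :
  {ae mu, forall x, convolution (fun y => f y - convolution f rho y)%R psi x =
    (convolution f psi x - convolution (convolution f psi) (convolution chi rho) x)%R}.
Proof.
have [mf _] := fp.
have fr := in_Lp_conv p1 fp rhoi.
have psi1 : in_Lp 1%:E psi by apply/in_L1P.
have pcr := cintegrable_conv chii rhoi.
have e1 : convolution f (convolution psi (convolution chi rho)) = convolution f (convolution psi rho).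
  rewrite (conv_ae_eqr (k := convolution (convolution psi chi) rho) mf); last 3 first.
  - by apply: cmeas_conv => //; exact: cmeas_conv.
  - by apply: cmeas_conv => //; exact: cmeas_conv.
  - by apply: filterS (conv_ae_A (lexx 1%:E) psi1 chii rhoi) => x ->.
  by rewrite (conv_ae_eql _ mpsi mrho psi_chi)//; exact: cmeas_conv.
have h1 := conv_ae_Bl p1 fp fr psii.
have h2 := conv_ae_A p1 fp rhoi psii.
have h3 := conv_ae_A p1 fp psii pcr.
apply: filterS2 h1 (filterI h2 h3) => x -> [-> ->].
by rewrite e1 (convC mrho mpsi).
Qed.

Lemma Lp_residual_le :
  Lp_norm p (convolution (fun y => f y - convolution f rho y)%R psi) <=
  Lp_norm p (convolution f psi) * Lp_norm 1%:E (fun y => chi y - convolution chi rho y)%R.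
Proof.
have [mf _] := fp; have gp := in_Lp_conv p1 fp psii; have [mg _] := gp.
have cri := cintegrable_conv chii rhoi; have di := cintegrableB chii cri.
apply: (le_trans _ (Lp_conv_le p1 mg di)).
have [md _] := di.
rewrite le_eqVlt; apply/orP; left; apply/eqP; apply: ae_eq_Lp_norm => //.
- apply: cmeas_conv => //; apply: cmeasB => //; exact: cmeas_conv.
- exact: cmeas_conv.
apply: filterS2 conv_ae_residual (filterI conv_ae_reproducing (conv_ae_Br p1 gp chii cri)).
by move=> x -> [h ->]; rewrite h.
Qed.

Lemma Lp_piece_le_residual (c : R) : (c <= 2^-1)%R ->
  Lp_norm 1%:E (convolution chi rho) <= c%:E ->
  Lp_norm p (convolution f psi) <=
  2%:E * Lp_norm 1%:E psi * Lp_norm p (fun y => f y - convolution f rho y)%R.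
Proof.
move=> c2 hc.
have [mf _] := fp; have gp := in_Lp_conv p1 fp psii; have [mg _] := gp.
have cri := cintegrable_conv chii rhoi; have [mcr _] := cri.
have up := in_LpB p1 fp (in_Lp_conv p1 fp rhoi); have [mu_ _] := up.
have H : Lp_norm p (convolution f psi) <=
    Lp_norm p (fun y => f y - convolution f rho y)%R * Lp_norm 1%:E psi +
    Lp_norm p (convolution f psi) * (2^-1)%:E.
  apply: (@le_trans _ _ (Lp_norm p (convolution (fun y => f y - convolution f rho y)%R psi) +
      Lp_norm p (convolution (convolution f psi) (convolution chi rho)))).
    apply: (le_trans _ (Lp_normD p1 (cmeas_conv mu_ mpsi) (cmeas_conv mg mcr))).
    rewrite le_eqVlt; apply/orP; left; apply/eqP; apply: ae_eq_Lp_norm => //.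
      by apply: cmeasD; exact: cmeas_conv.
    by apply: filterS conv_ae_residual => x ->; rewrite subrK.
  apply: leeD; first exact: Lp_conv_le.
  apply: (le_trans (Lp_conv_le p1 mg cri)); rewrite lee_wpmul2l ?Lp_norm_ge0//.
  by rewrite (le_trans hc).
have psi1 : in_Lp 1%:E psi by apply/in_L1P.
move: H; have /fineK <- := in_Lp_fin gp; have /fineK <- := in_Lp_fin up.
have /fineK <- := in_Lp_fin psi1.
rewrite -!EFinM -EFinD !lee_fin; move: (fine _) (fine _) (fine _) => a b c'; lra.
Qed.

End conv_reproducing.

Section littlewood_paley_decomposition.
Context {R : realType} {n : nat}.
Local Notation mu := (@lebesgue_rV R n).
Local Notation V := 'rV[R]_n.
Variable zeta : V -> R[i].
Hypothesis hzeta : LP_generator zeta.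
Implicit Types (f rho : V -> R[i]) (p : \bar R).

Let zi : cintegrable mu zeta := LP_cintegrable hzeta.
Let mz : cmeas zeta := zi.1.

Definition LP_low (j : nat) : V -> R[i] := dilate (2 ^- j) zeta.

(* For j > 0 this is the kernel phi_{2^(1-j)} of LP_piece, as a difference of
   two dilates of zeta. *)
Definition LP_kernel (j : nat) : V -> R[i] :=
  if j is k.+1 then fun x => LP_low k.+1 x - LP_low k x else zeta.

Lemma LP_scale_gt0 (j : nat) : 0 < 2 ^- j :> R.
Proof. by rewrite invr_gt0 exprn_gt0. Qed.

Lemma LP_scale_cvg0 : (fun j => 2 ^- j : R) @ \oo --> (0 : R).
Proof.
have := @cvg_geometric R 1 2^-1.
rewrite ger0_norm// invf_lt1// ltr1n => /(_ isT).
by rewrite (_ : geometric _ _ = (fun j => 2 ^- j))//; apply/funext => J; rewrite /geometric /= mul1r exprVn.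
Qed.

Lemma cintegrable_LP_low j : cintegrable mu (LP_low j).
Proof. exact: cintegrable_dilate (LP_scale_gt0 j) zi. Qed.

Lemma LP_low0 : LP_low 0 = zeta.
Proof. by rewrite /LP_low expr0 invr1 dilate1. Qed.

Lemma cintegrable_LP_kernel j : cintegrable mu (LP_kernel j).
Proof. by case: j => [|k] //=; apply: cintegrableB; exact: cintegrable_LP_low. Qed.

Lemma LP_pieceE f j : LP_piece zeta f j = convolution f (LP_kernel j).
Proof.
case: j => [//|k] /=; congr (convolution f _).
rewrite (_ : LP_phi zeta = (fun x => dilate 2^-1 zeta x - zeta x))//.
by rewrite dilateB dilate_comp -invfM -exprSr.
Qed.

Lemma cint_zeta : cint mu zeta = 1.
Proof.
have e0 : enorm (0 : V) <= 1.
  by rewrite /enorm /dotp big1 ?sqrtr0// => i _; rewrite mxE mul0r.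
rewrite -(LP_fourier_eq1 hzeta e0) fourierE; congr cint; apply/funext => x.
rewrite /echar (_ : dotp x 0 = 0) ?cos0 ?sin0 ?oppr0 ?mul1r//.
by rewrite /dotp big1// => i _; rewrite mxE mulr0.
Qed.

Local Open Scope ereal_scope.

Lemma Lp1_LP_kernel j : Lp_norm 1%:E (LP_kernel j) <= 2%:E * Lp_norm 1%:E zeta.
Proof.
have z0 := Lp_norm_ge0 1%:E zeta.
have E : 2%:E * Lp_norm 1%:E zeta = Lp_norm 1%:E zeta + Lp_norm 1%:E zeta.
  by rewrite mule_natl mule2n.
rewrite E; case: j => [|k]; first by rewrite leeDl.
have [m1 _] := cintegrable_LP_low k; have [m2 _] := cintegrable_LP_low k.+1.
apply: (le_trans (Lp_normB (lexx 1%:E) m2 m1)).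
by rewrite !Lp1_dilate// LP_scale_gt0.
Qed.

Lemma LP_low_conv a b : (a < b)%N ->
  {ae mu, forall x, convolution (LP_low a) (LP_low b) x = LP_low a x}.
Proof.
move=> ab; apply: (LP_conv_dilate hzeta (LP_scale_gt0 b)).
rewrite -ler_pdivlMl// -invfM -exprS.
by rewrite lef_pV2 ?posrE ?exprn_gt0// ler_eXn2l// ltr1n.
Qed.

Lemma LP_low_conv_gt a b : (a < b)%N ->
  {ae mu, forall x, convolution (LP_low b) (LP_low a) x = LP_low a x}.
Proof.
move=> ab; have [ma _] := cintegrable_LP_low a; have [mb _] := cintegrable_LP_low b.
by rewrite (convC mb ma); exact: LP_low_conv.
Qed.

Lemma LP_kernel_conv_low j :
  {ae mu, forall x, convolution (LP_kernel j) (LP_low j.+1) x = LP_kernel j x}.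
Proof.
case: j => [|k]; first by rewrite /= -LP_low0; exact: LP_low_conv.
have low1 j : in_Lp 1%:E (LP_low j) by apply/in_L1P; exact: cintegrable_LP_low.
apply: filterS2 (conv_ae_Bl (lexx 1%:E) (low1 k.+1) (low1 k) (cintegrable_LP_low k.+2))
  (filterI (LP_low_conv (ltnSn k.+1)) (LP_low_conv (ltnW (ltnSn k.+1)))) => x /=.
by move=> -> [-> ->].
Qed.

(* Its Fourier transform is 1 on the support of that of LP_kernel i.+2 and
   vanishes near 0, so that its integral is 0. *)
Definition LP_band (i : nat) : V -> R[i] := fun x => (LP_low i.+3 x - LP_low i x)%R.

Lemma LP_kernel_conv_band i :
  {ae mu, forall x, convolution (LP_kernel i.+2) (LP_band i) x = LP_kernel i.+2 x}.
Proof.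
have low1 j : in_Lp 1%:E (LP_low j) by apply/in_L1P; exact: cintegrable_LP_low.
have K1 : in_Lp 1%:E (LP_kernel i.+2) by apply/in_L1P; exact: cintegrable_LP_kernel.
have h1 := conv_ae_Br (lexx 1%:E) K1 (cintegrable_LP_low i.+3) (cintegrable_LP_low i).
have h2 := conv_ae_Bl (lexx 1%:E) (low1 i.+2) (low1 i.+1) (cintegrable_LP_low i).
have h3 := LP_low_conv_gt (ltnW (ltnSn i.+1)).
have h4 := LP_low_conv_gt (ltnSn i).
apply: filterS2 (filterI h1 (LP_kernel_conv_low i.+2)) (filterI h2 (filterI h3 h4)) => x.
by move=> [-> ->] /= [-> [-> ->]]; rewrite subrr subr0.
Qed.

Lemma LP_norm_le p f : 1 <= p -> in_Lp p f ->
  Lp_norm p f <= \sum_(j <oo) Lp_norm p (LP_piece zeta f j).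
Proof.
move=> p1 fp; have [mf _] := fp.
have mlow j : cmeas (LP_low j) by case: (cintegrable_LP_low j).
have mker j : cmeas (LP_kernel j) by case: (cintegrable_LP_kernel j).
have tele : {ae mu, forall x, forall k, convolution f (LP_kernel k.+1) x =
    (convolution f (LP_low k.+1) x - convolution f (LP_low k) x)%R}.
  apply/ae_foralln => k.
  exact: conv_ae_Br p1 fp (cintegrable_LP_low _) (cintegrable_LP_low _).
pose u J x := normc (convolution f (LP_low J) x - f x)%R.
have lim0 : {ae mu, forall x, limn_einf (fun J => (u J x)%:E) = 0}.
  apply: ae_limn_einf0 => [J|J x|N].
  - by apply: cmeas_normc; apply: cmeasB => //; exact: cmeas_conv.
  - exact: normc_ge0.
  - have := approximate_identity N p1 fp zi LP_scale_gt0 LP_scale_cvg0.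
    by rewrite cint_zeta /u; under eq_fun do under eq_integral do rewrite mul1r.
pose F j x := (normc (convolution f (LP_kernel j) x))%:E.
have F0 j x : 0 <= F j x by rewrite lee_fin normc_ge0.
have mF j : measurable_fun setT (F j) by apply: cmeas_enormc; exact: cmeas_conv.
have ptw : {ae mu, forall x, (normc (f x))%:E <= \sum_(j <oo) F j x}.
  apply: filterS2 tele lim0 => x hx lx.
  have part J : (normc (convolution f (LP_low J) x))%:E <= \sum_(0 <= j < J.+1) F j x.
    elim: J => [|J IH]; first by rewrite big_nat1 LP_low0.
    rewrite big_nat_recr//; apply: (le_trans _ (leeD IH (lexx _))).
    rewrite /F hx -EFinD lee_fin; move: (convolution _ _ x) (convolution _ _ x) => a b.
    by have := normcD a (b - a)%R; rewrite (addrC a) subrK.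
  have S0 : 0 <= \sum_(j <oo) F j x by exact: nneseries_ge0.
  have [S|Sfin] := eqVneq (\sum_(j <oo) F j x) +oo; first by rewrite S leey.
  have {}Sfin : \sum_(j <oo) F j x \is a fin_num by rewrite ge0_fin_numE// lt_neqAle Sfin leey.
  rewrite -(fineK Sfin) lee_fin -subr_le0 -lee_fin.
  apply: (@le_trans _ _ (limn_einf (fun J => (u J x)%:E))); last by rewrite lx.
  rewrite limn_einf_lim.
  apply: lime_ge; first exact: is_cvg_einfs.
  apply: nearW => N; apply: le_ereal_inf_tmp => _ [J _ <-]; rewrite lee_fin.
  rewrite lerBlDr -lee_fin EFinD fineK//.
  apply: (@le_trans _ _ ((u J x)%:E + (normc (convolution f (LP_low J) x))%:E)).
    rewrite -EFinD lee_fin /u [leRHS]addrC; move: (convolution _ _ x) => a.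
    by have := normcB a (a - f x)%R; rewrite subKr.
  rewrite leeD2l//; apply: (le_trans (part J)); exact: nneseries_lim_ge.
apply: (@le_trans _ _ 'N[mu]_p[(fun x => \sum_(j <oo) F j x)]).
  apply: ae_le_Lnorm => //; first exact: cmeas_enormc.
    exact: ge0_emeasurable_sum.
  apply: filterS ptw => x h; rewrite !gee0_abs ?lee_fin ?normc_ge0//.
  exact: nneseries_ge0.
apply: (le_trans (Lnorm_nneseries p1 mF F0 _)).
  by move=> k; apply: nearW => x; exact: ltry.
by apply: lee_nneseries => // [j _ _|j _]; rewrite ?Lnorm_ge0// LP_pieceE.
Qed.

End littlewood_paley_decomposition.

Section mollification.
Context {R : realType} {n : nat}.
Local Notation mu := (@lebesgue_rV R n).
Local Notation V := 'rV[R]_n.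
Variables (zeta rho : V -> R[i]).
Hypotheses (hzeta : LP_generator zeta) (rhoi : cintegrable mu rho).
Implicit Types (f : V -> R[i]) (p : \bar R).

Let zi : cintegrable mu zeta := LP_cintegrable hzeta.
Let mz : cmeas zeta := zi.1.
Let mrho : cmeas rho := rhoi.1.

Definition trunc_moment (t : R) : \bar R :=
  (\int[mu]_y (Num.min 1 (t * enorm y) * normc (rho y))%:E)%E.

Lemma measurable_enorm : measurable_fun setT (@enorm R n).
Proof.
apply: (measurableT_comp (continuous_measurable_fun (@sqrt_continuous R))).
apply: measurable_sum => i.
by apply: measurable_funM; exact: measurable_rV_coord.
Qed.

Local Open Scope ereal_scope.

Lemma LP_low_mollification : cint mu rho = 1%R -> exists2 C : R, (0 <= C)%R &
  forall j (eps : R), (0 < eps)%R ->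
    Lp_norm 1%:E (fun y => LP_low zeta j y - convolution (LP_low zeta j) (dilate eps rho) y)%R <=
    C%:E * trunc_moment (2 ^+ j * eps).
Proof.
move=> rho1; have [C C0 hC] := schwartz_modulus (LP_schwartz hzeta).
exists C => // j eps eps0.
have lowi := cintegrable_LP_low hzeta j; have [mlow _] := lowi.
have reps := cintegrable_dilate eps0 rhoi; have [mreps _] := reps.
have := conv_diff_L1 lowi reps; rewrite cint_dilate1// rho1.
rewrite (_ : (fun x => (convolution _ _ x - _)%R) =
  (fun x => - (LP_low zeta j x - convolution (LP_low zeta j) (dilate eps rho) x))%R); last first.
  by apply/funext => x; rewrite mul1r opprB.
rewrite Lp_normN => h; apply: (le_trans h).
rewrite (@ge0_integral_dilate _ _ _ _ (L1_modulus (LP_low zeta j)))//; last 2 first.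
- exact: measurable_L1_modulus.
- by move=> y; exact: L1_modulus_ge0.
have m1 : measurable_fun setT (fun y : V => Num.min 1 (2 ^+ j * eps * enorm y))%R.
  apply: measurable_minr => //; apply: measurable_funM => //; exact: measurable_enorm.
rewrite /trunc_moment -ge0_integralZl_EFin//; last 2 first.
- move=> y _; rewrite lee_fin mulr_ge0 ?normc_ge0// le_min ler01 mulr_ge0 ?enorm_ge0//.
  by rewrite mulr_ge0 ?exprn_ge0 ?ltW.
- by apply/measurable_EFinP; apply: measurable_funM => //; exact: cmeas_normc.
apply: ge0_le_integral => //.
- by move=> y _; rewrite mule_ge0 ?L1_modulus_ge0// lee_fin normc_ge0.
- apply: emeasurable_funM; last exact: cmeas_enormc.
  exact: (measurableT_comp (measurable_L1_modulus mlow) (measurable_scale _)).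
- apply: measurable_funeM; apply/measurable_EFinP; apply: measurable_funM => //; exact: cmeas_normc.
- move=> y _; rewrite EFinM muleA lee_wpmul2r ?lee_fin ?normc_ge0//.
  rewrite L1_modulus_dilate ?LP_scale_gt0// invrK scalerA.
  by apply: (le_trans (hC _)); rewrite enormZ ger0_norm// mulr_ge0 ?exprn_ge0 ?ltW.
Qed.

Lemma LP_band_mollification : exists2 d0 : R, (0 < d0)%R &
  forall i (eps : R), (0 < eps)%R -> (2 ^- i <= d0 * eps)%R ->
    Lp_norm 1%:E (convolution (LP_band zeta i) (dilate eps rho)) <= (2^-1)%:E.
Proof.
pose X := fun x : V => (dilate 8^-1 zeta x - zeta x)%R.
have c8 : (0 < 8^-1 :> R)%R by rewrite invr_gt0.
have Xi : cintegrable mu X by apply: cintegrableB => //; exact: cintegrable_dilate.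
have [mX _] := Xi.
have bandE i : LP_band zeta i = dilate (2 ^- i) X.
  rewrite /LP_band /X dilateB dilate_comp /LP_low -invfM.
  by rewrite -addn3 exprD (_ : 2 ^+ 3 = 8 :> R)%R// -natrX.
have X0 : cint mu X = 0%R.
  by rewrite cintB// ?cint_dilate1// ?subrr//; exact: cintegrable_dilate.
have [d0 d00 hd] := @L1_modulus_small _ _ rho X 2^-1 ltac:(by rewrite invr_gt0) rhoi Xi.
exists d0 => // i eps eps0 hi.
have reps := cintegrable_dilate eps0 rhoi; have [mreps _] := reps.
have i0 := @LP_scale_gt0 R i.
have Xd := cintegrable_dilate i0 Xi.
rewrite bandE convC//; last by case: Xd.
have := conv_diff_L1 reps Xd; rewrite cint_dilate1// X0.
rewrite (_ : (fun x => (convolution _ _ x - _)%R) =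
  convolution (dilate eps rho) (dilate (2 ^- i) X)); last first.
  by apply/funext => x; rewrite mul0r subr0.
move=> h; apply: (le_trans h).
rewrite (@ge0_integral_dilate _ _ _ _ (L1_modulus (dilate eps rho)))//; last 2 first.
- exact: measurable_L1_modulus.
- by move=> y; exact: L1_modulus_ge0.
under eq_integral do rewrite L1_modulus_dilate// scalerA.
by apply: hd; rewrite mulr_gt0 ?invr_gt0//= mulrC ler_pdivrMr.
Qed.

Lemma LP_piece_mollification : cint mu rho = 1%R ->
  exists2 C : R, (0 <= C)%R & forall p f, 1 <= p -> in_Lp p f ->
  forall j (eps : R), (0 < eps)%R ->
  Lp_norm p (LP_piece zeta (f \- convolution f (dilate eps rho))%R j) <=
  Lp_norm p (LP_piece zeta f j) * (C%:E * trunc_moment (2 ^+ j.+1 * eps)).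
Proof.
move=> /LP_low_mollification[C C0 hC]; exists C => // p f p1 fp j eps eps0.
rewrite !LP_pieceE//.
apply: (le_trans (Lp_residual_le p1 fp (cintegrable_LP_kernel hzeta j)
  (cintegrable_LP_low hzeta j.+1) (cintegrable_dilate eps0 rhoi) (LP_kernel_conv_low hzeta j))).
by rewrite lee_wpmul2l ?Lp_norm_ge0// hC.
Qed.

Lemma LP_piece_le_mollification : exists2 d0 : R, (0 < d0)%R &
  forall p f, 1 <= p -> in_Lp p f -> forall i (eps : R), (0 < eps)%R -> (2 ^- i <= d0 * eps)%R ->
  Lp_norm p (LP_piece zeta f i.+2) <=
  4%:E * Lp_norm 1%:E zeta * Lp_norm p (f \- convolution f (dilate eps rho))%R.
Proof.
have [d0 d00 hd] := LP_band_mollification; exists d0 => // p f p1 fp i eps eps0 hi.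
have bandi : cintegrable mu (LP_band zeta i).
  by apply: cintegrableB; exact: cintegrable_LP_low.
rewrite !LP_pieceE//.
apply: (le_trans (Lp_piece_le_residual p1 fp (cintegrable_LP_kernel hzeta i.+2)
  bandi (cintegrable_dilate eps0 rhoi) (LP_kernel_conv_band hzeta i) (lexx _) (hd i eps eps0 hi))).
rewrite lee_wpmul2r ?Lp_norm_ge0//.
rewrite (_ : 4%:E = 2%:E * 2%:E :> \bar R); last by rewrite -EFinM -natrM.
by rewrite -muleA lee_wpmul2l ?Lp1_LP_kernel// lee_fin.
Qed.

End mollification.

Section dyadic_integral.
Context {R : realType}.
Local Notation lam := (@lebesgue_measure R).
Local Open Scope ereal_scope.

(* Measurability is not required: the integral of a nonnegative function is a
   supremum over simple functions. This is what makes the integral over eps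
   tractable without measurability of eps |-> ||f - f * rho_eps||_p. *)
Lemma ge0_subintegral_le d (T : measurableType d) (m : {measure set T -> \bar R})
    (D : set T) (f g : T -> \bar R) : (forall x, 0 <= f x) -> (forall x, D x -> f x <= g x) ->
  \int[m]_(x in D) f x <= \int[m]_(x in D) g x.
Proof.
move=> f0 fg; rewrite !ge0_integralE//; last first.
  by move=> x Dx; rewrite (le_trans (f0 x))// fg.
apply: le_ereal_sup => _ [h /= hf <-]; exists h => //= x; apply: (le_trans (hf x)).
by rewrite !patchE; case: ifPn => // xD; apply: fg; rewrite inE in xD.
Qed.

Definition dyadic_itv (k : nat) : set R := `[2 ^- k.+1, 2 ^- k[%classic.

Let pow_gt0 k : (0 < 2 ^- k :> R)%R. Proof. by rewrite invr_gt0 exprn_gt0. Qed.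

Let pow_le j k : (j <= k)%N -> (2 ^- k <= 2 ^- j :> R)%R.
Proof. by move=> jk; rewrite lef_pV2 ?posrE ?exprn_gt0// ler_eXn2l// ltr1n. Qed.

Lemma dyadic_itv_gt0 k x : dyadic_itv k x -> (0 < x)%R.
Proof. by rewrite /dyadic_itv /= in_itv/= => /andP[h _]; rewrite (lt_le_trans _ h). Qed.

Lemma dyadic_itv_inj j k x : dyadic_itv j x -> dyadic_itv k x -> j = k.
Proof.
wlog : j k / (j < k)%N.
  move=> h; case: (ltngtP j k) => // jk xj xk; [exact: h|].
  by apply/esym/(h k j).
move=> jk; rewrite /dyadic_itv /= !in_itv/= => /andP[h _] /andP[_ h'].
by have := lt_le_trans (le_lt_trans h h') (pow_le jk); rewrite ltxx.
Qed.

Lemma dyadic_itv_cover x : (0 < x < 1)%R -> exists k, dyadic_itv k x.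
Proof.
move=> /andP[x0 x1].
have ex : exists k, (2 ^- k.+1 <= x)%R.
  exists (Num.bound x^-1); rewrite invf_ple ?posrE ?exprn_gt0//.
  apply: (le_trans (ltW (archi_boundP _))); first by rewrite invr_ge0 ltW.
  rewrite -natrX ler_nat (leq_trans (ltnW (ltn_expl _ (ltnSn 1))))//.
  by rewrite leq_exp2l.
exists (ex_minn ex); case: ex_minnP => k hk kmin; rewrite /dyadic_itv /= in_itv/= hk/=.
case: k hk kmin => [|k] hk kmin; first by rewrite expr0 invr1.
by rewrite ltNge; apply/negP => /kmin; rewrite ltnn.
Qed.

Lemma dyadic_itv_sub k : dyadic_itv k `<=` `]0%R, 1%R[%classic.
Proof.
move=> x xk; rewrite /= in_itv/= (dyadic_itv_gt0 xk)/=.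
move: xk; rewrite /dyadic_itv /= in_itv/= => /andP[_ h].
by rewrite (lt_le_trans h)// (le_trans (pow_le (leq0n k)))// expr0 invr1.
Qed.

Lemma lebesgue_dyadic_itv k : lam (dyadic_itv k) = (2 ^- k.+1)%:E.
Proof.
rewrite lebesgue_measure_itv/= lte_fin ltf_pV2 ?posrE ?exprn_gt0// ltr_eXn2l ?ltr1n//.
rewrite ltnSn -EFinB; congr EFin; rewrite exprS invfM; set a := (2 ^- k)%R; lra.
Qed.

Let step (c : nat -> \bar R) (k : nat) : R -> \bar R := (cst (c k)) \_ (dyadic_itv k).

Let mstep c k D : measurable D -> measurable_fun D (step c k).
Proof.
move=> mD; apply/(measurable_restrict _ (measurable_itv _) mD).
exact: measurable_cst.
Qed.

Let integral_step c k : \int[lam]_(x in `]0%R, 1%R[) step c k x = (2 ^- k.+1)%:E * c k.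
Proof.
rewrite /step -integral_mkcondr setIidr; last exact: dyadic_itv_sub.
transitivity (c k * lam (dyadic_itv k)); last by rewrite lebesgue_dyadic_itv muleC.
exact: (integral_cst lam (measurable_itv _)).
Qed.

Let step_ge0 c k x : (forall k, 0 <= c k) -> 0 <= step c k x.
Proof. by move=> c0; rewrite /step patchE; case: ifP => // _; exact: c0. Qed.

Lemma integral_le_dyadic (F : R -> \bar R) (c : nat -> \bar R) :
  (forall x, 0 <= F x) -> (forall k, 0 <= c k) ->
  (forall k x, dyadic_itv k x -> F x <= c k) ->
  \int[lam]_(x in `]0%R, 1%R[) F x <= \sum_(k <oo) (2 ^- k.+1)%:E * c k.
Proof.
move=> F0 c0 Fc.
have m01 : measurable (`]0%R, 1%R[%classic : set R) by exact: measurable_itv.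
apply: (@le_trans _ _ (\int[lam]_(x in `]0%R, 1%R[) \sum_(k <oo) step c k x)).
  apply: ge0_subintegral_le => // x; rewrite /= in_itv/= => /dyadic_itv_cover[k xk].
  apply: (le_trans (Fc _ _ xk)).
  apply: (@le_trans _ _ (\sum_(0 <= i < k.+1) step c i x)).
    rewrite big_nat_recr//=; have -> : step c k x = c k by rewrite /step patchE mem_set.
    by rewrite leeDr// sume_ge0// => i _; exact: step_ge0.
  by apply: nneseries_lim_ge => i _ _; exact: step_ge0.
rewrite integral_nneseries//.
- by rewrite le_eqVlt; apply/orP; left; apply/eqP; apply: eq_eseriesr => k _; exact: integral_step.
- by move=> k; exact: mstep.
- by move=> k x _; exact: step_ge0.
Qed.

Lemma dyadic_le_integral (F : R -> \bar R) (c : nat -> \bar R) :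
  (forall x, 0 <= F x) -> (forall k, 0 <= c k) ->
  (forall k x, dyadic_itv k x -> c k <= F x) ->
  \sum_(k <oo) (2 ^- k.+1)%:E * c k <= \int[lam]_(x in `]0%R, 1%R[) F x.
Proof.
move=> F0 c0 Fc.
have m01 : measurable (`]0%R, 1%R[%classic : set R) by exact: measurable_itv.
apply: (@le_trans _ _ (\int[lam]_(x in `]0%R, 1%R[) \sum_(k <oo) step c k x)); last first.
  apply: ge0_subintegral_le => [x|x _]; first by apply: nneseries_ge0 => k _ _; exact: step_ge0.
  apply: lime_le; first by apply: is_cvg_nneseries => k _ _; exact: step_ge0.
  apply: nearW => N.
  have [[k xk]|nk] := pselect (exists k, dyadic_itv k x).
    rewrite (eq_bigr (fun i => if i == k then c k else 0)); last first.
      move=> i _; rewrite /step patchE; case: ifPn => [/set_mem xi|/negP xi].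
        by rewrite (dyadic_itv_inj xi xk) eqxx.
      by case: eqP => // ik; case: xi; rewrite ik; apply/mem_set.
    rewrite -big_mkcond big_nat1_eq; case: ifP => // _; exact: Fc.
  rewrite big1 ?F0// => i _; rewrite /step patchE; case: ifPn => // /set_mem xi.
  by case: nk; exists i.
rewrite integral_nneseries//.
- by rewrite le_eqVlt; apply/orP; left; apply/eqP; apply: eq_eseriesr => k _; rewrite integral_step.
- by move=> k; exact: mstep.
- by move=> k x _; exact: step_ge0.
Qed.

End dyadic_integral.

Lemma powRVl {R : realType} (a s : R) : 0 < a -> a^-1 `^ s = (a `^ s)^-1.
Proof. by move=> a0; rewrite -powR_inv1 ?ltW// -powRrM mulN1r powRN. Qed.

Section besov_equivalence.
Context {R : realType} {n : nat}.
Local Notation mu := (@lebesgue_rV R n).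
Local Notation V := 'rV[R]_n.
Variables (zeta rho : V -> R[i]) (s : R).
Hypotheses (hzeta : LP_generator zeta) (rhoi : cintegrable mu rho).
Hypotheses (s_gt0 : 0 < s) (s_lt1 : s < 1).
Implicit Types (f : V -> R[i]) (p : \bar R) (q : R).

Let mrho : cmeas rho := rhoi.1.

Let min_ge0 (t r : R) : 0 <= t -> 0 <= r -> 0 <= Num.min 1 (t * r).
Proof. by move=> t0 r0; rewrite le_min ler01 mulr_ge0. Qed.

Let pow2 (j : nat) : 0 < 2 ^+ j :> R. Proof. by rewrite exprn_gt0. Qed.

Local Open Scope ereal_scope.

Let measurable_trunc (t : R) :
  measurable_fun setT (fun y : V => (Num.min 1 (t * enorm y) * normc (rho y))%:E).
Proof.
apply/measurable_EFinP; apply: measurable_funM; last exact: cmeas_normc.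
by apply: measurable_minr => //; apply: measurable_funM => //; exact: measurable_enorm.
Qed.

Let trunc_ge0 (t : R) (y : V) : (0 <= t)%R ->
  0 <= (Num.min 1 (t * enorm y) * normc (rho y))%:E.
Proof. by move=> t0; rewrite lee_fin mulr_ge0 ?normc_ge0// min_ge0 ?enorm_ge0. Qed.

Lemma trunc_moment_ge0 (t : R) : (0 <= t)%R -> 0 <= trunc_moment rho t.
Proof. by move=> t0; apply: integral_ge0 => y _; exact: trunc_ge0. Qed.

Lemma trunc_moment_fin (t : R) : (0 <= t)%R -> trunc_moment rho t \is a fin_num.
Proof.
move=> t0; rewrite ge0_fin_numE ?trunc_moment_ge0//.
apply: le_lt_trans rhoi.2; apply: ge0_le_integral => //.
- by move=> y _; exact: trunc_ge0.
- exact: cmeas_enormc.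
- by move=> y _; rewrite lee_fin ler_piMl ?normc_ge0// ge_min lexx.
Qed.

Lemma le_trunc_moment (t t' : R) : (0 <= t <= t')%R -> trunc_moment rho t <= trunc_moment rho t'.
Proof.
move=> /andP[t0 tt']; have t'0 := le_trans t0 tt'.
apply: ge0_le_integral => //.
- by move=> y _; exact: trunc_ge0.
- move=> y _; rewrite lee_fin ler_wpM2r ?normc_ge0// le_min !ge_min lexx/=.
  by rewrite ler_wpM2r ?orbT// enorm_ge0.
Qed.

Lemma dyadic_trunc_moment_le (c : R) (N : nat) : (0 < c)%R ->
  \sum_(0 <= i < N) ((2 ^+ i * c) `^ (- s))%:E * trunc_moment rho (2 ^+ i * c) <=
  (dyadic_const s)%:E * \int[mu]_y ((enorm y) `^ s * normc (rho y))%:E.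
Proof.
move=> c0; have t0 i : (0 <= 2 ^+ i * c)%R by rewrite mulr_ge0 ?exprn_ge0 ?ltW.
have D0 := dyadic_const_ge0 s_gt0 s_lt1.
have g0 i (y : V) : 0 <= ((2 ^+ i * c) `^ (- s))%:E * (Num.min 1 (2 ^+ i * c * enorm y) * normc (rho y))%:E.
  by rewrite mule_ge0 ?trunc_ge0// lee_fin powR_ge0.
have m1 : measurable_fun setT (fun y : V => ((enorm y) `^ s * normc (rho y))%:E).
  apply/measurable_EFinP; apply: measurable_funM; last exact: cmeas_normc.
  exact: (measurableT_comp (measurable_powR s) measurable_enorm).
have h0 (y : V) : (0 <= (enorm y) `^ s * normc (rho y))%R by rewrite mulr_ge0 ?normc_ge0 ?powR_ge0.
rewrite (eq_bigr (fun i => \int[mu]_y (((2 ^+ i * c) `^ (- s))%:E *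
    (Num.min 1 (2 ^+ i * c * enorm y) * normc (rho y))%:E))); last first.
  move=> i _; rewrite ge0_integralZl_EFin ?powR_ge0// => y _; exact: trunc_ge0.
rewrite -ge0_integral_sum//; last by move=> i; apply: measurable_funeM.
rewrite -ge0_integralZl_EFin//; last by move=> y _; rewrite lee_fin.
apply: ge0_le_integral => //.
- by move=> y _; apply: sume_ge0.
- by apply: emeasurable_sum => i; apply: measurable_funeM.
- exact: measurable_funeM.
- move=> y _; rewrite (eq_bigr (fun i =>
    ((2 ^+ i * c) `^ (- s) * Num.min 1 (2 ^+ i * c * enorm y) * normc (rho y))%:E)).
    rewrite sumEFin -mulr_suml lee_fin mulrA ler_wpM2r ?normc_ge0//.
    exact: dyadic_sum_le (enorm_ge0 y).
  by move=> i _; rewrite -EFinM mulrA.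
Qed.

Let N p f (j : nat) : R := fine (Lp_norm p (LP_piece zeta f j)).

Let N_ge0 p f j : (0 <= N p f j)%R. Proof. by rewrite fine_ge0// Lp_norm_ge0. Qed.

Let NE p f j : 1 <= p -> in_Lp p f -> (N p f j)%:E = Lp_norm p (LP_piece zeta f j).
Proof.
move=> p1 fp; rewrite fineK// LP_pieceE// in_Lp_fin//.
by apply: in_Lp_conv => //; exact: cintegrable_LP_kernel.
Qed.

Lemma pow2_weight (j : nat) q : (2 `^ (s * j%:R * q) = ((2 ^+ j) `^ s) `^ q)%R.
Proof. by rewrite powRrM (mulrC s) powRrM powR_mulrn. Qed.

Lemma besov_seminormE p q f : 1 <= p -> in_Lp p f ->
  besov_seminorm_pow zeta s p q f = \sum_(j <oo) (((2 ^+ j) `^ s * N p f j) `^ q)%:E.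
Proof.
move=> p1 fp; apply: eq_eseriesr => j _.
by rewrite -NE// pow2_weight poweR_EFin -EFinM powRM// powR_ge0.
Qed.

Let I p q f := \int[lebesgue_measure]_(eps in `]0%R, 1%R[)
  (((eps `^ (s * q + 1))^-1)%:E *
   (Lp_norm p (f \- convolution f (dilate eps rho))%R) `^ q).

Lemma mollifier_le_seminorm p q : 1 <= p -> (1 <= q)%R -> cint mu rho = 1%R ->
  \int[mu]_y ((enorm y) `^ s * normc (rho y))%:E < +oo ->
  exists2 C : R, (0 <= C)%R & forall f, in_Lp p f ->
    I p q f <= C%:E * besov_seminorm_pow zeta s p q f.
Proof.
move=> p1 q1 rho1 moment; have q0 : (0 < q)%R by rewrite (lt_le_trans _ q1).
have [C C0 hC] := LP_piece_mollification hzeta rhoi rho1.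
have M0 : 0 <= \int[mu]_y ((enorm y) `^ s * normc (rho y))%:E.
  by apply: integral_ge0 => y _; rewrite lee_fin mulr_ge0 ?normc_ge0 ?powR_ge0.
pose A := (dyadic_const s * fine (\int[mu]_y ((enorm y) `^ s * normc (rho y))%:E)%E)%R.
have A0 : (0 <= A)%R by rewrite mulr_ge0 ?dyadic_const_ge0 ?fine_ge0.
have AE : A%:E = (dyadic_const s)%:E * \int[mu]_y ((enorm y) `^ s * normc (rho y))%:E.
  by rewrite EFinM fineK// ge0_fin_numE.
pose t (k j : nat) : R := (2 ^+ j.+1 / 2 ^+ k)%R.
have t0 k j : (0 < t k j)%R by rewrite divr_gt0.
pose K k j : R := ((t k j) `^ (- s) * fine (trunc_moment rho (t k j)))%R.
have K0 k j : (0 <= K k j)%R by rewrite mulr_ge0 ?powR_ge0// fine_ge0// trunc_moment_ge0// ltW.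
have KE k j : (K k j)%:E = ((t k j) `^ (- s))%:E * trunc_moment rho (t k j).
  by rewrite EFinM fineK// trunc_moment_fin// ltW.
have Krow k : \sum_(j <oo) (K k j)%:E <= A%:E.
  apply: lime_le; first by apply: is_cvg_nneseries => j _ _; rewrite lee_fin.
  apply: nearW => L; rewrite AE.
  apply: (le_trans _ (@dyadic_trunc_moment_le (2 / 2 ^+ k) L _)); last by rewrite divr_gt0.
  rewrite le_eqVlt; apply/orP; left; apply/eqP; apply: eq_bigr => j _.
  by rewrite KE /t exprSr mulrA.
have Kcol j : \sum_(k <oo) (K k j)%:E <= A%:E.
  apply: lime_le; first by apply: is_cvg_nneseries => k _ _; rewrite lee_fin.
  apply: nearW => L; rewrite AE.
  apply: (le_trans _ (@dyadic_trunc_moment_le (2 ^+ j.+1 / 2 ^+ L * 2) L _)); last first.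
    by rewrite mulr_gt0// divr_gt0.
  rewrite big_nat_rev/= add0n.
  rewrite le_eqVlt; apply/orP; left; apply/eqP; apply: eq_big_nat => i /andP[_ iL].
  have -> : (2 ^+ i * (2 ^+ j.+1 / 2 ^+ L * 2))%R = t (L - i.+1)%N j.
    rewrite /t -{1}(subnK iL) exprD !exprS.
    have := pow2 i; have := pow2 (L - i.+1); move: (2 ^+ i)%R (2 ^+ (L - i.+1))%R => a b a0 b0.
    by field; rewrite !gt_eqF.
  exact: KE.
exists ((A * (4 `^ s * C)) `^ q)%R; first exact: powR_ge0.
move=> f fp; rewrite besov_seminormE//.
pose b (j : nat) : R := (4 `^ s * C * ((2 ^+ j) `^ s * N p f j))%R.
have b0 j : (0 <= b j)%R by rewrite !mulr_ge0 ?powR_ge0.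
pose S k := \sum_(j <oo) (K k j * b j)%:E.
have S0 k : 0 <= S k by apply: nneseries_ge0 => j _ _; rewrite lee_fin mulr_ge0.
have key : I p q f <= \sum_(k <oo) (S k) `^ q.
  rewrite (_ : \sum_(k <oo) (S k) `^ q = \sum_(k <oo) (2 ^- k.+1)%:E * ((2 ^+ k.+1)%:E * (S k) `^ q)); last first.
    apply: eq_eseriesr => k _; rewrite muleA -EFinM mulVf ?mul1e// gt_eqF//.
  apply: integral_le_dyadic.
  - by move=> e; rewrite mule_ge0 ?poweR_ge0// lee_fin invr_ge0 powR_ge0.
  - by move=> k; rewrite mule_ge0 ?poweR_ge0// lee_fin.
  - move=> k e ek; have e0 := dyadic_itv_gt0 ek.
    move: (ek); rewrite /dyadic_itv /= in_itv/= => /andP[ek1 ek2].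
    have fd : in_Lp p (f \- convolution f (dilate e rho))%R.
      by apply: in_LpB => //; apply: in_Lp_conv => //; exact: cintegrable_dilate.
    have T : Lp_norm p (f \- convolution f (dilate e rho))%R <=
        ((2 ^+ k.+1) `^ (- s))%:E * S k.
      apply: (le_trans (LP_norm_le hzeta p1 fd)).
      rewrite /S -nneseriesZl; last by move=> j _; rewrite lee_fin mulr_ge0.
      apply: lee_nneseries => [j _ _|j _]; first exact: Lp_norm_ge0.
      apply: (le_trans (hC p f p1 fp j e e0)); rewrite -NE//.
      have tle : (0 <= 2 ^+ j.+1 * e <= t k j)%R.
        rewrite mulr_ge0 ?(ltW e0) ?(ltW (pow2 _))//= /t ler_wpM2l ?(ltW (pow2 _))//.
        exact: ltW.
      apply: (@le_trans _ _ ((N p f j)%:E * (C%:E * trunc_moment rho (t k j)))).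
        by rewrite !lee_wpmul2l ?lee_fin// le_trunc_moment.
      rewrite -(fineK (trunc_moment_fin (ltW (t0 k j)))) -!EFinM lee_fin /K /b.
      move: (fine (trunc_moment _ _)) => m.
      have s2 : (0 < 2 `^ s :> R)%R by rewrite powR_gt0.
      have s4 : (4 `^ s = 2 `^ s * 2 `^ s :> R)%R by rewrite -powRM// -natrM.
      have Xk : (0 < (2 ^+ k) `^ s :> R)%R by rewrite powR_gt0.
      have Xj : (0 < (2 ^+ j) `^ s :> R)%R by rewrite powR_gt0.
      rewrite !powRN /t powRM ?invr_ge0 ?(ltW (pow2 _))// powRVl//.
      rewrite !exprS !powRM ?(ltW (pow2 _))// s4.
      move: ((2 ^+ k) `^ s)%R ((2 ^+ j) `^ s)%R (2 `^ s)%R (N p f j) Xk Xj s2 => x y z N' x0 y0 z0.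
      rewrite le_eqVlt; apply/orP; left; apply/eqP.
      by field; rewrite !gt_eqF.
    have Tq := le_poweR (ltW q0) (Lp_norm_ge0 _ _) T.
    apply: (le_trans (lee_wpmul2l _ Tq)); first by rewrite lee_fin invr_ge0 powR_ge0.
    rewrite poweRM ?lee_fin ?powR_ge0// poweR_EFin muleA -EFinM.
    rewrite lee_wpmul2r ?poweR_ge0// lee_fin.
    have pk := pow2 k.+1.
    have h : ((2 ^- k.+1) `^ (s * q + 1) <= e `^ (s * q + 1))%R.
      apply: ge0_ler_powR; rewrite ?nnegrE ?invr_ge0 ?(ltW pk) ?(ltW e0)//.
      by rewrite addr_ge0 ?mulr_ge0 ?(ltW s_gt0) ?(ltW q0).
    apply: (@le_trans _ _ (((2 ^- k.+1) `^ (s * q + 1))^-1 * ((2 ^+ k.+1) `^ (- s)) `^ q)%R).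
      by rewrite ler_wpM2r ?powR_ge0// lef_pV2// posrE powR_gt0// invr_gt0.
    rewrite powRVl// invrK -powRrM mulNr -powRD ?(gt_eqF pk) ?implybT//.
    by rewrite addrAC subrr add0r powRr1// ltW.
apply: (le_trans key); apply: (le_trans (schur_test q1 A0 K0 b0 Krow Kcol)).
have sC0 : (0 <= 4 `^ s * C)%R by rewrite mulr_ge0 ?powR_ge0.
rewrite (powRM q A0 sC0) EFinM -muleA lee_wpmul2l ?lee_fin ?powR_ge0//.
rewrite -nneseriesZl; last by move=> j _; rewrite lee_fin powR_ge0.
rewrite le_eqVlt; apply/orP; left; apply/eqP; apply: eq_eseriesr => j _.
by rewrite -EFinM /b powRM// mulr_ge0 ?powR_ge0.
Qed.

Lemma seminorm_le_mollifier p q : 1 <= p -> (1 <= q)%R ->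
  exists2 C : R, (0 <= C)%R & forall f, in_Lp p f ->
    besov_seminorm_pow zeta s p q f <= C%:E * ((Lp_norm p f) `^ q + I p q f).
Proof.
move=> p1 q1; have q0 : (0 < q)%R by rewrite (lt_le_trans _ q1).
have [d0 d00 hd] := LP_piece_le_mollification hzeta rhoi.
have [a ha] : exists a : nat, (2 ^- a <= d0)%R.
  exists (Num.bound d0^-1); rewrite invf_ple ?posrE ?exprn_gt0//.
  apply: (le_trans (ltW (archi_boundP _))); first by rewrite invr_ge0 ltW.
  by rewrite -natrX ler_nat (leq_trans (ltnW (ltn_expl _ (ltnSn 1)))).
have zi := LP_cintegrable hzeta.
have z1 : in_Lp 1%:E zeta by apply/in_L1P.
pose Z := fine (Lp_norm 1%:E zeta).
have Z0 : (0 <= Z)%R by rewrite fine_ge0// Lp_norm_ge0.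
have ZE : Z%:E = Lp_norm 1%:E zeta by rewrite fineK// in_Lp_fin.
pose D : R := (4 * Z + 1)%R.
have D0 : (0 < D)%R by rewrite ltr_wpDl// mulr_ge0.
pose B : R := (\sum_(0 <= j < a.+3) ((2 ^+ j) `^ s * (2 * Z)) `^ q)%R.
have B0 : (0 <= B)%R by rewrite sumr_ge0// => j _; exact: powR_ge0.
pose M : R := (2 * ((2 ^+ a.+3) `^ s * D) `^ q)%R.
have M0 : (0 <= M)%R by rewrite mulr_ge0// powR_ge0.
exists (B + M)%R; first exact: addr_ge0.
move=> f fp; rewrite besov_seminormE//.
have L0 : 0 <= (Lp_norm p f) `^ q by exact: poweR_ge0.
have I0 : 0 <= I p q f.
  by apply: integral_ge0 => e _; rewrite mule_ge0 ?poweR_ge0// lee_fin invr_ge0 powR_ge0.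
have S0 j : 0 <= (((2 ^+ j) `^ s * N p f j) `^ q)%:E by rewrite lee_fin powR_ge0.
rewrite (nneseries_split 0 a.+3)// add0n -nneseries_addn//.
have low : \sum_(0 <= j < a.+3) (((2 ^+ j) `^ s * N p f j) `^ q)%:E <= B%:E * (Lp_norm p f) `^ q.
  have Lfin := in_Lp_fin fp; rewrite -(fineK Lfin) poweR_EFin -EFinM sumEFin lee_fin.
  have l0 : (0 <= fine (Lp_norm p f))%R by rewrite fine_ge0// Lp_norm_ge0.
  rewrite mulr_suml; apply: ler_sum => j _; rewrite -powRM ?mulr_ge0 ?powR_ge0//.
  apply: ge0_ler_powR; rewrite ?nnegrE ?(ltW q0) ?mulr_ge0 ?powR_ge0//.
  rewrite -mulrA ler_wpM2l ?powR_ge0// -lee_fin NE// EFinM fineK// EFinM ZE.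
  rewrite LP_pieceE muleC; have [mf _] := fp.
  apply: (le_trans (Lp_conv_le p1 mf (cintegrable_LP_kernel hzeta j))).
  by rewrite lee_wpmul2l ?Lp_norm_ge0// Lp1_LP_kernel.
have high : \sum_(k <oo) (((2 ^+ (k + a.+3)) `^ s * N p f (k + a.+3)) `^ q)%:E <= M%:E * I p q f.
  pose c k : \bar R := (2 ^+ k * ((2 ^+ k) `^ s * (N p f (k + a.+3) / D)) `^ q)%:E.
  have c0 k : 0 <= c k by rewrite lee_fin mulr_ge0 ?exprn_ge0 ?powR_ge0.
  have E k : (((2 ^+ (k + a.+3)) `^ s * N p f (k + a.+3)) `^ q)%:E =
      M%:E * ((2 ^- k.+1)%:E * c k).
    rewrite -!EFinM; congr EFin.
    rewrite exprD (powRM s (ltW (pow2 k)) (ltW (pow2 a.+3))).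
    have -> : ((2 ^+ k) `^ s * (2 ^+ a.+3) `^ s * N p f (k + a.+3) =
      (2 ^+ a.+3) `^ s * D * ((2 ^+ k) `^ s * (N p f (k + a.+3) / D)))%R.
      by field; rewrite gt_eqF.
    rewrite [LHS]powRM ?mulr_ge0 ?powR_ge0 ?invr_ge0 ?(ltW D0)// /M (exprS 2 k).
    have := pow2 k; move: (2 ^+ k)%R (_ `^ q)%R (_ `^ q)%R => x y z x0.
    by field; rewrite gt_eqF.
  rewrite (eq_eseriesr (fun k _ => E k)) nneseriesZl; last first.
    by move=> k _; rewrite mule_ge0.
  rewrite lee_wpmul2l ?lee_fin//; apply: dyadic_le_integral => //.
    by move=> e; rewrite mule_ge0 ?poweR_ge0// lee_fin invr_ge0 powR_ge0.
  move=> k e ek; have e0 := dyadic_itv_gt0 ek.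
  move: (ek); rewrite /dyadic_itv /= in_itv/= => /andP[ek1 ek2].
  have u1 : in_Lp p (f \- convolution f (dilate e rho))%R.
    by apply: in_LpB => //; apply: in_Lp_conv => //; exact: cintegrable_dilate.
  have hi : (2 ^- (k.+1 + a) <= d0 * e)%R.
    rewrite exprD invfM mulrC; apply: ler_pM => //; by rewrite invr_ge0 exprn_ge0.
  have := hd p f p1 fp (k.+1 + a)%N e e0 hi.
  rewrite (_ : (k.+1 + a).+2 = (k + a.+3))%N; last by rewrite addSn !addnS.
  rewrite -NE// -ZE -(fineK (in_Lp_fin u1)) -!EFinM lee_fin => h.
  rewrite /c lee_fin.
  have T0 : (0 <= fine (Lp_norm p (f \- convolution f (dilate e rho))%R))%R.
    by rewrite fine_ge0// Lp_norm_ge0.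
  move: (fine _) T0 h => T T0 h.
  have pk := pow2 k.
  rewrite powRM ?powR_ge0 ?divr_ge0 ?(ltW D0)// mulrA; apply: ler_pM.
  - by rewrite mulr_ge0 ?powR_ge0// ltW.
  - exact: powR_ge0.
  - have -> : (2 ^+ k * ((2 ^+ k) `^ s) `^ q = ((2 ^- k) `^ (s * q + 1))^-1)%R.
      rewrite powRVl// invrK powRD ?(gt_eqF pk) ?implybT// powRrM powRr1 ?(ltW pk)//.
      by rewrite mulrC.
    rewrite lef_pV2 ?posrE ?powR_gt0 ?invr_gt0//.
    apply: ge0_ler_powR; rewrite ?nnegrE ?invr_ge0 ?(ltW pk) ?(ltW e0) ?(ltW ek2)//.
    by rewrite addr_ge0 ?mulr_ge0 ?(ltW s_gt0) ?(ltW q0).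
  - apply: ge0_ler_powR; rewrite ?nnegrE ?(ltW q0) ?divr_ge0 ?(ltW D0)//.
    by rewrite ler_pdivrMr// (le_trans h)// mulrC ler_wpM2l// lerDl.
apply: (le_trans (leeD low high)).
rewrite EFinD ge0_muleDl ?lee_fin//; apply: leeD.
- by rewrite lee_wpmul2l ?lee_fin// leeDl.
- by rewrite lee_wpmul2l ?lee_fin// leeDr.
Qed.

End besov_equivalence.

Theorem proposition1p5 (R : realType) (n : nat) (n_gt0 : (0 < n)%N)
    (zeta : 'rV[R]_n -> R[i]) (hzeta : LP_generator zeta)
    (rho : 'rV[R]_n -> R[i]) (rhoL1 : in_Lp 1%:E rho)
    (rho1 : cintegral rho = 1)
    (s : R) (s_gt0 : 0 < s) (s_lt1 : s < 1)
    (moment : (\int[lebesgue_rV n]_y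
                 ((enorm y) `^ s * Normc.normc (rho y))%:E < +oo)%E) :
  characterizes_besov zeta rho s.
Proof.
move=> p q p1 q1.
have rhoi : cintegrable (@lebesgue_rV R n) rho by apply/in_L1P.
have [C1 C10 h1] := mollifier_le_seminorm hzeta rhoi s_gt0 s_lt1 p1 q1 rho1 moment.
have [C2 C20 h2] := seminorm_le_mollifier hzeta rhoi s_gt0 p1 q1.
exists (1 + (C1 + C2)); split; first by rewrite lerDl addr_ge0.
move=> f fp; have L0 : (0 <= Lp_norm p f `^ q)%E by exact: poweR_ge0.
have S0 : (0 <= besov_seminorm_pow zeta s p q f)%E.
  by apply: nneseries_ge0 => j _ _; rewrite mule_ge0 ?poweR_ge0// lee_fin powR_ge0.
have I0 : (0 <= mollifier_pow rho s p q f)%E.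
  rewrite adde_ge0//; apply: integral_ge0 => e _.
  by rewrite mule_ge0 ?poweR_ge0// lee_fin invr_ge0 powR_ge0.
have B0 : (0 <= besov_norm_pow zeta s p q f)%E by rewrite adde_ge0.
have C0 := addr_ge0 C10 C20.
rewrite EFinD !ge0_muleDl ?lee_fin// !mul1e; split.
- apply: leeD.
    rewrite /mollifier_pow leeDl//; apply: integral_ge0 => e _.
    by rewrite mule_ge0 ?poweR_ge0// lee_fin invr_ge0 powR_ge0.
  apply: (le_trans (h2 f fp)); rewrite lee_wpmul2r ?lee_fin ?lerDr//.
- apply: leeD; first by rewrite /besov_norm_pow leeDl.
  apply: (le_trans (h1 f fp)).
  apply: (@le_trans _ _ (C1%:E * besov_norm_pow zeta s p q f)%E).
    by rewrite lee_wpmul2l ?lee_fin// leeDr.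
  by rewrite lee_wpmul2r ?lee_fin ?lerDl.
Qed.
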